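(* Let $d$ be a constant and let $\mathcal{P}$ be a set of $n$ points in $\mathbb{R}^d$ in general position in the existential uncertainty model, with $p_v\in(0,1)$ for all $v$. The convex polytope $M=\sum_{P\sim\mathcal{P}}\Pr[P]\,\mathrm{ConvH}(P)$, which satisfies $f(M,u)=f(\mathcal{P},u)$ for every direction $u$, can be described with $O(n^{2d-2})$ vertices in $\mathbb{R}^d$ and can be computed in $O(n^{2d-1}\log n)$ time. In $\mathbb{R}^2$ the running time can be improved to $O(n^2\log n)$.
   Context: Existential uncertainty model: each $v\in\mathcal{P}$ is present in a random realization $P\sim\mathcal{P}$ independently with probability $p_v$; $\Pr[P]$ is the probability of realization $P$. $\mathrm{ConvH}(P)$ is the convex hull of $P$; $M$ is the weighted Minkowski sum of these hulls over all realizations. For a set $K$, $f(K,u)=\sup_{x\in K}\langle u,x\rangle$; for stochastic $\mathcal{P}$, $f(\mathcal{P},u)=\mathbb{E}_{P\sim\mathcal{P}}[f(P,u)]$ with $f(\emptyset,u)=0$. *)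

(* Defs.v *)
From HB Require Import structures.
From mathcomp Require Import all_boot all_order all_algebra.
From mathcomp Require Import all_classical all_reals all_analysis.

Set Implicit Arguments.
Unset Strict Implicit.
Unset Printing Implicit Defensive.

Import Order.TTheory GRing.Theory Num.Theory.
Import numFieldNormedType.Exports.

Local Open Scope classical_set_scope.
Local Open Scope ring_scope.

(** * Convex geometry in R^d *)

Section Geometry.
Variables (R : realType) (d : nat).
Implicit Types (K S : set 'rV[R]_d) (u x y z : 'rV[R]_d).

Definition dot u x : R := \sum_j u 0 j * x 0 j.

(* [sup] is the supremum in [R]; it is meaningful for nonempty sets that are
   bounded in the direction [u]. *)
Definition support_fun K u : R := sup [set dot u x | x in K].

Definition conv_hull S : set 'rV[R]_d :=
  smallest (fun A : set 'rV[R]_d => convex_set A) S.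

Definition is_polytope K : Prop :=
  exists s : seq 'rV[R]_d, K = conv_hull [set` s].

Definition is_vertex K x : Prop :=
  K x /\ forall y z (t : R), K y -> K z -> 0 < t < 1 ->
    x = t *: y + (1 - t) *: z -> y = x /\ z = x.

(* [s] lists the vertices of the polytope [K], each of them once. *)
Definition vertex_description K (s : seq 'rV[R]_d) : Prop :=
  [/\ uniq s, forall x, x \in s <-> is_vertex K x & K = conv_hull [set` s]].

End Geometry.

(** * Stochastic point sets, existential uncertainty *)

Section Stochastic.
Variables (R : realType) (d n : nat).
(* The points, and their probabilities of being present. *)
Variables (v : 'I_n -> 'rV[R]_d) (p : 'I_n -> R).
Implicit Types (P : {set 'I_n}) (u : 'rV[R]_d).

(* No hyperplane contains more than [d] of the points. *)
Definition general_position : Prop :=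
  forall (a : 'rV[R]_d) (b : R), a != 0 ->
    (#|[set i | dot a (v i) == b]%SET| <= d)%N.

Definition stochastic_instance : Prop :=
  [/\ injective v, general_position & forall i, 0 < p i < 1].

Definition prob_realization P : R :=
  (\prod_(i in P) p i) * \prod_(i in ~: P) (1 - p i).

Definition realized P : set 'rV[R]_d := [set v i | i in [set` P]].

(* f(P, u), with f(set0, u) = 0. *)
Definition realization_support P u : R :=
  if P == finset.set0 then 0 else support_fun (realized P) u.

Definition expected_support u : R :=
  \sum_(P : {set 'I_n}) prob_realization P * realization_support P u.

(* The empty realization contributes {0} to the Minkowski sum, in accordance
   with f(set0, u) = 0; the convex hull of the empty set is empty and would make
   the whole sum empty. *)
Definition ConvH P : set 'rV[R]_d :=
  if P == finset.set0 then [set 0] else conv_hull (realized P).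

Definition expected_hull : set 'rV[R]_d :=
  [set x | exists2 y : {set 'I_n} -> 'rV[R]_d,
     forall P, ConvH P (y P) &
     x = \sum_(P : {set 'I_n}) prob_realization P *: y P].

End Stochastic.

(** * Real RAM

  Programs are finite texts over finitely many named unbounded arrays of natural
  numbers and of real numbers ([a : nat] names an array, cell 0 serves as a
  scalar variable).  Every memory access, arithmetic operation, comparison,
  assignment and branching costs one unit.  Reals are only accessible
  through + - * / and comparison: there is no rounding of reals to integers, and
  the only constants are natural numbers.  There is no multiplication on
  indices, so that unit cost does not give access to huge integers. *)

Inductive iexp : Type :=
| INum of nat
| IGet of nat & iexp
| IAdd of iexp & iexp
| ISub of iexp & iexp.

Inductive rexp : Type :=
| RNum of nat
| RGet of nat & iexp
| RAdd of rexp & rexp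
| RSub of rexp & rexp
| RMul of rexp & rexp
| RDiv of rexp & rexp.

Inductive bexp : Type :=
| BILe of iexp & iexp
| BRLe of rexp & rexp
| BNot of bexp
| BAnd of bexp & bexp.

Inductive cmd : Type :=
| Skip
| ISet of nat & iexp & iexp  (* array, index, value *)
| RSet of nat & iexp & rexp
| Seq of cmd & cmd
| If of bexp & cmd & cmd
| While of bexp & cmd.

Fixpoint icost (e : iexp) : nat :=
  match e with
  | INum _ => 1
  | IGet _ e1 => (icost e1).+1
  | IAdd e1 e2 | ISub e1 e2 => (icost e1 + icost e2).+1%N
  end.

Fixpoint rcost (e : rexp) : nat :=
  match e with
  | RNum _ => 1
  | RGet _ e1 => (icost e1).+1
  | RAdd e1 e2 | RSub e1 e2 | RMul e1 e2 | RDiv e1 e2 => (rcost e1 + rcost e2).+1%N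
  end.

Fixpoint bcost (b : bexp) : nat :=
  match b with
  | BILe e1 e2 => (icost e1 + icost e2).+1%N
  | BRLe e1 e2 => (rcost e1 + rcost e2).+1%N
  | BNot b1 => (bcost b1).+1
  | BAnd b1 b2 => (bcost b1 + bcost b2).+1%N
  end.

Section RealRAM.
Variable R : realType.

(* [imem s a i] is the content of cell [i] of array [a]. *)
Record state := State { imem : nat -> nat -> nat; rmem : nat -> nat -> R }.

Definition upd (T : Type) (m : nat -> nat -> T) (a i : nat) (x : T) :=
  fun b j : nat => if (b == a) && (j == i) then x else m b j.

(* Subtraction of indices is truncated. *)
Fixpoint ieval (s : state) (e : iexp) : nat :=
  match e with
  | INum k => k
  | IGet a e1 => imem s a (ieval s e1)
  | IAdd e1 e2 => (ieval s e1 + ieval s e2)%N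
  | ISub e1 e2 => (ieval s e1 - ieval s e2)%N
  end.

(* Division by 0 yields 0. *)
Fixpoint reval (s : state) (e : rexp) : R :=
  match e with
  | RNum k => k%:R
  | RGet a e1 => rmem s a (ieval s e1)
  | RAdd e1 e2 => reval s e1 + reval s e2
  | RSub e1 e2 => reval s e1 - reval s e2
  | RMul e1 e2 => reval s e1 * reval s e2
  | RDiv e1 e2 => reval s e1 / reval s e2
  end.

Fixpoint beval (s : state) (b : bexp) : bool :=
  match b with
  | BILe e1 e2 => (ieval s e1 <= ieval s e2)%N
  | BRLe e1 e2 => reval s e1 <= reval s e2
  | BNot b1 => ~~ beval s b1
  | BAnd b1 b2 => beval s b1 && beval s b2
  end.

(* [exec c s t s'] : started in [s], [c] halts in [s'] after [t] steps. *)
Inductive exec : cmd -> state -> nat -> state -> Prop :=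
| ExecSkip s : exec Skip s 1 s
| ExecISet s a e1 e2 :
    exec (ISet a e1 e2) s (icost e1 + icost e2).+1%N
      (State (upd (imem s) a (ieval s e1) (ieval s e2)) (rmem s))
| ExecRSet s a e1 e2 :
    exec (RSet a e1 e2) s (icost e1 + rcost e2).+1%N
      (State (imem s) (upd (rmem s) a (ieval s e1) (reval s e2)))
| ExecSeq c1 c2 s1 s2 s3 t1 t2 :
    exec c1 s1 t1 s2 -> exec c2 s2 t2 s3 -> exec (Seq c1 c2) s1 (t1 + t2)%N s3
| ExecIfT b c1 c2 s s' t :
    beval s b -> exec c1 s t s' -> exec (If b c1 c2) s (bcost b + t).+1%N s'
| ExecIfF b c1 c2 s s' t :
    ~~ beval s b -> exec c2 s t s' -> exec (If b c1 c2) s (bcost b + t).+1%N s'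
| ExecWhileF b c s :
    ~~ beval s b -> exec (While b c) s (bcost b).+1 s
| ExecWhileT b c s1 s2 s3 t1 t2 :
    beval s1 b -> exec c s1 t1 s2 -> exec (While b c) s2 t2 s3 ->
    exec (While b c) s1 (bcost b + t1 + t2).+1%N s3.

(* The input: [n] in cell 0 of index array 0, the [j]-th coordinates of the
   points in real array [j] for [j < d], the probabilities in real array [d];
   all the other cells contain 0. *)
Definition input_state (d n : nat) (v : 'I_n -> 'rV[R]_d) (p : 'I_n -> R) :
    state :=
  State (fun a i => if (a == 0) && (i == 0) then n else 0)%N
    (fun a i =>
       if insub i is Some k then
         if insub a is Some j then v k 0 j else if a == d then p k else 0
       else 0).

(* The output: the length of the list in cell 0 of index array 0, the [j]-th
   coordinates of its elements in real array [j] for [j < d]. *)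
Definition output_points (d : nat) (s : state) : seq 'rV[R]_d :=
  mkseq (fun k => \row_(j < d) rmem s j k) (imem s 0 0).

(* One program, depending on [d] only, computes the vertices of the expected
   hull of every [d]-dimensional instance; its worst-case running time on [n]
   points is at most [T n], with [T] in O(g). *)
Definition expected_hull_computable_in (d : nat) (g : nat -> R) : Prop :=
  exists (c : cmd) (T : nat -> nat),
    (fun n => (T n)%:R : R^o) =O_\oo (g : nat -> R^o) /\
    forall (n : nat) (v : 'I_n -> 'rV[R]_d) (p : 'I_n -> R),
      stochastic_instance v p ->
      exists (t : nat) (s : state),
        [/\ exec c (input_state v p) t s, (t <= T n)%N &
            vertex_description (expected_hull v p) (output_points d s)].

End RealRAM.

(* Main.v *)
Require Import Defs.
From HB Require Import structures.
From mathcomp Require Import all_boot all_order all_algebra.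
From mathcomp Require Import all_classical all_reals all_analysis.
From mathcomp Require Import ring lra zify.

Set Implicit Arguments.
Unset Strict Implicit.
Unset Printing Implicit Defensive.

Import Order.TTheory GRing.Theory Num.Theory.
Import numFieldNormedType.Exports.

Local Open Scope classical_set_scope.
Local Open Scope ring_scope.

(* When the points are ordered by decreasing values of a direction u without ties,
   the maximal realized point has expectation
     e(u) = sum_i p_i prod_(j above i) (1 - p_j) v_i,
   and the vertices of the expected hull are exactly these points e(u).  So all
   orders induced by generic directions have to be enumerated.  A direction
   supported on the coordinates >= k can be moved along the k-th axis, without
   reversing any strict comparison, until it is orthogonal to a difference h of two
   points; the order is then that of the projections along h onto the coordinates
   > k, ties being broken by the k-th coordinate or by its opposite.  After d - 2
   such steps, with at most (n+1)^2 choices of h each, the directions lie in a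
   plane; there a rotating sweep meets n^2 events, and each of them updates e(u) in
   constant time.  Lexicographic tie breaking replaces general position throughout.
   The points so obtained are sorted and repetitions are dropped. *)

(** * Convexity and separation *)

(** Since every emitted point must be a vertex, covering all generic orders is not enough: each
    lexicographic order met must in turn come from a generic direction. It does, because its keys
    are linear functions of the points which together separate them; adding up their directions with
    rapidly decreasing weights realizes it. Hence degenerate choices of h are harmless, h = 0
    included, and the loops may simply try all pairs of indices. Each of the d - 2 levels
    contributes (n+1)^2 choices of h and two tie-breaking signs, each plane two sweeps (one per sign
    of the last coordinate) with at most n^2 + 1 orders: O(n^(2d-2)) candidates. Each sweep sorts
    its n^2 events, so for d >= 2 the whole takes O(n^(2d-2) log n) time. For d = 2 this is the
    planar bound, and it lies below n^(2d-1) log n in higher dimensions; only the line, where n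
    points are sorted, attains the exponent 2d - 1. Constant time per event rests on p_v < 1:
    overtaking a point of probability p means dividing by 1 - p. *)

Section Dot.
Variables (R : realType).

Section Fixed.
Variable (d : nat).
Implicit Types (x y u w : 'rV[R]_d) (K : set 'rV[R]_d).

Lemma dotDr u x y : dot u (x + y) = dot u x + dot u y.
Proof. by rewrite /dot -big_split; apply: eq_bigr => j _; rewrite mxE mulrDr. Qed.

Lemma dotC u x : dot u x = dot x u.
Proof. by apply: eq_bigr => j _; rewrite mulrC. Qed.

Lemma dotDl u w x : dot (u + w) x = dot u x + dot w x.
Proof. by rewrite dotC dotDr !(dotC x). Qed.

Lemma dotZr u a x : dot u (a *: x) = a * dot u x.
Proof. by rewrite /dot mulr_sumr; apply: eq_bigr => j _; rewrite mxE; ring. Qed.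

Lemma dotZl a u x : dot (a *: u) x = a * dot u x.
Proof. by rewrite dotC dotZr dotC. Qed.

Lemma dotNr u x : dot u (- x) = - dot u x.
Proof. by rewrite -scaleN1r dotZr mulN1r. Qed.

Lemma dotNl u x : dot (- u) x = - dot u x.
Proof. by rewrite dotC dotNr dotC. Qed.

Lemma dotBr u x y : dot u (x - y) = dot u x - dot u y.
Proof. by rewrite dotDr dotNr. Qed.

Lemma dotBl u w x : dot (u - w) x = dot u x - dot w x.
Proof. by rewrite dotDl dotNl. Qed.

Lemma dot0r u : dot u 0 = 0.
Proof. by rewrite -(scale0r 0) dotZr mul0r. Qed.

Lemma dot_sumr (I : Type) (r : seq I) (P : pred I) (F : I -> 'rV[R]_d) u :
  dot u (\sum_(i <- r | P i) F i) = \sum_(i <- r | P i) dot u (F i).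
Proof. by apply: (big_morph (dot u) (dotDr u) (dot0r u)). Qed.

Lemma dot_delta (c : 'I_d) x : dot (delta_mx 0 c) x = x 0 c.
Proof.
rewrite /dot (bigD1 c) //= big1 ?addr0 => [|j /negbTE jc]; rewrite mxE eqxx /=.
  by rewrite eqxx mul1r.
by rewrite jc mul0r.
Qed.

Lemma convex_setP K :
  convex_set K <-> (forall x y t, K x -> K y -> 0 < t < 1 -> K (t *: x + (1 - t) *: y)).
Proof.
rewrite convex_setW; split=> [cK x y t Kx Ky /andP[t0 t1]|cK x y /set_mem Kx /set_mem Ky k k0 k1].
  have t01 : Itv.spec (Itv.num_sem (R := R)) (Itv.Real `[0%Z, 1%Z]) t.
    by rewrite /= /Itv.num_sem in_itv/= !ltW //= realE (ltW t0).
  by have /set_mem := cK x y (mem_set Kx) (mem_set Ky) (Itv.mk t01) t0 t1.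
by apply: mem_set; apply: cK; rewrite ?k0.
Qed.

Lemma conv_hull_convex (S : set 'rV[R]_d) : convex_set (conv_hull S).
Proof.
apply/convex_setP => x y t Kx Ky t01 A [/[dup] cA /convex_setP cA' SA].
by apply: cA' => //; [apply: Kx|apply: Ky].
Qed.

Lemma sub_conv_hull (S : set 'rV[R]_d) : S `<=` conv_hull S.
Proof. exact: sub_gen_smallest. Qed.

Lemma conv_hull_min (S K : set 'rV[R]_d) :
  convex_set K -> S `<=` K -> conv_hull S `<=` K.
Proof. by move=> cK SK; apply: smallest_sub. Qed.

Lemma halfspace_convex u (b : R) : convex_set [set x | dot u x <= b].
Proof.
apply/convex_setP => x y t /= xb yb /andP[t0 t1]; rewrite dotDr !dotZr.
have : t * dot u x + (1 - t) * dot u y <= t * b + (1 - t) * b.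
  by apply: lerD; rewrite ler_pM2l // subr_gt0.
by have -> : t * b + (1 - t) * b = b by ring.
Qed.

Lemma conv_hull_dot_le (S : set 'rV[R]_d) u b :
  (forall x, S x -> dot u x <= b) -> forall x, conv_hull S x -> dot u x <= b.
Proof. by move=> Sb; apply: conv_hull_min => //; apply: halfspace_convex. Qed.

(** Deleting an extreme point from a convex set leaves it convex. If [x] were not in [S], the hull
    without [x] would still be a convex set containing [S]. *)
Lemma conv_hull_vertex (S : set 'rV[R]_d) x : is_vertex (conv_hull S) x -> S x.
Proof.
move=> [Kx vx]; apply: contrapT => nSx.
have /conv_hull_min : convex_set (conv_hull S `\ x).
  apply/convex_setP => y z t [Ky ny] [Kz nz] t01; split=> [|/= E].
    by have /convex_setP := @conv_hull_convex S; apply.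
  by have [] := vx y z t Ky Kz t01 (esym E).
move=> /(_ S) H; suff /H /(_ x Kx) [_ /(_ erefl)] : S `<=` conv_hull S `\ x by [].
move=> y Sy.
by split; [exact: sub_conv_hull|move=> /= yx; apply: nSx; rewrite -yx].
Qed.

(** In a proper convex combination that attains the maximum, two nonnegative deficits add up to 0,
    so both vanish. *)
Lemma unique_max_vertex K x u : K x ->
  (forall y, K y -> dot u y <= dot u x /\ (dot u y = dot u x -> y = x)) -> is_vertex K x.
Proof.
move=> Kx mx; split=> // y z t Ky Kz /andP[t0 t1] E.
have [yx yE] := mx y Ky; have [zx zE] := mx z Kz.
have : t * (dot u x - dot u y) + (1 - t) * (dot u x - dot u z) = 0.
  by rewrite {1 2}E !dotDr !dotZr; ring.
have t1' : 0 < 1 - t by rewrite subr_gt0.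
move/eqP; rewrite paddr_eq0; last first.
- by rewrite mulr_ge0 ?subr_ge0 ?(ltW t1).
- by rewrite mulr_ge0 ?subr_ge0 // ltW.
rewrite !mulf_eq0 (gt_eqF t0) (gt_eqF t1') /= !subr_eq0 => /andP[/eqP ey /eqP ez].
by split; [apply: yE|apply: zE].
Qed.

(** The cone generated by [l], one generator at a time, so that membership follows the induction of
    [farkas]. *)
Fixpoint cone (l : seq 'rV[R]_d) x : Prop :=
  if l is a :: l' then exists2 t : R, 0 <= t & cone l' (x - t *: a) else x = 0.

(* Farkas' lemma. If u separates x from l but not from a :: l, then l and x are
   projected along a onto the hyperplane orthogonal to u. *)
Lemma farkas (l : seq 'rV[R]_d) x :
  cone l x \/ exists2 u, (forall y, y \in l -> dot u y <= 0) & 0 < dot u x.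
Proof.
pose pr u a y : 'rV[R]_d := y - (dot u y / dot u a) *: a.
(* Undoing the projection: since [dot u b <= 0], projecting a generator [b] adds a nonnegative
   multiple of [a]. So a point of the projected cone is a point of the original one plus a
   nonnegative multiple of [a]; the parameter [s] cancels out. *)
have cone_pr u a l' : 0 < dot u a -> (forall y, y \in l' -> dot u y <= 0) ->
    forall x s, cone [seq pr u a y | y <- l'] x ->
    exists2 t, 0 <= t & cone l' (x - s *: a + (s - t) *: a) /\ True.
  move=> ua; elim: l' => [|b l' IH] ul z s /=.
    by move=> ->; exists 0 => //; split=> //; rewrite subr0 subrK.
  move=> [t t0] /IH - /(_ _ s) [|t' t'0 [C _]].
    by move=> y yl; apply: ul; rewrite inE yl orbT.
  exists (t' - t * (dot u b / dot u a)).
    rewrite subr_ge0 (le_trans _ t'0) // mulr_ge0_le0 // pmulr_lle0 ?invr_gt0 //.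
    by apply: ul; rewrite inE eqxx.
  split=> //; exists t => //; move: C; rewrite /pr; congr cone.
  rewrite scalerBr scalerA !scalerBl.
  by apply/rowP => j; rewrite !mxE; ring.
(* Induction on the length, because the hypothesis is also applied to the projected list. *)
have [m] := ubnP (size l); elim: m l x => // m IHm [|a l] x /= sl.
  have [->|x0] := eqVneq x 0; [by left|right; exists x => //].
  rewrite lt_neqAle eq_sym /dot; apply/andP; split.
    apply: contra x0; rewrite psumr_eq0 => [/allP E|i _]; last by rewrite -expr2 sqr_ge0.
    apply/eqP/rowP => j; rewrite mxE; have := E j; rewrite mem_index_enum => /(_ isT) /=.
    by rewrite mulf_eq0 orbb => /eqP.
  by apply: sumr_ge0 => i _; rewrite -expr2 sqr_ge0.
have [Cx|[u ul ux]] := IHm l x sl.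
  by left; exists 0; rewrite ?scale0r ?subr0.
have [ua|ua] := leP (dot u a) 0.
  by right; exists u => // y; rewrite inE => /orP[/eqP->//|]; apply: ul.
have [|Cx|[w wl wx]] := IHm [seq pr u a y | y <- l] (pr u a x); first by rewrite size_map.
  left; have [t t0 [C _]] := cone_pr u a l ua ul _ 0 Cx.
  exists (dot u x / dot u a + t); first by rewrite addr_ge0 // divr_ge0 // ltW.
  move: C; congr cone; rewrite /pr.
  by apply/rowP => j; rewrite !mxE; ring.
(* The adjoint of the projection applied to [w]: it vanishes on [a] and pairs with [y] as [w] does
   with the projected [y]. *)
right; exists (w - (dot w a / dot u a) *: u).
  have E y : dot (w - (dot w a / dot u a) *: u) y = dot w (pr u a y).
    by rewrite /pr dotBl dotZl dotBr dotZr; ring.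
  move=> y; rewrite inE => /orP[/eqP->|yl]; rewrite E.
    by rewrite /pr divff ?gt_eqF // scale1r subrr dot0r.
  by apply/wl/map_f.
by move: wx; congr (_ < _); rewrite /pr dotBl dotZl dotBr dotZr; ring.
Qed.

End Fixed.

Lemma dot_row_mx d (b s : 'rV[R]_1) (u x : 'rV[R]_d) :
  dot (row_mx b u) (row_mx s x) = b 0 0 * s 0 0 + dot u x.
Proof.
rewrite /dot big_split_ord /= big_ord1 row_mxEl row_mxEl; congr (_ + _).
by apply: eq_bigr => j _; rewrite !row_mxEr.
Qed.

(** Placed at height 1 in one more dimension, the convex hull becomes a section of a cone, to which
    [farkas] applies. The added coordinate of the separating functional is a threshold common to all
    points, whence the strict inequality. *)
Lemma conv_hull_separation d (l : seq 'rV[R]_d) (x : 'rV[R]_d) :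
  conv_hull [set` l] x \/ exists u, forall y, y \in l -> dot u y < dot u x.
Proof.
pose lift (s : R) (y : 'rV[R]_d) : 'rV[R]_(1 + d) := row_mx (const_mx s) y.
have [Cx|[bu ul ux]] := farkas [seq lift 1 y | y <- l] (lift 1 x); last first.
  right; exists (rsubmx bu) => y yl.
  have := ul _ (map_f (lift 1) yl); move: ux.
  rewrite -[bu]hsubmxK !dot_row_mx row_mxKr !mxE !mulr1 => h1 h2.
  lra.
left; move=> K [/convex_setP cK lK].
(* For cone points of height [s]: at positive height, rescaling to height 1 lands in [K]; at height
   0 there is only the origin, since all generators have height 1. *)
suff main s y : cone [seq lift 1 y | y <- l] (lift s y) ->
    0 <= s /\ (s = 0 -> y = 0) /\ (0 < s -> K (s^-1 *: y)).
  by have [_ [_]] := main _ _ Cx; rewrite ltr01 invr1 scale1r; apply.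
have {lK} : forall y, y \in l -> K y by move=> z zl; apply: lK.
elim: l s y {x Cx} => [|a l IH] s y lK /=.
  move=> E.
  have Es : s = 0.
    have /(congr1 (fun v : 'rV[R]_(1 + d) => v 0 (lshift d 0))) := E.
    by rewrite row_mxEl !mxE.
  have Ey : y = 0.
    apply/rowP => j; have /(congr1 (fun v : 'rV[R]_(1 + d) => v 0 (rshift 1 j))) := E.
    by rewrite row_mxEr !mxE.
  by rewrite Es ltxx.
move=> [t t0]; have -> : lift s y - t *: lift 1 a = lift (s - t) (y - t *: a).
  rewrite /lift scale_row_mx opp_row_mx add_row_mx; congr row_mx.
  by apply/rowP => j; rewrite !mxE mulr1.
move=> /IH [z zl|st [E H]]; first by apply: lK; rewrite inE zl orbT.
have ts : t <= s by rewrite -subr_ge0.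
have Ka : K a by apply: lK; rewrite inE eqxx.
have s0 := le_trans t0 ts.
split=> //; split=> [s00|sgt0].
  have t00 : t = 0 by apply/eqP; rewrite eq_le t0 -s00 ts.
  by have := E; rewrite s00 t00 subrr scale0r subr0; apply.
have [ts0|ts0] := eqVneq (s - t) 0.
  have st0 : s = t by apply/eqP; rewrite -subr_eq0 ts0.
  have -> : y = s *: a by apply/eqP; rewrite -subr_eq0 st0 E.
  by rewrite scalerA mulVf ?gt_eqF // scale1r.
have st0 : 0 < s - t by rewrite lt_neqAle eq_sym ts0.
have [t00|t00] := eqVneq t 0.
  by have := H st0; rewrite t00 scale0r !subr0.
have tgt0 : 0 < t by rewrite lt_neqAle eq_sym t00.
have := cK _ _ (t / s) Ka (H st0).
have -> : t / s *: a + (1 - t / s) *: ((s - t)^-1 *: (y - t *: a)) = s^-1 *: y.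
  rewrite scalerA; have -> : (1 - t / s) / (s - t) = s^-1.
    by field; rewrite ts0 gt_eqF.
  by rewrite scalerBr scalerA [t / s]mulrC addrC subrK.
by apply; rewrite divr_gt0 //= ltr_pdivrMr // mul1r -subr_gt0.
Qed.

End Dot.

(** * Orders induced by generic directions *)

Section Perturbation.
Variables (R : realType) (d : nat).
Implicit Types (u w g : 'rV[R]_d) (G H : seq 'rV[R]_d).

Definition supported_from (k : nat) u := forall c : 'I_d, (c < k)%N -> u 0 c = 0.

(** Valid for all smaller steps too, so that the induction can take the minimum of two bounds. *)
Lemma small_perturbation G u w : exists2 e : R, 0 < e & forall e', 0 < e' <= e ->
  forall g, g \in G -> 0 < dot u g -> 0 < dot (u + e' *: w) g.
Proof.
elim: G => [|g G [e e0 He]]; first by exists 1.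
have [ug|ug] := leP (dot u g) 0.
  exists e => // e' e'e h; rewrite inE => /orP[/eqP->|]; last exact: He.
  by rewrite ltNge ug.
have K : 0 < 1 + `|dot w g| by rewrite ltr_pwDl.
(* The added 1 avoids a zero denominator and makes the final inequality strict. *)
exists (Num.min e (dot u g / (1 + `|dot w g|))).
  by rewrite lt_min e0 divr_gt0.
move=> e' /andP[e'0]; rewrite le_min => /andP[e'e]; rewrite ler_pdivlMr // => e'u h.
rewrite inE => /orP[/eqP-> _|]; last by apply: He; rewrite e'0.
rewrite dotDl dotZl.
have : - (e' * `|dot w g|) <= e' * dot w g.
  by rewrite -mulrN ler_pM2l // lerNl -normrN ler_norm.
lra.
Qed.

Lemma sign_perturbation G u w : exists2 e : R, 0 < e & forall g, g \in G ->
  (0 < dot u g -> 0 < dot (u + e *: w) g) /\ (dot u g < 0 -> dot (u + e *: w) g < 0).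
Proof.
have [e e0 He] := small_perturbation (G ++ [seq - g | g <- G]) u w.
exists e => // g gG; split=> ug.
  by apply: He; rewrite ?e0 ?lexx // mem_cat gG.
rewrite -oppr_gt0 -dotNr; apply: He; rewrite ?e0 ?lexx //.
  by rewrite mem_cat (map_f (@GRing.opp _) gG) orbT.
by rewrite dotNr oppr_gt0.
Qed.

(** A vector still orthogonal to the current direction is cured by a step along an axis [c >= k] on
    which it does not vanish, short enough to keep all signs obtained so far. *)
Lemma generic_perturbation (k : nat) G u : supported_from k u ->
  exists2 u', supported_from k u' & forall g, g \in G ->
    [/\ 0 < dot u g -> 0 < dot u' g, dot u g < 0 -> dot u' g < 0 &
        (exists2 c : 'I_d, (k <= c)%N & g 0 c != 0) -> dot u' g != 0].
Proof.
move=> su.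
suff [u' su' [H1 H2]] : exists2 u', supported_from k u' &
    (forall g, g \in G -> (0 < dot u g -> 0 < dot u' g) /\ (dot u g < 0 -> dot u' g < 0)) /\
    (forall g, g \in G -> (exists2 c : 'I_d, (k <= c)%N & g 0 c != 0) -> dot u' g != 0).
  by exists u' => // g gG; have [] := H1 g gG; split=> //; apply: H2.
have : {subset G <= G} by [].
(* The induction runs over the vectors already made non-orthogonal, while signs are preserved on the
   whole of [G]. *)
elim: {1 4}G => [|g H IH] HG; first by exists u.
have [h hH|u1 su1 [H1 H2]] := IH; first by apply: HG; rewrite inE hH orbT.
have [[c kc gc]|ng] := EM (exists2 c : 'I_d, (k <= c)%N & g 0 c != 0); last first.
  by exists u1 => //; split=> // h; rewrite inE => /orP[/eqP->//|]; apply: H2.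
have [ug|ug] := eqVneq (dot u1 g) 0; last first.
  by exists u1 => //; split=> // h; rewrite inE => /orP[/eqP->//|]; apply: H2.
have [e e0 He] := sign_perturbation G u1 (delta_mx 0 c).
exists (u1 + e *: delta_mx 0 c).
  move=> j jk; rewrite !mxE su1 // add0r eqxx /=; case: eqP => [jc|]; last by rewrite mulr0.
  by rewrite jc ltnNge kc in jk.
split=> h; last rewrite inE.
  move=> hG; have [h1 h2] := H1 h hG; have [e1 e2] := He h hG.
  by split=> [/h1/e1|/h2/e2].
move=> /orP[/eqP-> _|hH hc].
  by rewrite dotDl ug add0r dotZl dot_delta mulf_neq0 // gt_eqF.
have /HG/He [e1 e2] : h \in g :: H by rewrite inE hH orbT.
by have := H2 h hH hc; rewrite !neq_lt => /orP[/e2->//|/e1->]; rewrite orbT.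
Qed.

End Perturbation.

(** * Lexicographic orders and their realization by a single direction *)

Section Lexicographic.
Variable R : realType.

(* [j] strictly precedes [i] in the order of lexicographically decreasing keys. *)
Fixpoint before (fs : seq (nat -> R)) (j i : nat) : bool :=
  if fs is f :: fs' then (f i < f j) || ((f i == f j) && before fs' j i) else false.

Fixpoint ties (fs : seq (nat -> R)) (i j : nat) : bool :=
  if fs is f :: fs' then (f i == f j) && ties fs' i j else true.

Lemma before_cat fs gs j i :
  before (fs ++ gs) j i = before fs j i || (ties fs i j && before gs j i).
Proof. by elim: fs => //= f fs ->; case: ltgtP. Qed.

Lemma tiesC fs i j : ties fs i j = ties fs j i.
Proof. by elim: fs => //= f fs ->; rewrite eq_sym. Qed.

Lemma before_total fs j i : [|| before fs j i, before fs i j | ties fs i j].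
Proof. by elim: fs => //= f fs; case: ltgtP => //=; rewrite ?orbT. Qed.

Lemma before_asym fs j i : before fs j i -> ~~ before fs i j.
Proof. by elim: fs => //= f fs IH; case: ltgtP. Qed.

Lemma before_irr fs i : before fs i i = false.
Proof. by elim: fs => //= f fs ->; rewrite ltxx eqxx. Qed.

Lemma before_ties fs i j : ties fs i j -> before fs j i = false.
Proof. by elim: fs => //= f fs IH /andP[/eqP -> /IH ->]; rewrite ltxx eqxx. Qed.

Lemma ties_before fs i j :
  ties fs i j = ~~ before fs j i && ~~ before fs i j.
Proof. by elim: fs => //= f fs ->; case: ltgtP. Qed.

(** Ties are determined by [before], so two key lists inducing the same order can be exchanged in
    front of the same tie-breakers. *)
Lemma before_extend n F G T :
  (forall j i, (j < n)%N -> (i < n)%N -> before F j i = before G j i) ->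
  forall j i, (j < n)%N -> (i < n)%N -> before (F ++ T) j i = before (G ++ T) j i.
Proof.
by move=> E j i jn im; rewrite !before_cat !ties_before !E.
Qed.

Variables (d n : nat) (v : 'I_n -> 'rV[R]_d).

Definition generic (u : 'rV[R]_d) := injective (fun i => dot u (v i)).

Definition above (u : 'rV[R]_d) : rel 'I_n := fun j i => dot u (v i) < dot u (v j).

(** Restricted to ordinals because only the cells below [n] hold points. *)
Definition linear_on (f : nat -> R) := exists w, forall i : 'I_n, f i = dot w (v i).

Fixpoint all_linear fs := if fs is f :: fs' then linear_on f /\ all_linear fs' else True.

Lemma linear_onD f g : linear_on f -> linear_on g -> linear_on (fun i => f i + g i).
Proof. by move=> [a ha] [b hb]; exists (a + b) => i; rewrite ha hb dotDl. Qed.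

Lemma linear_onZ a f : linear_on f -> linear_on (fun i => a * f i).
Proof. by move=> [w hw]; exists (a *: w) => i; rewrite hw dotZl. Qed.

(** The direction of the first key is perturbed by a small multiple of one realizing the remaining
    keys: strict comparisons survive and ties are decided by the later keys. This is the source of
    soundness. *)
Lemma before_realizable fs : all_linear fs ->
  (forall i j : 'I_n, ties fs i j -> i = j) ->
  exists2 u, generic u & forall j i : 'I_n, before fs j i = above u j i.
Proof.
move=> lfs sep.
suff [u Hu] : exists u, forall j i : 'I_n, before fs j i -> 0 < dot u (v j - v i).
  have gu : generic u.
    move=> i j E; apply: sep.
    have := before_total fs i j; case/or3P => [/Hu|/Hu|]; rewrite 1?tiesC //;
      by rewrite dotBr /= E subrr ltxx.
  exists u => // j i; rewrite /above.
  have := before_total fs j i; case/or3P => [b|b|t].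
  - by have := Hu _ _ b; rewrite dotBr subr_gt0 b => ->.
  - rewrite (negbTE (before_asym b)); have := Hu _ _ b; rewrite dotBr subr_gt0.
    by case: ltgtP.
  - by rewrite before_ties // (sep _ _ t) ltxx.
elim: fs lfs {sep} => [_|f fs IH /= [[w hw] /IH [u Hu]]]; first by exists 0.
have [e e0 He] := sign_perturbation [seq v ij.1 - v ij.2 | ij <- enum {: 'I_n * 'I_n}] w u.
exists (w + e *: u) => j i.
have /He [H1 _] : v j - v i \in [seq v ij.1 - v ij.2 | ij <- enum {: 'I_n * 'I_n}].
  by apply/mapP; exists (j, i) => //; rewrite mem_enum.
rewrite !hw => /orP[|/andP[/eqP E b]].
  by rewrite -subr_gt0 -dotBr => /H1.
by rewrite dotDl dotBr E subrr add0r dotZl mulr_gt0 //; apply: Hu.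
Qed.

End Lexicographic.

(** * Completeness: from an arbitrary direction to a lexicographic order the program meets *)

Section Elimination.
Variables (R : realType) (d n : nat).
Implicit Types (u h g x y : 'rV[R]_d) (G : seq 'rV[R]_d) (X : nat -> 'rV[R]_d).

(* When [h 0 k = 0] the quotient is 0 and nothing happens. *)
Definition eliminate (k : 'I_d) h x := x - (x 0 k / h 0 k) *: h.

Lemma eliminateE k h x c :
  eliminate k h x 0 c = x 0 c - x 0 k / h 0 k * h 0 c.
Proof. by rewrite !mxE. Qed.

Definition signed (s : bool) (x : R) := if s then x else - x.

(** Injectivity would be too much to ask: elimination may make distinct points coincide in all
    coordinates from [k] on. Such coincidences are the only ties allowed. *)
Definition separates (k : nat) u X := forall i j : 'I_n,
  dot u (X i) = dot u (X j) -> forall c : 'I_d, (k <= c)%N -> X i 0 c = X j 0 c.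

Definition drop_coord (k : 'I_d) u : 'rV[R]_d := u - u 0 k *: delta_mx 0 k.

Lemma dot_drop_coord k u x : dot (drop_coord k u) x = dot u x - u 0 k * x 0 k.
Proof. by rewrite dotBl dotZl dot_delta. Qed.

Lemma supported_drop_coord (k : 'I_d) u :
  supported_from k u -> supported_from k.+1 (drop_coord k u).
Proof.
move=> su c; rewrite ltnS leq_eqVlt => /orP[/eqP/val_inj->|ck]; rewrite !mxE eqxx /=.
  by rewrite eqxx mulr1 subrr.
rewrite (su c ck); by have -> : (c == k) = false by [apply/eqP => ck'; rewrite ck' ltnn in ck]; rewrite mulr0 subr0.
Qed.

Lemma dot_supported_eq (k : nat) u x y : supported_from k u ->
  (forall c : 'I_d, (k <= c)%N -> x 0 c = y 0 c) -> dot u x = dot u y.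
Proof.
move=> su E; apply: eq_bigr => c _; have [kc|ck] := leqP k c; first by rewrite E.
by rewrite su // !mul0r.
Qed.

(** Tied points agree in every coordinate from [k] on, so they stay tied under any direction
    supported there; all other comparisons are strict and survive a small move. *)
Lemma separating_perturbation (k : nat) u X G : supported_from k u -> separates k u X ->
  exists u', [/\ supported_from k u', separates k u' X,
    forall i j : 'I_n, (dot u (X j) < dot u (X i)) = (dot u' (X j) < dot u' (X i)) &
    forall g, g \in G -> (exists2 c : 'I_d, (k <= c)%N & g 0 c != 0) -> dot u' g != 0].
Proof.
move=> su sep; pose D := [seq X ij.1 - X ij.2 | ij : 'I_n * 'I_n].
have [u' su' Hu'] := generic_perturbation (G ++ D) su.
have HD (i j : 'I_n) : X i - X j \in G ++ D.
  by rewrite mem_cat; apply/orP; right; apply/mapP; exists (i, j); rewrite ?mem_enum.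
have E (i j : 'I_n) : (dot u (X j) < dot u (X i)) = (dot u' (X j) < dot u' (X i)).
  have [H1 H2 _] := Hu' _ (HD i j).
  move: H1 H2; rewrite !dotBr !subr_gt0 !subr_lt0; case: ltgtP => // [_ /(_ isT)->//||].
    by move=> _ _ /(_ isT); case: ltgtP.
  move=> e _ _; rewrite (@dot_supported_eq k u' (X j) (X i)) ?ltxx //.
  by move=> c kc; apply: sep.
exists u'; split=> //.
  move=> i j e; apply: sep; apply/eqP; have := E i j; have := E j i; rewrite e ltxx.
  by case: ltgtP.
by move=> g gG; have [] := Hu' g; rewrite ?mem_cat ?gG.
Qed.

(** Here [a] is the value of a direction on a difference and [a + t * b] its value after a move of
    length [|t|] that goes no further than the zero. Either the sign survives, or the value becomes
    0 and the old sign was that of [- t * b]. *)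
Lemma nearest_sign (a b t : R) : t != 0 -> b != 0 -> `|t| * `|b| <= `|a| ->
  (0 < a) = (0 < a + t * b) || ((a + t * b == 0) && (0 < - t * b)).
Proof.
move=> t0 b0; rewrite -normrM mulNr; have : t * b != 0 by rewrite mulf_neq0.
move: (t * b) => c {t b t0 b0} c0.
have [a0|a0|a0] := ltgtP a 0.
- rewrite (ltr0_norm a0) ler_norml => /andP[_ ca].
  have -> : (0 < a + c) = false by apply/negbTE; rewrite -leNgt; lra.
  by case: eqP => //= e; apply/esym/negbTE; rewrite -leNgt; lra.
- rewrite (gtr0_norm a0) ler_norml => /andP[ca _].
  have [//|h] := ltP 0 (a + c); have -> : a + c = 0 by lra.
  by rewrite eqxx /=; apply/esym; lra.
- by rewrite a0 normr0 normr_le0 (negbTE c0).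
Qed.

(** Among the differences with nonzero [k]-th coordinate, [h] is one that needs the shortest move of
    [u] along the axis, so no comparison is reversed by then. Points that become tied differ by a
    multiple of [h] in the coordinates from [k] on, hence [eliminate] makes them coincide there. *)
Lemma elimination_complete (k : 'I_d) u X (f : nat -> R) :
  (forall r, f r = X r 0 k) -> supported_from k u -> separates k u X ->
  exists i0 j0 s u', [/\ (i0 <= n)%N, (j0 <= n)%N, supported_from k.+1 u',
    separates k.+1 u' (fun r => eliminate k (X i0 - X j0) (X r)) &
    forall i j : 'I_n, (dot u (X j) < dot u (X i)) =
      before [:: fun r => dot u' (eliminate k (X i0 - X j0) (X r));
                 fun r => signed s (f r)] i j].
Proof.
move=> /funext -> su sep.
have [const|] := EM (forall i j : 'I_n, X i 0 k = X j 0 k).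
  (* All [k]-th coordinates agree, so the axis has no influence on the order. Taking [i0 = j0] gives
     [h = 0], for which elimination is the identity; index 0 is within the bound even if there is no
     point. *)
  exists 0%N, 0%N, true, (drop_coord k u).
  have el x : eliminate k (X 0%N - X 0%N) x = x by rewrite /eliminate subrr scaler0 subr0.
  have dE (i j : 'I_n) : dot (drop_coord k u) (X i) - dot (drop_coord k u) (X j) =
      dot u (X i) - dot u (X j).
    by rewrite !dot_drop_coord (const i j); ring.
  split=> //; first exact: supported_drop_coord.
    move=> i j; rewrite !el => /eqP; rewrite -subr_eq0 dE subr_eq0 => /eqP e c kc.
    by apply: sep => //; apply: ltnW.
  move=> i j; rewrite /= !el (const j i) ltxx eqxx /= andbF orbF.
  by rewrite -subr_gt0 -dE subr_gt0.
move/existsNP => [i1 /existsNP [j1 ne1]].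
(* Combinations of two differences whose [k]-th coordinate cancels: [u1] and its translate [u2]
   along the axis agree on them. As [u1] avoids orthogonality to [G], a tie after the move forces
   such a combination to vanish from coordinate [k] on. *)
pose G := [seq (X q.1.1 - X q.1.2) 0 k *: (X q.2.1 - X q.2.2) -
               (X q.2.1 - X q.2.2) 0 k *: (X q.1.1 - X q.1.2)
          | q : ('I_n * 'I_n) * ('I_n * 'I_n)].
have [u1 [su1 sep1 ordE HG]] := separating_perturbation G su sep.
pose P := fun q : 'I_n * 'I_n => (X q.1 - X q.2) 0 k != 0.
(* The length of the move along the axis that makes [u1] orthogonal to the difference given by
   [q]. *)
pose t_ := fun q : 'I_n * 'I_n => `|dot u1 (X q.1 - X q.2) / (X q.1 - X q.2) 0 k|.
have P1 : P (i1, j1) by rewrite /P /= !mxE subr_eq0; apply/eqP.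
have [[i0 j0] hk mn] := Order.TotalTheory.arg_minP t_ P1.
rewrite /P /t_ /= in hk mn.
set h := X i0 - X j0 in hk mn.
pose t := - (dot u1 h / h 0 k).
pose u2 := u1 + t *: delta_mx 0 k.
have u2E x : dot u2 x = dot u1 x + t * x 0 k by rewrite dotDl dotZl dot_delta.
have u2h : dot u2 h = 0 by rewrite u2E /t mulNr divfK ?subrr.
(* Orthogonality of [u1] to [h] would force equal [k]-th coordinates, since [u1] separates. *)
have t0 : t != 0.
  rewrite oppr_eq0 mulf_neq0 ?invr_eq0 //; apply: contra hk.
  rewrite dotBr subr_eq0 => /eqP/sep1 /(_ k (leqnn k)) e.
  by rewrite /h !mxE e subrr.
have elk x : eliminate k h x 0 k = 0 by rewrite eliminateE divfK ?subrr.
have el2 x : dot u2 (eliminate k h x) = dot u2 x.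
  by rewrite /eliminate dotBr dotZr u2h mulr0 subr0.
have el' x : dot (drop_coord k u2) (eliminate k h x) = dot u2 x.
  by rewrite dot_drop_coord el2 elk mulr0 subr0.
have su2 : supported_from k u2.
  move=> c ck; rewrite !mxE su1 // add0r eqxx /=.
  by have -> : (c == k) = false by [apply/eqP => ck'; rewrite ck' ltnn in ck]; rewrite mulr0.
(* Points that become tied were ordered by [- t] times their [k]-th coordinate, which gives the
   tie-breaking sign. *)
exists i0, j0, (t < 0), (drop_coord k u2); split.
- exact/ltnW.
- exact/ltnW.
- exact: supported_drop_coord.
- move=> i j; rewrite !el' => /eqP; rewrite -subr_eq0 -dotBr => /eqP E.
  pose g := X i - X j.
  have gG : h 0 k *: g - g 0 k *: h \in G.
    by apply/mapP; exists ((i0, j0), (i, j)); rewrite ?mem_enum.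
  have z : dot u1 (h 0 k *: g - g 0 k *: h) = 0.
    rewrite dotBr !dotZr; move: E; rewrite u2E -/g /t => E.
    have -> : dot u1 g = (dot u1 h / h 0 k) * g 0 k.
      by apply/eqP; rewrite -subr_eq0 -mulNr; apply/eqP.
    by field.
  move=> c kc; apply/eqP; rewrite -subr_eq0.
  have -> : eliminate k h (X i) 0 c - eliminate k h (X j) 0 c =
      (h 0 k *: g - g 0 k *: h) 0 c / h 0 k.
    have gE c' : g 0 c' = X i 0 c' - X j 0 c' by rewrite !mxE.
    have -> : (h 0 k *: g - g 0 k *: h) 0 c = h 0 k * g 0 c - g 0 k * h 0 c by rewrite !mxE.
    by rewrite !eliminateE !gE; field.
  suff -> : (h 0 k *: g - g 0 k *: h) 0 c = 0 by rewrite mul0r.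
  apply: contrapT => /eqP nz.
  by have := HG _ gG; rewrite z eqxx => H; have /H : exists2 c : 'I_d, (k <= c)%N & (h 0 k *: g - g 0 k *: h) 0 c != 0 by [exists c => //; apply: ltnW].
- move=> i j; rewrite ordE /= !el'.
  pose g := X i - X j.
  have a1 : dot u1 (X i) = dot u1 (X j) + dot u1 g by rewrite dotBr; ring.
  have a2 : dot u2 (X i) = dot u2 (X j) + dot u2 g by rewrite dotBr; ring.
  have a3 : X i 0 k = X j 0 k + g 0 k by rewrite !mxE; ring.
  rewrite a1 a2 a3 !ltrDl eq_sym -subr_eq0 [_ + _ - _]addrC addKr -/g.
  have gz : dot u1 g = 0 -> g 0 k = 0.
    by rewrite dotBr => /eqP; rewrite subr_eq0 => /eqP/sep1 /(_ k (leqnn k)); rewrite !mxE => ->; rewrite subrr.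
  have := mn (i, j); rewrite /= -/g -/h u2E => mg.
  have sE : (signed (t < 0) (X j 0 k) < signed (t < 0) (X j 0 k + g 0 k)) = (0 < - t * g 0 k).
    rewrite /signed; have [tt|tt] := ltP t 0; rewrite ?ltrN2 ?ltrDl ?gtrDl.
      by rewrite pmulr_rgt0 ?oppr_gt0.
    by rewrite mulNr oppr_gt0 pmulr_rlt0 // lt_neqAle eq_sym t0.
  have [g0|g0] := eqVneq (g 0 k) 0.
    by rewrite sE g0 !mulr0 ltxx addr0 !andbF orbF.
  have {}mg : `|t| * `|g 0 k| <= `|dot u1 g|.
    by rewrite -ler_pdivlMr ?normr_gt0 // -normf_div normrN mg.
  by rewrite sE andbF orbF; apply: nearest_sign.
Qed.

(** Up to a positive factor the direction is [B + tau * A], the sign [s] making its [b]-coordinate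
    positive. The order changes at event times only, so it is the one right after the last event
    before [tau], or the order at minus infinity if there is none. *)
Lemma line_sweep_complete (a b : 'I_d) u X (f g : nat -> R) :
  (a.+1 = b)%N -> (b.+1 = d)%N -> (forall r, f r = X r 0 a) -> (forall r, g r = X r 0 b) ->
  supported_from a u -> separates a u X ->
  exists s, let A r := signed s (f r) in let B r := signed s (g r) in
  (forall i j : 'I_n, (dot u (X j) < dot u (X i)) = before [:: fun r => - A r; B] i j) \/
  exists2 q : 'I_n * 'I_n, A q.1 != A q.2 &
    forall i j : 'I_n, (dot u (X j) < dot u (X i)) =
      before [:: fun r => B r + (B q.2 - B q.1) / (A q.1 - A q.2) * A r; A] i j.
Proof.
move=> ab bd /funext -> /funext -> su sep.
(* Listing [delta_mx 0 b] makes the [b]-coordinate of [u1] nonzero; the slope is a quotient by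
   it. *)
have [u1 [su1 sep1 ordE]] := separating_perturbation [:: delta_mx 0 b] su sep.
move=> /(_ (delta_mx 0 b)); rewrite inE eqxx dotC dot_delta => /(_ isT) ub0.
have {}ub0 : u1 0 b != 0.
  by apply: ub0; exists b; rewrite ?mxE ?eqxx ?oner_neq0 // -ab.
pose s := 0 < u1 0 b.
exists s => A B.
pose m := `|u1 0 b|; have m0 : 0 < m by rewrite normr_gt0.
pose tau := u1 0 a / u1 0 b.
have dE r : dot u1 (X r) = m * (B r + tau * A r).
  have aNb : a != b by apply/eqP => e; move: ab; rewrite e => /eqP; rewrite eqn_leq ltnn.
  rewrite /dot (bigD1 a) //= (bigD1 b) 1?eq_sym //= big1 => [|c /andP[ca cb]]; last first.
    rewrite su1 ?mul0r //; move: ca cb (ltn_ord c).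
    by rewrite -!(inj_eq val_inj) /=; lia.
  rewrite addr0 /A /B /tau /m /s /signed.
  case: ltP => h; first by rewrite gtr0_norm //; field.
  by rewrite ler0_norm //; field.
have {}ordE (i j : 'I_n) :
    (dot u (X j) < dot u (X i)) = (0 < (B i - B j) + tau * (A i - A j)).
  rewrite ordE !dE ltr_pM2l // -subr_gt0; congr (0 < _); ring.
pose t_ (q : 'I_n * 'I_n) := (B q.2 - B q.1) / (A q.1 - A q.2).
have fE (q : 'I_n * 'I_n) (x : R) : A q.1 != A q.2 ->
    (B q.1 - B q.2) + x * (A q.1 - A q.2) = (x - t_ q) * (A q.1 - A q.2).
  by rewrite -subr_eq0 /t_ => h; field.
(* At an event time two points with distinct [A] would be tied, which separation excludes; so [tau]
   lies strictly between events. *)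
have tne (q : 'I_n * 'I_n) : A q.1 != A q.2 -> t_ q != tau.
  move=> h; apply/eqP => e; move: (fE q tau h); rewrite -e subrr mul0r e => z.
  have /sep1 /(_ a (leqnn a)) : dot u1 (X q.1) = dot u1 (X q.2).
    by rewrite !dE; congr (_ * _); apply/eqP; rewrite -subr_eq0 -z; apply/eqP; ring.
  by move=> eA; move: h; rewrite /A eA eqxx.
have [none|] := EM (forall q : 'I_n * 'I_n, A q.1 != A q.2 -> tau < t_ q).
  left=> i j; rewrite ordE /= andbF orbF ltrN2 eqr_opp.
  have [e|ne] := eqVneq (A i) (A j).
    by rewrite e ltxx subrr mulr0 addr0 subr_gt0.
  rewrite orbF (fE (i, j)) // nmulr_rgt0.
    by rewrite subr_lt0.
  by rewrite subr_lt0; apply: (none (i, j)).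
move/existsNP => [q0 /not_implyP [nq0 /negP tq0]].
pose P (q : 'I_n * 'I_n) := (A q.1 != A q.2) && ~~ (tau < t_ q).
have P0 : P q0 by rewrite /P nq0.
(* The latest event not after [tau]. *)
have [q /andP[nq tq] mx] := Order.TotalTheory.arg_maxP t_ P0.
right; exists q => // i j; rewrite ordE /= andbF orbF -/(t_ q).
rewrite -leNgt in tq.
have {}tq : t_ q < tau by rewrite lt_neqAle tne.
have [e|ne] := eqVneq (A i) (A j).
  by rewrite e ltxx andbF orbF subrr mulr0 addr0 subr_gt0 ltrD2r.
rewrite (fE (i, j)) //.
have -> : (B j + t_ q * A j < B i + t_ q * A i) = (0 < (t_ q - t_ (i, j)) * (A i - A j)).
  by rewrite -(fE (i, j)) // -subr_gt0; congr (0 < _) => /=; ring.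
have -> : (B j + t_ q * A j == B i + t_ q * A i) = (t_ q == t_ (i, j)).
  rewrite eq_sym -subr_eq0.
  have -> : B i + t_ q * A i - (B j + t_ q * A j) = (t_ q - t_ (i, j)) * (A i - A j).
    by rewrite -(fE (i, j)) //=; ring.
  by rewrite mulf_eq0 !subr_eq0 (negbTE ne) orbF.
have [tij|tij] := ltP tau (t_ (i, j)).
  have h : t_ q < t_ (i, j) by apply: lt_trans tij.
  by rewrite (lt_eqF h) orbF !nmulr_rgt0 ?subr_lt0.
have tij' : t_ (i, j) < tau by rewrite lt_neqAle tne.
have /= := mx (i, j); rewrite /P /= ne -leNgt tij => /(_ isT).
rewrite le_eqVlt => /orP[/eqP e|h].
  by rewrite e eqxx subrr mul0r ltxx /= pmulr_rgt0 ?subr_gt0.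
by rewrite (gt_eqF h) orbF !pmulr_rgt0 ?subr_gt0.
Qed.

Lemma line_complete X (u : 'rV[R]_d) (a : 'I_d) (f : nat -> R) : (d = 1)%N ->
  (forall r, f r = X r 0 a) -> separates 0 u X ->
  exists s, forall i j : 'I_n, (dot u (X j) < dot u (X i)) =
    before [:: fun r => signed s (f r)] i j.
Proof.
move=> d1 /funext -> sep.
have dE r : dot u (X r) = u 0 a * X r 0 a.
  rewrite /dot (bigD1 a) //= big1 ?addr0 // => c; suff -> : c = a by rewrite eqxx.
  by apply: val_inj; move: c a => [c +] [a' +] /=; rewrite d1; case: c; case: a'.
exists (0 < u 0 a) => i j; rewrite /= andbF orbF !dE /signed.
have [h|h|h] := ltgtP 0 (u 0 a).
- by rewrite ltr_pM2l.
- by rewrite ltr_nM2l // ltrN2.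
- have /sep /(_ a isT) -> : dot u (X i) = dot u (X j) by rewrite !dE -h !mul0r.
  by rewrite !ltxx.
Qed.

End Elimination.

(** * Vertices of the expected hull *)

Lemma sup_maximum (R : realType) (S : set R) x :
  S x -> (forall y, S y -> y <= x) -> sup S = x.
Proof.
move=> Sx ub; apply/eqP; rewrite eq_le; apply/andP; split.
  by apply: ge_sup => //; exists x.
by apply: ub_le_sup => //; exists x.
Qed.

(** The points strictly below [x], together with [x] itself, form a convex set. *)
Lemma conv_hull_unique_max (R : realType) d (S : set 'rV[R]_d) x u : S x ->
  (forall y, S y -> dot u y < dot u x \/ y = x) ->
  forall y, conv_hull S y -> dot u y < dot u x \/ y = x.
Proof.
move=> Sx H; apply: (@conv_hull_min _ _ _ [set y | dot u y < dot u x \/ y = x]) => //.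
apply/convex_setP => y z t /= hy hz /andP[t0 t1].
have t1' : 0 < 1 - t by rewrite subr_gt0.
have ly : dot u y <= dot u x by case: hy => [/ltW//|->].
have lz : dot u z <= dot u x by case: hz => [/ltW//|->].
have E : dot u x = t * dot u x + (1 - t) * dot u x by ring.
case: hy => [hy|->].
  left; rewrite dotDr !dotZr E; apply: ltr_leD; first by rewrite ltr_pM2l.
  by rewrite ler_pM2l.
case: hz => [hz|->]; last by right; rewrite -scalerDl addrC subrK scale1r.
by left; rewrite dotDr !dotZr [ltRHS]E ltrD2l ltr_pM2l.
Qed.

Section ExpectedHull.
Variables (R : realType) (d n : nat) (v : 'I_n -> 'rV[R]_d) (p : 'I_n -> R).
Implicit Types (P : {set 'I_n}) (u : 'rV[R]_d) (bf : rel 'I_n).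

(* The expectation of the first realized point in the order [bf]. *)
Definition order_point bf : 'rV[R]_d :=
  \sum_i (p i * \prod_(j | bf j i) (1 - p j)) *: v i.

Lemma eq_order_point bf bf' : bf =2 bf' -> order_point bf = order_point bf'.
Proof.
move=> E; apply: eq_bigr => i _; congr (_ * _ *: _).
by apply: eq_bigl => j; rewrite E.
Qed.

Hypothesis p01 : forall i, 0 < p i < 1.

Lemma prob_realizationE P :
  prob_realization p P = \prod_i if i \in P then p i else 1 - p i.
Proof.
rewrite [RHS](bigID (mem P)) /=; congr (_ * _).
  by apply: eq_bigr => i ->.
by apply: eq_big => i; rewrite ?inE // => /negbTE ->.
Qed.

Lemma prob_realization_gt0 P : 0 < prob_realization p P.
Proof.
rewrite prob_realizationE prodr_gt0 // => i _.
by have /andP[p0 p1] := p01 i; case: ifP; rewrite ?subr_gt0.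
Qed.

Lemma realization_argmax P u : P != finset.set0 ->
  exists2 i, i \in P & forall j, j \in P -> dot u (v j) <= dot u (v i).
Proof.
case/finset.set0Pn => i0 iP.
by have [i iP' mx] := Order.TotalTheory.arg_maxP (fun i => dot u (v i)) iP; exists i.
Qed.

Lemma ConvHE P : P != finset.set0 -> ConvH v P = conv_hull (realized v P).
Proof. by rewrite /ConvH => /negbTE ->. Qed.

Lemma realization_support_max P u i : i \in P ->
  (forall j, j \in P -> dot u (v j) <= dot u (v i)) ->
  realization_support v P u = dot u (v i).
Proof.
move=> iP mx; have nz : P != finset.set0 by apply/finset.set0Pn; exists i.
rewrite /realization_support (negbTE nz); apply: sup_maximum.
  by exists (v i) => //; exists i.
by move=> _ [_ [j jP <-] <-]; apply: mx.
Qed.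

Lemma ConvH_dot_le P u x : ConvH v P x -> dot u x <= realization_support v P u.
Proof.
have [->|nz] := eqVneq P finset.set0.
  by rewrite /ConvH /realization_support eqxx => ->; rewrite dot0r.
have [i iP mx] := realization_argmax u nz.
rewrite (realization_support_max iP mx) ConvHE //.
by apply: conv_hull_dot_le => _ [j jP <-]; apply: mx.
Qed.

Lemma ConvH_support_attained P u :
  exists2 x, ConvH v P x & dot u x = realization_support v P u.
Proof.
have [->|nz] := eqVneq P finset.set0.
  by exists 0; rewrite /ConvH /realization_support eqxx ?dot0r.
have [i iP mx] := realization_argmax u nz.
exists (v i); last by rewrite (realization_support_max iP mx).
by rewrite ConvHE //; apply: sub_conv_hull; exists i.
Qed.

Lemma expected_hull_dot_le u x : expected_hull v p x -> dot u x <= expected_support v p u.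
Proof.
move=> [y yP ->]; rewrite dot_sumr; apply: ler_sum => P _.
by rewrite dotZr ler_pM2l ?prob_realization_gt0 //; apply: ConvH_dot_le.
Qed.

Lemma expected_hull_support u :
  support_fun (expected_hull v p) u = expected_support v p u.
Proof.
apply: sup_maximum => [|_ [x Mx <-]]; last exact: expected_hull_dot_le.
have /choice [y Hy] : forall P, exists x, ConvH v P x /\ dot u x = realization_support v P u.
  by move=> P; have [x] := ConvH_support_attained P u; exists x.
exists (\sum_P prob_realization p P *: y P).
  by exists y => // P; have [] := Hy P.
by rewrite dot_sumr; apply: eq_bigr => P _; rewrite dotZr; have [_ ->] := Hy P.
Qed.

Lemma ConvH_convex P : convex_set (ConvH v P).
Proof.
rewrite /ConvH; case: ifP => _; last exact: conv_hull_convex.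
apply/convex_setP => x y t /= -> -> _.
by rewrite !scaler0 addr0.
Qed.

Lemma expected_hull_convex : convex_set (expected_hull v p).
Proof.
apply/convex_setP => _ _ t [x Hx ->] [y Hy ->] t01.
exists (fun P => t *: x P + (1 - t) *: y P).
  by move=> P; have /convex_setP := @ConvH_convex P; apply.
rewrite !scaler_sumr -big_split; apply: eq_bigr => P _ /=.
by rewrite scalerDr !scalerA [t * _]mulrC [(1 - t) * _]mulrC.
Qed.

Hypothesis v_inj : injective v.

Section Generic.
Variable u : 'rV[R]_d.
Hypothesis gen_u : generic v u.

Definition is_top P i := (i \in P) && [forall j in P, ~~ above v u j i].

(** Written as a sum so that the empty realization gets 0, in agreement with [ConvH]; a nonempty
    realization has exactly one term. *)
Definition top_point P := \sum_(i | is_top P i) v i.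

Lemma is_top_uniq P i j : is_top P i -> is_top P j -> i = j.
Proof.
move=> /andP[iP /forall_inP Hi] /andP[jP /forall_inP Hj]; apply: gen_u.
by apply/eqP; rewrite eq_le !leNgt Hi // Hj.
Qed.

Lemma top_pointE P i : is_top P i -> top_point P = v i.
Proof.
move=> ti; rewrite /top_point (bigD1 i) //= big1 ?addr0 // => j /andP[tj].
by rewrite (is_top_uniq tj ti) eqxx.
Qed.

Lemma exists_top P : P != finset.set0 -> exists i, is_top P i.
Proof.
move=> /(realization_argmax u) [i iP mx]; exists i; rewrite /is_top iP /=.
by apply/forall_inP => j /mx; rewrite /above -leNgt.
Qed.

(** The point [i] is on top iff it is present and everything above it is absent; the points below
    are free and their probabilities sum to 1. *)
Lemma prob_top i :
  \sum_(P | is_top P i) prob_realization p P = p i * \prod_(j | above v u j i) (1 - p j).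
Proof.
(* [F] weighs presence and [G] absence, with weight 0 for what is forbidden; the sum over all
   realizations then factors over the points. *)
pose F j := if above v u j i then 0 else p j.
pose G j := if j == i then 0 else 1 - p j.
have -> : \sum_(P | is_top P i) prob_realization p P =
    \sum_(P : {set 'I_n}) \prod_j (if j \in P then F j else G j).
  rewrite [RHS](bigID (fun P => is_top P i)) /= [X in _ = _ + X]big1 ?addr0.
    apply: eq_bigr => P /andP[iP /forall_inP Hi]; rewrite prob_realizationE.
    apply: eq_bigr => j _; rewrite /F /G; case: ifP => jP; first by rewrite (negbTE (Hi j jP)).
    by case: eqP => // ji; rewrite ji iP in jP.
  move=> P; rewrite negb_and => /orP[iP|/forall_inPn [j jP /negPn ja]].
    by rewrite (bigD1 i) //= (negbTE iP) /G eqxx mul0r.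
  by rewrite (bigD1 j) //= jP /F ja mul0r.
rewrite -bigA_distr (bigD1 i) //=; congr (_ * _).
  by rewrite /F /G eqxx /above ltxx addr0.
rewrite [RHS]big_mkcond [RHS](bigD1 i) //= {1}/above ltxx mul1r.
apply: eq_bigr => j /negbTE ji; rewrite /F /G ji; case: ifP => _; first by rewrite add0r.
by rewrite addrC subrK.
Qed.

Lemma order_point_top : order_point (above v u) = \sum_P prob_realization p P *: top_point P.
Proof.
rewrite /order_point; under eq_bigr do rewrite -prob_top scaler_suml.
rewrite (exchange_big_dep xpredT) //=; apply: eq_bigr => P _.
by rewrite /top_point scaler_sumr.
Qed.

Lemma top_point_ConvH P : ConvH v P (top_point P).
Proof.
have [->|nz] := eqVneq P finset.set0.
  by rewrite /ConvH eqxx /top_point big1 // => i /andP[]; rewrite inE.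
have [i ti] := exists_top nz; rewrite (top_pointE ti) ConvHE //.
by apply: sub_conv_hull; exists i => //; case/andP: ti.
Qed.

Lemma order_point_in_hull : expected_hull v p (order_point (above v u)).
Proof. by rewrite order_point_top; exists top_point => //; apply: top_point_ConvH. Qed.

Lemma ConvH_unique_max P y :
  ConvH v P y -> dot u y < dot u (top_point P) \/ y = top_point P.
Proof.
have [->|nz] := eqVneq P finset.set0.
  rewrite /ConvH eqxx /top_point big1; first by move=> ->; right.
  by move=> i /andP[]; rewrite inE.
have [i ti] := exists_top nz; rewrite (top_pointE ti) ConvHE //.
move: ti => /andP[iP /forall_inP Hi]; apply: conv_hull_unique_max.
  by exists i.
move=> _ [j jP <-]; have := Hi j jP; rewrite /above -leNgt le_eqVlt => /orP[/eqP/gen_u->|].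
  by right.
by left.
Qed.

(** Each realization contributes at most its top point. As all probabilities are positive, equality
    of the sums forces equality for every realization. *)
Lemma expected_hull_unique_max y : expected_hull v p y ->
  dot u y <= dot u (order_point (above v u)) /\
  (dot u y = dot u (order_point (above v u)) -> y = order_point (above v u)).
Proof.
move=> [z Hz ->]; rewrite order_point_top.
have le P : dot u (z P) <= dot u (top_point P).
  by have [/ltW|->] := ConvH_unique_max (Hz P).
have leS P : dot u (prob_realization p P *: z P) <= dot u (prob_realization p P *: top_point P).
  by rewrite !dotZr ler_pM2l ?prob_realization_gt0.
split; first by rewrite !dot_sumr; apply: ler_sum.
rewrite !dot_sumr => /eqP; rewrite -subr_eq0 -sumrB -oppr_eq0 -sumrN psumr_eq0; last first.
  by move=> P _; rewrite opprB subr_ge0.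
move=> /allP E; apply: eq_bigr => P _.
have := E P; rewrite mem_index_enum opprB subr_eq0 !dotZr => /(_ isT) /eqP.
move/(mulfI (lt0r_neq0 (prob_realization_gt0 P))) => e.
by have [|->//] := ConvH_unique_max (Hz P); rewrite e ltxx.
Qed.

End Generic.

(** Each listed point is the unique maximizer in its direction, hence a vertex. If some point of the
    expected hull escaped the hull of [l], a separating direction could be perturbed to a generic
    one, and the point would lie above the maximizer of that direction. *)
Lemma expected_hull_vertices (l : seq 'rV[R]_d) : uniq l ->
  (forall x, x \in l <-> exists2 u, generic v u & x = order_point (above v u)) ->
  vertex_description (expected_hull v p) l.
Proof.
move=> ul Hl.
have lV x : x \in l -> is_vertex (expected_hull v p) x.
  move=> /Hl [u gu ->]; apply: (unique_max_vertex (u := u)); first exact: order_point_in_hull.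
  by move=> y; apply: expected_hull_unique_max.
have MV : expected_hull v p = conv_hull [set` l].
  apply/seteqP; split; last first.
    by apply: conv_hull_min; [exact: expected_hull_convex|move=> x /= /lV []].
  move=> x Mx; have [//|[u0 Hu0]] := conv_hull_separation l x.
  have su0 : supported_from 0 u0 by [].
  pose D := [seq v ij.1 - v ij.2 | ij : 'I_n * 'I_n].
  have [u _ Hu] := generic_perturbation ([seq x - y | y <- l] ++ D) su0.
  have gu : generic v u.
    move=> i j E; apply: contrapT => /eqP ij.
    have /Hu [_ _] : v i - v j \in [seq x - y | y <- l] ++ D.
      by rewrite mem_cat; apply/orP; right; apply/mapP; exists (i, j); rewrite ?mem_enum.
    rewrite dotBr /= E subrr eqxx => H.
    have : v i != v j by apply: contra ij => /eqP/v_inj->.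
    move/eqP; apply; apply/rowP => c; apply/eqP/negP => /negP nc.
    suff : false by []; apply: H; exists c => //.
    by rewrite !mxE subr_eq0.
  have wl : order_point (above v u) \in l by apply/Hl; exists u.
  have [+ _] := expected_hull_unique_max gu Mx.
  have /Hu [+ _ _] : x - order_point (above v u) \in [seq x - y | y <- l] ++ D.
    by rewrite mem_cat (map_f (fun y => x - y) wl).
  by rewrite !dotBr !subr_gt0 => /(_ (Hu0 _ wl)) xw /(lt_le_trans xw); rewrite ltxx.
split=> // x; split; first exact: lV.
by rewrite MV => /conv_hull_vertex.
Qed.

End ExpectedHull.

(** * Reasoning about timed executions *)

(** Loop-free commands are executed by computation and their cost is bounded syntactically, which
    leaves invariants to loops only. *)
Fixpoint straight (c : cmd) : bool :=
  match c with
  | Seq c1 c2 | If _ c1 c2 => straight c1 && straight c2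
  | While _ _ => false
  | _ => true
  end.

Fixpoint straight_cost (c : cmd) : nat :=
  match c with
  | Skip => 1
  | ISet _ e1 e2 => (icost e1 + icost e2).+1
  | RSet _ e1 e2 => (icost e1 + rcost e2).+1
  | Seq c1 c2 => (straight_cost c1 + straight_cost c2)%N
  | If b c1 c2 => (bcost b + maxn (straight_cost c1) (straight_cost c2)).+1
  | While _ _ => 0
  end.

Fixpoint int_writes (c : cmd) (a : nat) : bool :=
  match c with
  | ISet a' _ _ => a == a'
  | Seq c1 c2 | If _ c1 c2 => int_writes c1 a || int_writes c2 a
  | While _ c1 => int_writes c1 a
  | _ => false
  end.

Fixpoint real_writes (c : cmd) (a : nat) : bool :=
  match c with
  | RSet a' _ _ => a == a'
  | Seq c1 c2 | If _ c1 c2 => real_writes c1 a || real_writes c2 a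
  | While _ c1 => real_writes c1 a
  | _ => false
  end.

Definition For (x : nat) (e : iexp) (body : cmd) : cmd :=
  Seq (ISet x (INum 0) (INum 0))
    (While (BILe (IAdd (IGet x (INum 0)) (INum 1)) e)
       (Seq body (ISet x (INum 0) (IAdd (IGet x (INum 0)) (INum 1))))).

(** Unrolled when the program is built: the dimension is fixed, and array names cannot be computed
    at run time. *)
Definition Each (f : nat -> cmd) (d : nat) : cmd :=
  foldr (fun c r => Seq (f c) r) Skip (iota 0 d).

Lemma straight_Each f d : (forall c, straight (f c)) -> straight (Each f d).
Proof. by move=> sf; rewrite /Each; elim: (iota 0 d) => //= c l ->; rewrite sf. Qed.

Lemma int_writes_Each f d a : int_writes (Each f d) a = has (fun c => int_writes (f c) a) (iota 0 d).
Proof. by rewrite /Each; elim: (iota 0 d) => //= c l ->. Qed.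

Lemma real_writes_Each f d a :
  real_writes (Each f d) a = has (fun c => real_writes (f c) a) (iota 0 d).
Proof. by rewrite /Each; elim: (iota 0 d) => //= c l ->. Qed.

Lemma straight_cost_Each f d K : (forall c, straight_cost (f c) = K) ->
  straight_cost (Each f d) = (d * K).+1.
Proof.
move=> H; rewrite /Each -{2}(size_iota 0 d).
by elim: (iota 0 d) => //= c l ->; rewrite H mulSn addnS.
Qed.

Section Runs.
Variable R : realType.
Implicit Types (s : state R) (Q : state R -> Prop).

Lemma upd_ne (T : Type) (m : nat -> nat -> T) a i x b :
  (b == a) = false -> upd m a i x b = m b.
Proof. by rewrite /upd => ->. Qed.

Definition set_int s a i x := State (upd (imem s) a i x) (rmem s).
Definition set_real s a i x := State (imem s) (upd (rmem s) a i x).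

Fixpoint run (c : cmd) s : state R :=
  match c with
  | ISet a e1 e2 => set_int s a (ieval s e1) (ieval s e2)
  | RSet a e1 e2 => set_real s a (ieval s e1) (reval s e2)
  | Seq c1 c2 => run c2 (run c1 s)
  | If b c1 c2 => if beval s b then run c1 s else run c2 s
  | _ => s
  end.

Definition runs c s b Q := exists t s', [/\ exec c s t s', (t <= b)%N & Q s'].

Lemma runs_weaken c s b b' Q Q' : runs c s b Q -> (b <= b')%N ->
  (forall s', Q s' -> Q' s') -> runs c s b' Q'.
Proof.
by move=> [t [s' [e tb q]]] bb QQ; exists t, s'; split=> //; [apply: leq_trans bb|apply: QQ].
Qed.

Lemma runs_bound c s b b' Q : runs c s b Q -> (b <= b')%N -> runs c s b' Q.
Proof. by move=> H bb; apply: runs_weaken H bb _. Qed.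

Lemma runs_seq c1 c2 s b1 b2 Q :
  runs c1 s b1 (fun s1 => runs c2 s1 b2 Q) -> runs (Seq c1 c2) s (b1 + b2) Q.
Proof.
move=> [t1 [s1 [e1 tb1 [t2 [s2 [e2 tb2 q]]]]]]; exists (t1 + t2)%N, s2.
by split=> //; [apply: ExecSeq e1 e2|apply: leq_add].
Qed.

Lemma runs_straight c s Q : straight c -> Q (run c s) -> runs c s (straight_cost c) Q.
Proof.
elim: c s Q => [|a e1 e2|a e1 e2|c1 IH1 c2 IH2|b c1 IH1 c2 IH2|//] s Q /=.
- by move=> _ q; exists 1%N, s; split=> //; apply: ExecSkip.
- by move=> _ q; eexists; eexists; split; [apply: ExecISet| |apply: q].
- by move=> _ q; eexists; eexists; split; [apply: ExecRSet| |apply: q].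
- by move=> /andP[h1 h2] q; apply: runs_seq; apply: IH1 => //; apply: IH2.
- move=> /andP[h1 h2]; case: ifPn => hb q.
    have [t [s' [e tb q']]] := IH1 s Q h1 q; eexists; eexists; split; [exact: ExecIfT e| |exact: q'].
    by rewrite ltnS leq_add2l; apply: leq_trans tb _; apply: leq_maxl.
  have [t [s' [e tb q']]] := IH2 s Q h2 q; eexists; eexists; split; [exact: ExecIfF e| |exact: q'].
  by rewrite ltnS leq_add2l; apply: leq_trans tb _; apply: leq_maxr.
Qed.

Lemma run_Each (f : nat -> cmd) d (I : nat -> state R -> Prop) s :
  (forall c s, (c < d)%N -> I c s -> I c.+1 (run (f c) s)) -> I 0 s -> I d (run (Each f d) s).
Proof.
move=> H; suff E m c s' : (c + m)%N = d -> I c s' ->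
  I d (run (foldr (fun c r => Seq (f c) r) Skip (iota c m)) s') by apply: E.
elim: m c s' => [|m IH] c s' /=; first by rewrite addn0 => ->.
by move=> cd Ic; apply: IH; [rewrite addSnnS|apply: H => //; lia].
Qed.

(** The index of [I] bounds the number of iterations left; the loop may stop before it reaches 0. *)
Lemma runs_while b c s cb (I : nat -> state R -> Prop) q :
  (forall q s, I q s -> beval s b -> exists2 q', q = q'.+1 & runs c s cb (I q')) ->
  I q s ->
  runs (While b c) s (q * (bcost b + cb).+1 + (bcost b).+1)
    (fun s' => ~~ beval s' b /\ exists q', I q' s').
Proof.
move=> H; elim: q s => [|q IH] s Iq.
  case: (boolP (beval s b)) => hb; first by have [] := H _ _ Iq hb.
  exists (bcost b).+1, s; split=> //; [exact: ExecWhileF|by split=> //; exists 0%N].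
case: (boolP (beval s b)) => hb; last first.
  exists (bcost b).+1, s; split=> //; [exact: ExecWhileF|exact: leq_addl|by split=> //; exists q.+1].
have [_ [<-] [t1 [s1 [e1 tb1 I1]]]] := H _ _ Iq hb.
have [t2 [s2 [e2 tb2 q2]]] := IH _ I1.
exists (bcost b + t1 + t2).+1, s2; split=> //; first exact: ExecWhileT e1 e2.
by rewrite mulSn; move: tb1 tb2; move: (q * _)%N; lia.
Qed.

(** [I k] describes the state once the counter is set to [k]. The bound [e] is evaluated in every
    round, hence the demand that its value stay [N]. The 13 covers test and increment of a round,
    the 9 initialization and the last, failing test. *)
Lemma runs_for x e body s N b (I : nat -> state R -> Prop) Q :
  I 0 (set_int s x 0 0) ->
  (forall k s, (k <= N)%N -> I k s -> imem s x 0 = k -> ieval s e = N) ->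
  (forall k s, (k < N)%N -> I k s -> imem s x 0 = k ->
    runs body s b (fun s' => imem s' x 0 = k /\ I k.+1 (set_int s' x 0 k.+1))) ->
  (forall s', I N s' -> Q s') ->
  runs (For x e body) s (N * (b + icost e + 13) + icost e + 9) Q.
Proof.
move=> I0 He Hb HQ.
pose J q s := exists k, [/\ (q + k = N)%N, I k s & imem s x 0 = k].
have J0 : J N (set_int s x 0 0).
  by exists 0%N; rewrite addn0; split=> //=; rewrite /upd !eqxx.
apply: (@runs_weaken _ _ (3 + (N * ((3 + icost e).+2 + (b + 6)).+1 + (3 + icost e).+3))) => //; last first.
- exact: HQ.
- lia.
apply: runs_seq; apply: runs_straight => //.
apply: runs_weaken (leqnn _) _; first apply: (runs_while _ J0).
  move=> q s1 [k [qk Ik xk]] /=; rewrite xk (He k) //; last lia.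
  rewrite addn1 => kN; exists q.-1; first lia.
  apply: runs_seq; apply: runs_weaken (Hb _ _ kN Ik xk) (leqnn _) _ => s2 [xk2 Ik2].
  apply: runs_straight => //; exists k.+1; split; first lia.
    by rewrite /= xk2 addn1.
  by rewrite /= /upd !eqxx xk2 addn1.
move=> s1 [nb [q [k [qk Ik xk]]]]; move: nb; rewrite /= xk (He k) //; last lia.
by move=> h; have <- : k = N by lia.
Qed.

Lemma exec_frame c s t s' : exec c s t s' ->
  (forall a, ~~ int_writes c a -> imem s' a = imem s a) /\
  (forall a, ~~ real_writes c a -> rmem s' a = rmem s a).
Proof.
elim=> //=.
- by move=> s1 a e1 e2; split=> // b /negbTE ba; rewrite upd_ne.
- by move=> s1 a e1 e2; split=> // b /negbTE ba; rewrite upd_ne.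
- move=> c1 c2 s1 s2 s3 t1 t2 _ [i1 r1] _ [i2 r2].
  by split=> a; rewrite negb_or => /andP[h1 h2]; rewrite ?i2 ?i1 ?r2 ?r1.
- by move=> b c1 c2 s1 s2 t1 _ _ [i1 r1]; split=> a; rewrite negb_or => /andP[h1 h2]; rewrite ?i1 ?r1.
- by move=> b c1 c2 s1 s2 t1 _ _ [i1 r1]; split=> a; rewrite negb_or => /andP[h1 h2]; rewrite ?i1 ?r1.
- move=> b c1 s1 s2 s3 t1 t2 _ _ [i1 r1] _ [i2 r2].
  by split=> a h; rewrite ?i2 ?i1 ?r2 ?r1.
Qed.

Lemma runs_frame c s b Q : runs c s b Q ->
  runs c s b (fun s' => [/\ Q s', forall a, ~~ int_writes c a -> imem s' a = imem s a &
    forall a, ~~ real_writes c a -> rmem s' a = rmem s a]).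
Proof. by move=> [t [s' [e tb q]]]; exists t, s'; have [h1 h2] := exec_frame e. Qed.

Lemma run_frame c s : straight c ->
  (forall a, ~~ int_writes c a -> imem (run c s) a = imem s a) /\
  (forall a, ~~ real_writes c a -> rmem (run c s) a = rmem s a).
Proof.
move=> sc; have [t [s' [e _ E]]] := runs_straight (Q := eq (run c s)) sc erefl.
by rewrite E; apply: exec_frame e.
Qed.

End Runs.

(** * Merge sort *)

Definition slice (A : nat -> nat) x y := [seq A t | t <- iota x (y - x)].

Lemma slice_nil A x y : (y <= x)%N -> slice A x y = [::].
Proof. by rewrite /slice => /eqP ->. Qed.

Lemma sliceS A x y : (x < y)%N -> slice A x y = A x :: slice A x.+1 y.
Proof. by move=> xy; rewrite /slice (_ : y - x = (y - x.+1).+1)%N //; lia. Qed.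

Lemma slice_cat A x y z : (x <= y <= z)%N -> slice A x z = slice A x y ++ slice A y z.
Proof.
move=> xyz; rewrite /slice -map_cat (_ : z - x = (y - x) + (z - y))%N; last lia.
by rewrite iotaD subnKC //; lia.
Qed.

Lemma eq_slice A B x y : (forall t, (x <= t < y)%N -> A t = B t) -> slice A x y = slice B x y.
Proof. by move=> AB; apply/eq_in_map => t; rewrite mem_iota => h; apply: AB; lia. Qed.

Ltac lia_nodvd := repeat match goal with H : is_true (_ %| _)%N |- _ => clear H end; lia.

Section MergePass.
Variables (le : rel nat).
Hypotheses (le_total : total le) (le_trans : transitive le).

Definition block_sorted w m (A : nat -> nat) := forall b x y,
  (w %| b)%N -> (b <= x)%N -> (x <= y)%N -> (y < b + w)%N -> (y < m)%N -> le (A x) (A y).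

(* After [k] steps of a pass merging blocks of width [w] of [A] into [B]: the
   current pair of blocks starts at [lo], and [i], [j] are the heads of what
   remains of its halves. *)
Record merge_inv (A B : nat -> nat) w m k lo i j : Prop := MergeInv {
  mi_lo : (w + w %| lo)%N;
  mi_k : (lo <= k <= lo + w + w)%N;
  mi_i : (lo <= i <= lo + w)%N;
  mi_j : (lo + w <= j <= lo + w + w)%N;
  mi_jm : (j <= maxn (lo + w) m)%N;
  mi_sum : (i + j = k + lo + w)%N;
  mi_count : forall a, (count a (slice B 0 k) + count a (slice A i (minn (lo + w) m)) +
    count a (slice A j m) = count a (slice A 0 m))%N;
  mi_sorted : block_sorted (w + w) k B;
  mi_bound : forall x y, (lo <= x < k)%N -> (i <= y < lo + w)%N || (j <= y < lo + w + w)%N ->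
    (y < m)%N -> le (B x) (A y) }.

Lemma merge_init A B w m : (0 < w)%N -> merge_inv A B w m 0 0 0 w.
Proof.
move=> w0; split=> //; try lia_nodvd; rewrite ?dvdn0 //.
move=> a; rewrite /= add0n; have [wm|mw] := leqP w m.
  by rewrite -count_cat -slice_cat //; lia_nodvd.
by rewrite (@slice_nil A w m) ?addn0 //; lia_nodvd.
Qed.

Lemma merge_next A B w m k lo i j : (0 < w)%N -> (k < m)%N -> (lo + w + w <= k)%N ->
  merge_inv A B w m k lo i j -> merge_inv A B w m k (lo + w + w) (lo + w + w) (lo + w + w + w).
Proof.
move=> w0 km lok [h1 h2 h3 h4 h5 h6 h7 h8 h9].
have ek : k = (lo + w + w)%N by lia_nodvd.
have ei : i = (lo + w)%N by lia_nodvd.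
have ej : j = (lo + w + w)%N by lia_nodvd.
split; try lia_nodvd; rewrite ?addnA //.
  by rewrite -addnA dvdn_add.
move=> a; rewrite -(h7 a) -!addnA; congr (_ + _)%N.
rewrite ei ej (@slice_nil A (lo + w)) ?add0n; last lia_nodvd.
have [wm|mw] := leqP (lo + w + w + w) m.
  by rewrite !addnA (minn_idPl wm) -count_cat -slice_cat //; lia_nodvd.
by rewrite !addnA (@slice_nil A (lo + w + w + w) m) ?addn0 //; [congr (count _ (slice _ _ _)); lia_nodvd|lia_nodvd].
Qed.

(** The left head may be taken if it does not exceed the right one or the right half is exhausted;
    the right head if it does not exceed the left one or the left half is exhausted. *)
Lemma merge_take A B w m k lo i j i' j' z : (0 < w)%N -> (k < m)%N -> (k < lo + w + w)%N ->
  merge_inv A B w m k lo i j ->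
  [\/ [/\ z = i, i' = i.+1, j' = j, (i < lo + w)%N & (j < lo + w + w)%N -> (j < m)%N -> le (A i) (A j)] |
      [/\ z = j, i' = i, j' = j.+1 & (i < lo + w)%N -> [/\ (j < lo + w + w)%N, (j < m)%N & le (A j) (A i)]]] ->
  block_sorted w m A ->
  merge_inv A (fun t => if t == k then A z else B t) w m k.+1 lo i' j'.
Proof.
move=> w0 km klo [h1 h2 h3 h4 h5 h6 h7 h8 h9] cs bA.
have wlo : (w %| lo)%N by apply: dvdn_trans h1; rewrite addnn -muln2 dvdn_mulr.
have wlo' : (w %| lo + w)%N by rewrite dvdn_add.
have num : (z = i /\ i' = i.+1 /\ j' = j /\ i < lo + w /\ i < m)%N \/
    (z = j /\ i' = i /\ j' = j.+1 /\ j < lo + w + w /\ j < m)%N.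
  case: cs => [[-> -> -> il _]|[-> -> -> H]]; first by left; lia_nodvd.
  right; do 3?split=> //; case: (ltnP i (lo + w)%N) => il; first by have [-> -> _] := H il.
  lia_nodvd.
have zm : (z < m)%N by lia_nodvd.
have slB : slice (fun t => if t == k then A z else B t) 0 k.+1 = rcons (slice B 0 k) (A z).
  rewrite (@slice_cat _ 0 k) ?leqnSn // (@sliceS _ k k.+1) // (@slice_nil _ k.+1) // eqxx cats1.
  congr rcons; apply: eq_slice => t tk; by have -> : (t == k) = false by lia_nodvd.
have zle y : (i' <= y < lo + w)%N || (j' <= y < lo + w + w)%N -> (y < m)%N -> le (A z) (A y).
  case: cs => [[-> -> -> il H]|[-> -> -> H]] hy ym.
    case/orP: hy => hy; first by apply: (bA lo) => //; lia_nodvd.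
    have lej : le (A i) (A j) by apply: H; lia_nodvd.
    by apply: le_trans lej _; apply: (bA (lo + w)%N) => //; lia_nodvd.
  case/orP: hy => hy; last by apply: (bA (lo + w)%N) => //; lia_nodvd.
  have [|_ _ lej] := H; first lia_nodvd.
  by apply: le_trans lej _; apply: (bA lo) => //; lia_nodvd.
split=> //.
- lia_nodvd.
- lia_nodvd.
- lia_nodvd.
- lia_nodvd.
- lia_nodvd.
- move=> a; rewrite slB -cats1 count_cat /= -(h7 a).
  case: cs => [[ez -> -> il H]|[ez -> -> H]]; rewrite ez in zm *.
    by rewrite (@sliceS A i (minn (lo + w) m)) /=; lia_nodvd.
  by rewrite (@sliceS A j m) //=; lia_nodvd.
- move=> b x y wb bx xy yb yk.
  have xk : (x == k) = (k <= x)%N by lia_nodvd.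
  have [kx|xk'] := leqP k x.
    have ex : x = k by lia_nodvd.
    have ey : y = k by lia_nodvd.
    by rewrite ex ey; case/orP: (le_total (if k == k then A z else B k) (if k == k then A z else B k)).
  have -> : (x == k) = false by lia_nodvd.
  have [ey|ny] := eqVneq y k; last by apply: (h8 b) => //; lia_nodvd.
  apply: h9 => //; last by lia_nodvd.
  (* Cell [k] lies before [b + (w + w)] and not before [lo]; as both [b] and [lo] are multiples of
     [w + w], this gives [lo <= b]. *)
  suff : (lo <= b)%N by lia_nodvd.
  have /dvdnP [q1 e1] := wb; have /dvdnP [q2 e2] := h1.
  have : (q2 * (w + w) < q1.+1 * (w + w))%N by rewrite mulSn; lia_nodvd.
  rewrite ltn_pmul2r ?ltnS; last lia_nodvd.
  by move=> q12; rewrite e1 e2 leq_mul2r q12 orbT.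
- move=> x y xk hy ym; have [ex|nx] := eqVneq x k.
    by apply: zle.
  by apply: h9 => //; lia_nodvd.
Qed.

Lemma merge_end A B w m lo i j : (0 < w)%N -> merge_inv A B w m m lo i j ->
  perm_eq (slice B 0 m) (slice A 0 m) /\ block_sorted (w + w) m B.
Proof.
move=> w0 [h1 h2 h3 h4 h5 h6 h7 h8 h9]; split=> //.
apply/permP => a; rewrite -(h7 a) (@slice_nil A i) ?(@slice_nil A j) ?addn0 //; lia_nodvd.
Qed.

End MergePass.

(** * Comparing indices by lists of signed real keys *)

Section Comparator.
Variable R : realType.

(* A key is a sign and the name of the real array holding its values. *)
Definition key_exp (k : bool * nat) (e : iexp) : rexp :=
  if k.1 then RGet k.2 e else RSub (RNum 0) (RGet k.2 e).

Definition key_val (rm : nat -> nat -> R) (k : bool * nat) (r : nat) : R :=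
  signed k.1 (rm k.2 r).

Definition key_vals rm ks := [seq key_val rm k | k <- ks].

(** The machine offers neither strict comparison nor disjunction, hence the nested negations. *)
Fixpoint cmp_exp (ks : seq (bool * nat)) (e1 e2 : iexp) : bexp :=
  if ks is k :: ks' then
    BAnd (BRLe (key_exp k e2) (key_exp k e1))
      (BNot (BAnd (BRLe (key_exp k e1) (key_exp k e2)) (BNot (cmp_exp ks' e1 e2))))
  else BILe (INum 0) (INum 0).

Definition key_le rm ks : rel nat := fun i j => ~~ before (key_vals rm ks) j i.

Lemma reval_key_exp (s : state R) k e : reval s (key_exp k e) = key_val (rmem s) k (ieval s e).
Proof. by rewrite /key_exp /key_val; case: k.1 => //=; rewrite sub0r. Qed.

Lemma beval_cmp_exp (s : state R) ks e1 e2 :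
  beval s (cmp_exp ks e1 e2) = key_le (rmem s) ks (ieval s e1) (ieval s e2).
Proof.
rewrite /key_le; elim: ks => //= k ks ->; rewrite !reval_key_exp negbK.
by case: ltgtP.
Qed.

Lemma key_le_total rm ks : total (key_le rm ks).
Proof.
move=> i j; rewrite /key_le; apply/orP.
by case: (boolP (before _ j i)) => b; [right; apply: before_asym|left].
Qed.

Lemma key_le_trans rm ks : transitive (key_le rm ks).
Proof.
rewrite /key_le => j i k; elim: ks => //= f ks IH.
move: (key_val rm f i) (key_val rm f j) (key_val rm f k) => x y z.
case: (ltgtP x y) => //= [yx _|->]; case: (ltgtP y z) => //= [zy _|<-] //=.
- by have zx := lt_trans zy yx; rewrite ltNge (ltW zx) (gt_eqF zx).
- by rewrite ltNge (ltW yx) (gt_eqF yx).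
Qed.

End Comparator.

Definition reg a := IGet a (INum 0).

(* Sorts the first [m] cells of integer array 1, [m] being held by reg 8;
   array 2 is the merging buffer, scalars 3 to 7 are the width, the start of the
   current pair of blocks, the two reading heads and the writing head. *)
Definition merge_shift :=
  If (BILe (IAdd (IAdd (reg 4) (reg 3)) (reg 3)) (reg 7))
    (Seq (ISet 4 (INum 0) (IAdd (IAdd (reg 4) (reg 3)) (reg 3)))
      (Seq (ISet 5 (INum 0) (reg 4))
           (ISet 6 (INum 0) (IAdd (reg 4) (reg 3)))))
    Skip.

Definition merge_pick ks :=
  If (BAnd (BILe (IAdd (reg 5) (INum 1)) (IAdd (reg 4) (reg 3)))
       (BNot (BAnd (BILe (IAdd (reg 6) (INum 1)) (IAdd (IAdd (reg 4) (reg 3)) (reg 3)))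
         (BAnd (BILe (IAdd (reg 6) (INum 1)) (reg 8))
            (BNot (cmp_exp ks (IGet 1 (reg 5)) (IGet 1 (reg 6))))))))
    (Seq (ISet 2 (reg 7) (IGet 1 (reg 5))) (ISet 5 (INum 0) (IAdd (reg 5) (INum 1))))
    (Seq (ISet 2 (reg 7) (IGet 1 (reg 6))) (ISet 6 (INum 0) (IAdd (reg 6) (INum 1)))).

Definition merge_pass ks :=
  Seq (ISet 4 (INum 0) (INum 0)) (Seq (ISet 5 (INum 0) (INum 0)) (Seq (ISet 6 (INum 0) (reg 3))
    (Seq (For 7 (reg 8) (Seq merge_shift (merge_pick ks)))
      (Seq (For 7 (reg 8) (ISet 1 (reg 7) (IGet 2 (reg 7))))
           (ISet 3 (INum 0) (IAdd (reg 3) (reg 3))))))).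

Definition sort_cmd ks :=
  Seq (ISet 3 (INum 0) (INum 1))
    (While (BILe (IAdd (reg 3) (INum 1)) (reg 8)) (merge_pass ks)).

(** Bounds the cost per cell of one merging pass; 100 absorbs the overhead of the loops and of
    copying back. *)
Definition sort_cost ks := (100 + straight_cost (Seq merge_shift (merge_pick ks)))%N.

Section Sort.
Variables (R : realType) (ks : seq (bool * nat)).
Implicit Types s : state R.

Lemma merge_pass_spec s w m : imem s 3 0 = w -> imem s 8 0 = m -> (0 < w)%N ->
  block_sorted (key_le (rmem s) ks) w m (imem s 1) ->
  runs (merge_pass ks) s (sort_cost ks * m.+1) (fun s' =>
    [/\ rmem s' = rmem s, imem s' 3 0 = (w + w)%N, imem s' 8 0 = m,
        perm_eq (slice (imem s' 1) 0 m) (slice (imem s 1) 0 m) &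
        block_sorted (key_le (rmem s) ks) (w + w) m (imem s' 1)]).
Proof.
move=> sw sm w0 bs.
have tot := @key_le_total R (rmem s) ks; have tr := @key_le_trans R (rmem s) ks.
set le := key_le _ _ in bs tot tr *.
pose I k s' := [/\ rmem s' = rmem s, imem s' 1 = imem s 1, imem s' 3 0 = w, imem s' 8 0 = m &
  merge_inv le (imem s 1) (imem s' 2) w m k (imem s' 4 0) (imem s' 5 0) (imem s' 6 0)].
pose J k s' := [/\ rmem s' = rmem s, imem s' 3 0 = w, imem s' 8 0 = m,
  perm_eq (slice (imem s' 2) 0 m) (slice (imem s 1) 0 m) /\ block_sorted le (w + w) m (imem s' 2) &
  forall t, (t < k)%N -> imem s' 1 t = imem s' 2 t].
apply: (@runs_weaken _ _ _ (straight_cost (ISet 4 (INum 0) (INum 0)) +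
  (straight_cost (ISet 5 (INum 0) (INum 0)) + (straight_cost (ISet 6 (INum 0) (reg 3)) +
   ((m * (straight_cost (Seq merge_shift (merge_pick ks)) + icost (reg 8) + 13) + icost (reg 8) + 9) +
    ((m * (straight_cost (ISet 1 (reg 7) (IGet 2 (reg 7))) + icost (reg 8) + 13) + icost (reg 8) + 9) +
     straight_cost (ISet 3 (INum 0) (IAdd (reg 3) (reg 3)))))))));
  [|rewrite /sort_cost; set c := straight_cost (Seq _ _); rewrite /=; nia|by move=> s' H; exact: H].
apply: runs_seq; apply: runs_straight => //; apply: runs_seq; apply: runs_straight => //.
apply: runs_seq; apply: runs_straight => //; apply: runs_seq.
apply: (@runs_for _ _ _ _ _ m _ I).
- split; rewrite /= /upd /= ?sw //.
  exact: merge_init.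
- by move=> k s' km [].
- move=> k s' km [Ir I1 I3 I8 Ii] xk; apply: runs_straight => //.
  set s1 := run merge_shift s'.
  (* After the possible shift, the current pair of blocks has room for cell [k]. *)
  have E : [/\ rmem s1 = rmem s, imem s1 1 = imem s 1, imem s1 3 0 = w, imem s1 8 0 = m & imem s1 7 0 = k] /\
     (k < imem s1 4 0 + w + w)%N /\
     merge_inv le (imem s 1) (imem s1 2) w m k (imem s1 4 0) (imem s1 5 0) (imem s1 6 0).
    rewrite /s1 /merge_shift /= I3 xk; case: ifP => c /=; last first.
      by rewrite I3 I8; split=> //; split=> //; rewrite ltnNge c.
    rewrite /upd /= I3 I8; split=> //; split; last exact: merge_next Ii.
    by case: Ii; lia.
  change (run (Seq merge_shift (merge_pick ks)) s') with (run (merge_pick ks) s1).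
  move: s1 E => s1 [[Jr J1 J3 J8 J7] [klo Ji]] {Ir I1 I3 I8 Ii xk}.
  have cE : beval s1 (BAnd (BILe (IAdd (reg 5) (INum 1)) (IAdd (reg 4) (reg 3)))
       (BNot (BAnd (BILe (IAdd (reg 6) (INum 1)) (IAdd (IAdd (reg 4) (reg 3)) (reg 3)))
         (BAnd (BILe (IAdd (reg 6) (INum 1)) (reg 8))
            (BNot (cmp_exp ks (IGet 1 (reg 5)) (IGet 1 (reg 6)))))))) =
      (imem s1 5 0 < imem s1 4 0 + w)%N && ~~ [&& (imem s1 6 0 < imem s1 4 0 + w + w)%N,
        (imem s1 6 0 < m)%N & ~~ le (imem s 1 (imem s1 5 0)) (imem s 1 (imem s1 6 0))].
    by cbn [beval]; rewrite beval_cmp_exp /= J1 J3 J8 Jr !addn1.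
  rewrite /merge_pick; cbn [run]; rewrite cE; case: ifP => c.
  + split; first by [].
    split; rewrite /= /upd /= ?J1 ?J3 ?J8 ?J7 //.
    apply: merge_take Ji _ _ => //; left; split=> //; rewrite ?addn1 //.
      by case/andP: c.
    by case/andP: c => _; rewrite !negb_and !negbK => /orP[/negbTE->//|/orP[/negbTE->//|->]].
  + split; first by [].
    split; rewrite /= /upd /= ?J1 ?J3 ?J8 ?J7 //.
    apply: merge_take Ji _ _ => //; right; split=> //; rewrite ?addn1 // => il.
    move: c; rewrite il /= => /negbFE /and3P[-> -> h]; split=> //.
    by have := tot (imem s 1 (imem s1 5 0)) (imem s 1 (imem s1 6 0)); rewrite (negbTE h).
move=> s2 [I2r I21 I23 I28 I2i].
have [Hp Hb] := merge_end w0 I2i.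
apply: runs_seq; apply: (@runs_for _ _ _ _ _ m _ J).
- by split.
- by move=> k s' km [].
- move=> k s' km [Jr J3 J8 J2 Jk] xk; apply: runs_straight => //; split=> //.
  split; rewrite //= /upd /= xk // => t; rewrite ltnS leq_eqVlt => /orP[/eqP->|tk].
    by rewrite eqxx.
  by rewrite (ltn_eqF tk) Jk.
move=> s3 [Kr K3 K8 [K2p K2b] Kk]; apply: runs_straight => //.
have E : slice (imem s3 1) 0 m = slice (imem s3 2) 0 m by apply: eq_slice => t tm; rewrite Kk.
split; rewrite /= /upd /= ?K3 //.
  by rewrite E.
move=> b x y wb bx xy yb ym; rewrite !Kk; try lia.
exact: (K2b b).
Qed.

Lemma sort_spec s m : imem s 8 0 = m ->
  runs (sort_cmd ks) s (3 * sort_cost ks * (m.+1 * (up_log 2 m).+1)) (fun s' =>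
    [/\ rmem s' = rmem s, perm_eq (slice (imem s' 1) 0 m) (slice (imem s 1) 0 m) &
        forall x y, (x <= y)%N -> (y < m)%N -> key_le (rmem s) ks (imem s' 1 x) (imem s' 1 y)]).
Proof.
move=> sm; pose le := key_le (rmem s) ks.
(* At most [q] doublings of the width are left; once the width reaches [m], one sorted block is the
   whole array. *)
pose I q s' := exists2 w, [/\ imem s' 3 0 = w, (0 < w)%N, imem s' 8 0 = m & (m <= w * 2 ^ q)%N] &
  [/\ rmem s' = rmem s, perm_eq (slice (imem s' 1) 0 m) (slice (imem s 1) 0 m) &
      block_sorted le w m (imem s' 1)].
apply: (@runs_weaken _ _ _ (straight_cost (ISet 3 (INum 0) (INum 1)) +
  (up_log 2 m * (bcost (BILe (IAdd (reg 3) (INum 1)) (reg 8)) + sort_cost ks * m.+1).+1 +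
   (bcost (BILe (IAdd (reg 3) (INum 1)) (reg 8))).+1)));
  [|by rewrite /sort_cost; set c := straight_cost (Seq _ _); rewrite /=; nia|by move=> s' H; exact: H].
apply: runs_seq; apply: runs_straight => //.
apply: runs_weaken (leqnn _) _; first apply: (@runs_while _ _ _ _ _ I).
- move=> q s' [w [Iw w0 Im mw] [Ir Ip Ib]] /=; rewrite Iw Im addn1 => wm.
  case: q mw => [|q] mw; first by rewrite muln1 leqNgt wm in mw.
  exists q => //; apply: runs_weaken (leqnn _) _; first apply: (merge_pass_spec Iw Im w0).
    by rewrite Ir.
  move=> s2 [Jr J3 J8 Jp Jb]; exists (w + w)%N; split=> //; try lia.
  - by move: mw; rewrite expnS; nia.
  - by rewrite Jr.
  - exact: perm_trans Jp Ip.
  - by rewrite /le -Ir.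
- exists 1%N; split=> //=; first by rewrite mul1n up_logP.
  move=> b x y _ bx xy yb _.
  have -> : x = y by lia.
  by rewrite /le /key_le before_irr.
- move=> s' [nb [q [w [Iw w0 Im mw] [Ir Ip Ib]]]]; split=> //.
  move: nb; rewrite /= Iw Im => nb x y xy ym; apply: (Ib 0%N) => //; lia.
Qed.

End Sort.

(** * Expectation along a fixed order *)

Infix ";;" := Seq (at level 60, right associativity).

(* Arrays 0 to [d] hold the input.  Opaque, so that conversion never computes codes of triples. *)
Lemma naming d : {f : nat * nat * nat -> nat | injective f /\ forall x, (d < f x)%N}.
Proof.
exists (fun x => (d.+1 + pickle x)%N); split=> [x y /eqP|x]; last by rewrite leq_addr.
by rewrite eqn_add2l => /eqP /(pcan_inj pickleK).
Qed.

Section Names.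
Variable d : nat.

Definition rname : nat * nat * nat -> nat := sval (naming d).
(** Every level keeps its own copy of the points: the tie-breaking keys and the next rounds of the
    outer loops still read the earlier levels. *)
Definition level_name k c := rname (0, k, c)%N.
Definition factor_name := rname (1, 0, 0)%N.
Definition time_name := rname (2, 0, 0)%N.
Definition product_name := rname (3, 0, 0)%N.
Definition acc_name c := rname (4, 0, c)%N.
Definition out_name c := rname (5, 0, c)%N.

Lemma rname_eq x y : (rname x == rname y) = (x == y).
Proof. by apply: inj_eq; have [] := svalP (naming d). Qed.

Lemma rname_input x c : (c <= d)%N -> ((c == rname x) = false) * ((rname x == c) = false).
Proof. by have [_ /(_ x)] := svalP (naming d); rewrite -/rname; split; lia. Qed.

Definition emit :=
  Each (fun c => RSet (out_name c) (reg 14) (RGet (acc_name c) (INum 0))) d ;;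
  ISet 14 (INum 0) (IAdd (reg 14) (INum 1)).

(** [product_name] holds the probability that all points scanned so far are absent, which is the
    factor of the next one. *)
Definition scan_step :=
  ISet 15 (INum 0) (IGet 1 (reg 12)) ;;
  RSet factor_name (reg 15) (RGet product_name (INum 0)) ;;
  Each (fun c => RSet (acc_name c) (INum 0)
    (RAdd (RGet (acc_name c) (INum 0))
      (RMul (RMul (RGet d (reg 15)) (RGet product_name (INum 0))) (RGet c (reg 15))))) d ;;
  RSet product_name (INum 0)
    (RMul (RGet product_name (INum 0)) (RSub (RNum 1) (RGet d (reg 15)))).

Definition init_order ks :=
  For 12 (reg 0) (ISet 1 (reg 12) (reg 12)) ;;
  ISet 8 (INum 0) (reg 0) ;;
  sort_cmd ks ;;
  RSet product_name (INum 0) (RNum 1) ;;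
  Each (fun c => RSet (acc_name c) (INum 0) (RNum 0)) d ;;
  For 12 (reg 0) scan_step.

End Names.

Section Leaf.
Variables (R : realType) (d n : nat) (rm0 : nat -> nat -> R).
Implicit Types (s : state R) (bf : rel nat).

Local Notation p := (rm0 d).

Definition has_input s := imem s 0 0 = n /\ forall c, (c <= d)%N -> rmem s c = rm0 c.

(** With [order_coord], this restates [order_point] on memory cells: natural indices, one coordinate
    at a time. *)
Definition order_factor bf i : R := \prod_(0 <= j < n | bf j i) (1 - p j).
Definition order_coord bf c : R := \sum_(0 <= i < n) p i * order_factor bf i * rm0 c i.

Definition outputs s : seq 'rV[R]_d :=
  mkseq (fun e => \row_(c < d) rmem s (out_name d c) e) (imem s 14 0).

Lemma emit_spec s : let s' := run (emit d) s in
  outputs s' = rcons (outputs s) (\row_(c < d) rmem s (acc_name d c) 0%N).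
Proof.
move=> s'.
pose I c s1 := [/\ imem s1 = imem s, forall c', rmem s1 (acc_name d c') = rmem s (acc_name d c'),
  forall c', (c' < c)%N -> rmem s1 (out_name d c') (imem s 14 0) = rmem s (acc_name d c') 0 &
  forall c' e, (e < imem s 14 0)%N -> rmem s1 (out_name d c') e = rmem s (out_name d c') e].
have := @run_Each R (fun c => RSet (out_name d c) (reg 14) (RGet (acc_name d c) (INum 0))) d I s.
case=> [c s1 cd [I1 I2 I3 I4]|//|J1 _ J3 J4].
  split=> //= [c'|c' c'c|c' e eE]; rewrite ?I1.
  - by rewrite upd_ne // rname_eq.
  - rewrite /upd rname_eq !xpair_eqE /= eqxx andbT.
    by case: eqP => [->|/eqP ne]; rewrite ?I2 // I3 //; lia.
  - rewrite /upd (ltn_eqF eE) andbF I4 //.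
rewrite /s' /outputs /= /upd /= J1 addn1 mkseqS; congr rcons.
  apply/eq_in_map => e; rewrite mem_iota => /= eE.
  by apply/rowP => c; rewrite !mxE J4.
by apply/rowP => c; rewrite !mxE J3.
Qed.

Section SortedOrder.
Variables (fs : seq (nat -> R)) (pi : nat -> nat).
Hypothesis pi_perm : perm_eq (slice pi 0 n) (iota 0 n).
Hypothesis pi_sorted : forall x y, (x <= y)%N -> (y < n)%N -> ~~ before fs (pi y) (pi x).
Hypothesis sep : forall i j, (i < n)%N -> (j < n)%N -> ties fs i j -> i = j.

Lemma big_perm_iota (T : Type) (idx : T) (op : Monoid.com_law idx) (P : pred nat) (F : nat -> T) :
  \big[op/idx]_(0 <= j < n | P j) F j = \big[op/idx]_(0 <= t < n | P (pi t)) F (pi t).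
Proof.
rewrite /index_iota subn0 -(perm_big _ pi_perm) /slice subn0 big_map.
by [].
Qed.

Lemma pi_lt t : (t < n)%N -> (pi t < n)%N.
Proof.
move=> tn; have : pi t \in iota 0 n.
  by rewrite -(perm_mem pi_perm) map_f // mem_iota subn0.
by rewrite mem_iota.
Qed.

Lemma pi_inj x y : (x < n)%N -> (y < n)%N -> pi x = pi y -> x = y.
Proof.
move=> xn yn E; have : uniq (slice pi 0 n) by rewrite (perm_uniq pi_perm) iota_uniq.
have sz : size (slice pi 0 n) = n by rewrite size_map size_iota subn0.
move=> /(nth_uniq 0%N); rewrite sz => /(_ x y xn yn).
by rewrite !(nth_map 0%N) ?size_iota ?subn0 // !nth_iota ?subn0 // !add0n E eqxx => /esym/eqP.
Qed.

(** Without ties, being sorted identifies the order of the keys with that of the positions. *)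
Lemma before_sorted t' t : (t' < n)%N -> (t < n)%N -> before fs (pi t') (pi t) = (t' < t)%N.
Proof.
move=> tn' tn; have [tt|tt] := ltnP t' t; last exact/negbTE/pi_sorted.
have := before_total fs (pi t') (pi t).
rewrite (negbTE (pi_sorted (ltnW tt) tn)) /= => /orP[//|/sep E].
by have := pi_inj tn tn' (E (pi_lt tn) (pi_lt tn')); lia.
Qed.

Lemma order_factor_sorted t : (t < n)%N ->
  order_factor (before fs) (pi t) = \prod_(0 <= t' < t) (1 - p (pi t')).
Proof.
move=> tn; rewrite /order_factor big_perm_iota (@big_cat_nat _ _ _ t) ?(ltnW tn) //=.
rewrite [X in _ * X]big_nat_cond [X in _ * X]big1 ?mulr1.
  rewrite [LHS]big_nat_cond [RHS]big_nat_cond; apply: eq_bigl => t'.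
  have [tt|//] := ltnP t' t; rewrite before_sorted ?tt //; lia.
by move=> t' /andP[h]; rewrite before_sorted //; lia.
Qed.

Lemma order_coord_sorted c : order_coord (before fs) c =
  \sum_(0 <= t < n) p (pi t) * (\prod_(0 <= t' < t) (1 - p (pi t'))) * rm0 c (pi t).
Proof.
rewrite /order_coord big_perm_iota; apply: eq_big_nat => t tn.
by rewrite order_factor_sorted.
Qed.

End SortedOrder.

(** Sequential updates act like a simultaneous one, because [f c] may depend on no accumulator but
    its own. *)
Lemma run_Each_acc (f : nat -> rexp) s :
  (forall c s', (c < d)%N -> imem s' = imem s ->
    (forall a, (forall c', a != acc_name d c') -> rmem s' a = rmem s a) ->
    rmem s' (acc_name d c) = rmem s (acc_name d c) -> reval s' (f c) = reval s (f c)) ->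
  let s' := run (Each (fun c => RSet (acc_name d c) (INum 0) (f c)) d) s in
  [/\ imem s' = imem s, forall a, (forall c', a != acc_name d c') -> rmem s' a = rmem s a &
      forall c, (c < d)%N -> rmem s' (acc_name d c) 0 = reval s (f c)].
Proof.
move=> Hf; pose I c s1 := [/\ imem s1 = imem s,
  forall a, (forall c', a != acc_name d c') -> rmem s1 a = rmem s a,
  forall c', (c <= c')%N -> rmem s1 (acc_name d c') = rmem s (acc_name d c') &
  forall c', (c' < c)%N -> rmem s1 (acc_name d c') 0 = reval s (f c')].
have := @run_Each R (fun c => RSet (acc_name d c) (INum 0) (f c)) d I s.
case=> [c s1 cd [I1 I2 I3 I4]|//|J1 J2 _ J4]; last by split.
split=> //= [a an|c' cc'|c' c'c].
- by rewrite upd_ne ?I2 //; apply/negbTE.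
- by rewrite upd_ne ?I3 1?ltnW // rname_eq !xpair_eqE /=; lia.
- rewrite /upd rname_eq !xpair_eqE /= eqxx andbT; case: eqP => [->|/eqP ne].
    by apply: Hf => //; apply: I3.
  by rewrite I4 //; lia.
Qed.

Lemma init_order_spec ks s : has_input s ->
  let fs := key_vals (rmem s) ks in
  (forall i j, (i < n)%N -> (j < n)%N -> ties fs i j -> i = j) ->
  runs (init_order d ks) s ((100 * d.+1 + 3 * sort_cost ks) * (n.+1 * (up_log 2 n).+1)) (fun s' =>
    (forall i, (i < n)%N -> rmem s' (factor_name d) i = order_factor (before fs) i) /\
    (forall c, (c < d)%N -> rmem s' (acc_name d c) 0 = order_coord (before fs) c)).
Proof.
move=> [sn sin] fs sep.
eapply runs_bound.
  apply: runs_seq.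
  eapply (@runs_for _ _ _ _ _ n _ (fun k s' => [/\ has_input s', rmem s' = rmem s & forall t, (t < k)%N -> imem s' 1 t = t])).
  - by split.
  - by move=> k s' kn [[] ].
  - move=> k s' kn [[In Iin] Ir It] xk; apply: runs_straight => //; split=> //; split=> //= t.
    by rewrite ltnS leq_eqVlt /upd /= xk => /orP[/eqP->|tk]; rewrite ?eqxx // (ltn_eqF tk) It.
  move=> s1 [[In Iin] Ir It].
  apply: runs_seq; apply: runs_straight => //; apply: runs_seq.
  eapply runs_weaken; [eapply runs_frame; apply: (@sort_spec _ _ _ n) => //| |].
  - exact: leqnn.
  move=> s2 [[J1 J2 J3] Jf _].
  apply: runs_seq; apply: runs_straight => //.
  apply: runs_seq; apply: runs_straight; first exact: straight_Each.
  set s3 := run (Each _ _) _.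
  have [K1 K2 K3] := @run_Each_acc (fun=> RNum 0) (run (RSet (product_name d) (INum 0) (RNum 1)) s2) (fun _ _ _ _ _ _ => erefl).
  rewrite -/s3 in K1 K2 K3.
  pose pi := imem s2 1.
  have pi_perm : perm_eq (slice pi 0 n) (iota 0 n).
    rewrite (perm_trans J2) // /slice subn0 -[X in perm_eq _ X]map_id.
    rewrite (_ : map _ _ = map id (iota 0 n)) //.
    by apply/eq_in_map => t; rewrite mem_iota => /andP[_ tn]; apply: It.
  have pi_sorted x y : (x <= y)%N -> (y < n)%N -> ~~ before fs (pi y) (pi x).
    by move=> xy yn; have := J3 x y xy yn; rewrite /key_le /= Ir.
  pose K k s' := [/\ has_input s', imem s' 1 = pi,
    rmem s' (product_name d) 0 = \prod_(0 <= t < k) (1 - p (pi t)),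
    forall t, (t < k)%N -> rmem s' (factor_name d) (pi t) = \prod_(0 <= t' < t) (1 - p (pi t')) &
    forall c, (c < d)%N -> rmem s' (acc_name d c) 0 =
      \sum_(0 <= t < k) p (pi t) * (\prod_(0 <= t' < t) (1 - p (pi t'))) * rm0 c (pi t)].
  eapply (@runs_for _ _ _ _ _ n _ K).
  + split=> //=.
    * split; first by rewrite /= /upd /= K1 /= Jf.
      move=> c cd; rewrite K2 /=; last by move=> c'; rewrite rname_input.
      by rewrite upd_ne ?J1 ?Iin // rname_input.
    * by rewrite /= /upd /= K1.
    * rewrite K2; last by move=> c'; rewrite rname_eq.
      by rewrite /= /upd !eqxx big_geq.
    * by move=> c cd; rewrite K3 // big_geq.
  + by move=> k s' kn [[]].
  + move=> k s' kn [[Ln Li] L1 Lq Lf La] xk.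
    apply: runs_straight; first by rewrite /= straight_Each.
    set sA := run (RSet (factor_name d) (reg 15) (RGet (product_name d) (INum 0)))
      (run (ISet 15 (INum 0) (IGet 1 (reg 12))) s').
    have E15 : imem sA 15 0 = pi k by rewrite /sA /= /upd /= xk L1.
    have [|M1 M2 M3] := @run_Each_acc (fun c => RAdd (RGet (acc_name d c) (INum 0))
      (RMul (RMul (RGet d (reg 15)) (RGet (product_name d) (INum 0))) (RGet c (reg 15)))) sA.
      move=> c s'' cd I'' H'' A'' /=; rewrite I'' A'' !H'' // => c'; by rewrite ?rname_eq ?rname_input // ltnW.
    change (run (scan_step d) s') with (run (RSet (product_name d) (INum 0)
      (RMul (RGet (product_name d) (INum 0)) (RSub (RNum 1) (RGet d (reg 15)))))
      (run (Each (fun c => RSet (acc_name d c) (INum 0) (RAdd (RGet (acc_name d c) (INum 0))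
      (RMul (RMul (RGet d (reg 15)) (RGet (product_name d) (INum 0))) (RGet c (reg 15))))) d) sA)).
    move: (run (Each _ _) _) M1 M2 M3 => sB M1 M2 M3.
    have A2 c : (c <= d)%N -> rmem sA c = rm0 c.
      by move=> cd; rewrite /sA /= upd_ne ?Li // rname_input.
    have Aq : rmem sA (product_name d) 0 = \prod_(0 <= t < k) (1 - p (pi t)).
      by rewrite /sA /= upd_ne ?rname_eq.
    have Aa c : rmem sA (acc_name d c) = rmem s' (acc_name d c).
      by rewrite /sA /= upd_ne ?rname_eq.
    have Af t : rmem sA (factor_name d) t = if t == pi k then \prod_(0 <= t < k) (1 - p (pi t))
        else rmem s' (factor_name d) t.
      by rewrite /sA /= {1}/upd eqxx /upd /= xk L1 Lq.
    have Bq a : (a <= d)%N -> rmem sB a = rm0 a.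
      by move=> ad; rewrite M2 ?A2 // => c'; rewrite rname_input.
    have [A0 A12 A1] : [/\ imem sA 0 0 = n, imem sA 12 0 = k & imem sA 1 = pi] by [].
    clearbody sA; split; first by rewrite /= M1.
    split=> /=.
    * split; first by rewrite /upd /= M1.
      by move=> c cd /=; rewrite upd_ne ?Bq // rname_input.
    * by rewrite /upd /= M1.
    * rewrite {1}/upd !eqxx /= M1 E15 (Bq d) // M2 ?Aq => [|c']; last by rewrite rname_eq.
      by rewrite big_nat_recr.
    * move=> t; rewrite ltnS leq_eqVlt upd_ne ?rname_eq // M2 => [|c']; last by rewrite rname_eq.
      rewrite Af => /orP[/eqP->|tk]; first by rewrite eqxx.
      case: eqP => [/(pi_inj pi_perm (ltn_trans tk kn) kn) e|_]; last exact: Lf.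
      by rewrite e ltnn in tk.
    * move=> c cd; rewrite upd_ne ?rname_eq // M3 //= E15 Aq Aa La // (A2 d) // (A2 c) 1?ltnW //.
      by rewrite big_nat_recr //= ; congr (_ + _); ring.
  move=> s4 [_ _ _ Nf Na]; split=> [i im|c cd].
    have : i \in slice pi 0 n by rewrite (perm_mem pi_perm) mem_iota.
    move=> /mapP [t]; rewrite mem_iota subn0 => /andP[_ tn] ->.
    by rewrite Nf // (order_factor_sorted pi_perm).
  by rewrite Na // (order_coord_sorted pi_perm).
rewrite /scan_step; cbn [straight_cost icost rcost reg].
rewrite (straight_cost_Each _ (K := 3)) // (straight_cost_Each _ (K := 15)) //.
set C := sort_cost ks; set X := (n.+1 * _)%N.
have nX : (n.+1 <= X)%N by rewrite leq_pmulr.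
rewrite mulnDl; have : (100 * d.+1 * n.+1 <= 100 * d.+1 * X)%N by rewrite leq_mul2l nX orbT.
by move: (3 * C * X)%N (100 * d.+1 * X)%N => a b; lia.
Qed.

End Leaf.

(** * Rotating sweep *)

Section SweepMath.
Variables (R : realType) (d n : nat) (rm0 : nat -> nat -> R).
Implicit Types (bf : rel nat).

Local Notation p := (rm0 d).
Local Notation order_factor := (order_factor d n rm0).
Local Notation order_coord := (order_coord d n rm0).

Hypothesis p1 : forall i, (i < n)%N -> 1 - p i != 0.

Lemma eq_order_factor bf bf' i : (forall j, (j < n)%N -> bf j i = bf' j i) ->
  order_factor bf i = order_factor bf' i.
Proof.
move=> E; rewrite /order_factor [LHS]big_nat_cond [RHS]big_nat_cond; apply: eq_bigl => j.
by have [jn|//] := ltnP j n; rewrite E.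
Qed.

Lemma eq_order_coord bf bf' c : (forall j i, (j < n)%N -> (i < n)%N -> bf j i = bf' j i) ->
  order_coord bf c = order_coord bf' c.
Proof.
move=> E; apply: eq_big_nat => i /= im.
by rewrite (@eq_order_factor bf bf') // => j jn; apply: E.
Qed.

Lemma order_factor_add bf bf' i j : (j < n)%N -> bf j i = false -> bf' j i ->
  (forall k, (k < n)%N -> k != j -> bf' k i = bf k i) ->
  order_factor bf' i = order_factor bf i * (1 - p j).
Proof.
move=> jn b b' E; rewrite /order_factor mulrC.
rewrite [LHS]big_mkcond [in RHS]big_mkcond /=.
rewrite [LHS](bigD1_seq j) ?[in RHS](bigD1_seq j) ?mem_index_iota ?iota_uniq //= b b' mul1r.
congr (_ * _); rewrite big_seq_cond [RHS]big_seq_cond; apply: eq_bigr => k.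
by rewrite mem_index_iota => /andP[/andP[_ kn] kj]; rewrite E.
Qed.

Section Swap.
Variables (bf bf' : rel nat) (i j : nat).
Hypotheses (im : (i < n)%N) (jn : (j < n)%N) (ij : i != j).
Hypotheses (bji : bf j i = false) (bij : bf i j) (b'ji : bf' j i) (b'ij : bf' i j = false).
Hypothesis same : forall k l, (k < n)%N -> (l < n)%N -> (k, l) != (i, j) -> (k, l) != (j, i) ->
  bf' k l = bf k l.

Lemma order_factor_swapl : order_factor bf' i = order_factor bf i * (1 - p j).
Proof.
apply: order_factor_add => // k kn kj; apply: same; rewrite // xpair_eqE negb_and.
  by rewrite ij orbT.
by rewrite kj.
Qed.

Lemma order_factor_swapr : order_factor bf' j = order_factor bf j / (1 - p i).
Proof.
rewrite (@order_factor_add bf' bf j i) ?mulfK ?p1 // => k kn ki.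
apply/esym/same => //; rewrite xpair_eqE negb_and ?ki //.
by rewrite [j == i]eq_sym ij orbT.
Qed.

Lemma order_factor_swap_other k : (k < n)%N -> k != i -> k != j ->
  order_factor bf' k = order_factor bf k.
Proof.
move=> kn ki kj; apply: eq_order_factor => l ln.
by apply: same; rewrite // xpair_eqE negb_and ?ki ?kj orbT.
Qed.

(** When [j] overtakes [i], the factor of [j] loses [1 - p i] and that of [i] gains [1 - p j]. The
    relations need not be orders; they only have to differ on this one pair, as happens in the
    middle of simultaneous events. *)
Lemma order_coord_swap c : order_coord bf' c = order_coord bf c +
  (p j * (order_factor bf j / (1 - p i) - order_factor bf j) * rm0 c j +
   p i * (order_factor bf i * (1 - p j) - order_factor bf i) * rm0 c i).
Proof.
have split2 (F : nat -> R) : \sum_(0 <= k < n) F k =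
    F i + (F j + \sum_(k <- [seq k <- index_iota 0 n | k != i] | k != j) F k).
  rewrite (bigD1_seq i) ?mem_index_iota ?iota_uniq //= -big_filter.
  rewrite (bigD1_seq j) ?filter_uniq ?iota_uniq //= mem_filter mem_index_iota jn eq_sym ij //.
rewrite /order_coord !split2 order_factor_swapl order_factor_swapr.
have -> : \sum_(k <- [seq k <- index_iota 0 n | k != i] | k != j) p k * order_factor bf' k * rm0 c k =
  \sum_(k <- [seq k <- index_iota 0 n | k != i] | k != j) p k * order_factor bf k * rm0 c k.
  rewrite big_seq_cond [RHS]big_seq_cond; apply: eq_bigr => k.
  rewrite mem_filter mem_index_iota => /andP[/andP[ki kn] kj].
  by rewrite order_factor_swap_other.
ring.
Qed.

End Swap.

Variables (A B : nat -> R) (T : seq (nat -> R)).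

(** The [t] at which [B + t * A] takes equal values at [i] and [j], provided that [A] differs
    there. *)
Definition event_time i j := (B j - B i) / (A i - A j).

(** The order by [B + t * A] for [t] near minus infinity; [event_keys t] is the order immediately
    after time [t], when a larger slope [A] wins ties. *)
Definition start_keys := (fun r => - A r) :: B :: T.
Definition event_keys t := (fun r => B r + t * A r) :: A :: T.

(* The order reached once the events of [S] have been processed: the event
   [i * n + j] exchanges the points [i] and [j] when [A i < A j]. *)
Definition swept (S : pred nat) : rel nat := fun j i =>
  if A i == A j then before start_keys j i
  else if A i < A j then S (i * n + j)%N else ~~ S (j * n + i)%N.

Lemma event_timeC i j : event_time i j = event_time j i.
Proof. by rewrite /event_time -opprB -[A i - A j]opprB invrN mulrNN. Qed.

Lemma swept0 j i : swept pred0 j i = before start_keys j i.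
Proof.
by rewrite /swept /= ltrN2 eqr_opp; case: (ltgtP (A i) (A j)).
Qed.

(** The point with the larger slope is ahead right after [t] iff its crossing with the other has
    occurred by [t]. *)
Lemma swept_event t (S : pred nat) :
  (forall i j, (i < n)%N -> (j < n)%N -> S (i * n + j)%N = (event_time i j <= t)) ->
  forall j i, (j < n)%N -> (i < n)%N -> swept S j i = before (event_keys t) j i.
Proof.
move=> HS j i jn im; rewrite /swept.
have [e|ne] := eqVneq (A i) (A j).
  by rewrite /start_keys /event_keys /= e !eqxx !ltxx /= ltrD2r (inj_eq (addIr _)).
have tE i' j' : A i' != A j' -> B i' + t * A i' - (B j' + t * A j') = (t - event_time i' j') * (A i' - A j').
  by rewrite -subr_eq0 /event_time => h; field.
have E : (B i + t * A i < B j + t * A j) || ((B i + t * A i == B j + t * A j) && (A i < A j)) =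
    (if A i < A j then event_time i j <= t else t < event_time i j).
  rewrite -(subr_lt0 _ (B i + _)) -(subr_eq0 (B i + _)) tE // mulf_eq0 !subr_eq0 (negbTE ne) orbF.
  case: (ltgtP (A i) (A j)) ne => // h _; first by
    rewrite nmulr_llt0 ?subr_lt0 // subr_gt0 andbT orbC eq_sym -le_eqVlt.
  by rewrite pmulr_llt0 ?subr_gt0 // subr_lt0 andbF orbF.
rewrite /= (negbTE ne) /= orbF E; case: ifP => _; rewrite HS //.
by rewrite -ltNge event_timeC.
Qed.

Lemma swept_id_lt S S' j i : (forall x, (x < n * n)%N -> S x = S' x) -> (j < n)%N -> (i < n)%N ->
  swept S j i = swept S' j i.
Proof. by move=> E jn im; rewrite /swept !E //; nia. Qed.

Lemma event_id_inj i j i' j' : (j < n)%N -> (j' < n)%N ->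
  (i * n + j == i' * n + j')%N = (i == i') && (j == j').
Proof.
move=> jn j'n; apply/eqP/andP => [E|[/eqP-> /eqP->]//].
have n0 : (0 < n)%N by lia.
have /(congr1 (modn^~ n)) := E; rewrite !modnMDl !modn_small // => ->; split=> //.
have /(congr1 (divn^~ n)) := E; rewrite !divnMDl // !divn_small // !addn0 => ->.
by [].
Qed.

(** A pair with distinct slopes occurs in two events, of which only the one with [A i < A j] has an
    effect. *)
Lemma swept_step S i j c : (i < n)%N -> (j < n)%N -> ~~ S (i * n + j)%N ->
  let S' := [pred x | S x || (x == i * n + j)%N] in
  if A i < A j then
    [/\ order_factor (swept S') i = order_factor (swept S) i * (1 - p j),
        order_factor (swept S') j = order_factor (swept S) j / (1 - p i),
        forall k, (k < n)%N -> k != i -> k != j ->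
          order_factor (swept S') k = order_factor (swept S) k &
        order_coord (swept S') c = order_coord (swept S) c +
          (p j * (order_factor (swept S) j / (1 - p i) - order_factor (swept S) j) * rm0 c j +
           p i * (order_factor (swept S) i * (1 - p j) - order_factor (swept S) i) * rm0 c i)]
  else forall k l, (k < n)%N -> (l < n)%N -> swept S' k l = swept S k l.
Proof.
move=> im jn nS S'; case: ifP => [Aij|nAij]; last first.
  move=> k l kn ln; rewrite /swept /S' /= !event_id_inj //.
  case: (ltgtP (A l) (A k)) => // h.
    case: andP => [[/eqP li /eqP kj]|_]; last by rewrite orbF.
    by rewrite -li -kj h in nAij.
  case: andP => [[/eqP ki /eqP lj]|_]; last by rewrite orbF.
  by rewrite -ki -lj h in nAij.
have ij : i != j by apply/eqP => e; rewrite e ltxx in Aij.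
have h1 : swept S j i = false by rewrite /swept (lt_eqF Aij) Aij (negbTE nS).
have h2 : swept S i j by rewrite /swept (gt_eqF Aij) ltNge (ltW Aij).
have h3 : swept S' j i by rewrite /swept (lt_eqF Aij) Aij /S' /= eqxx orbT.
have h4 : swept S' i j = false by rewrite /swept (gt_eqF Aij) ltNge (ltW Aij) /S' /= eqxx orbT.
have h5 k l : (k < n)%N -> (l < n)%N -> (k, l) != (i, j) -> (k, l) != (j, i) -> swept S' k l = swept S k l.
  move=> kn ln; rewrite !xpair_eqE => kl1 kl2; rewrite /swept /S' /= !event_id_inj //.
  by rewrite [(l == i) && _]andbC (negbTE kl1) (negbTE kl2) !orbF.
split.
- exact: order_factor_swapl.
- exact: order_factor_swapr.
- by move=> k kn ki kj; apply: (order_factor_swap_other h5).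
- exact: order_coord_swap.
Qed.

End SweepMath.

(** * The sweep as a program *)

Section SweepCode.
Variable d : nat.

Local Notation factor e := (RGet (factor_name d) e).
Local Notation prob e := (RGet d e).

(* Event [e] exchanges the points stored in cells [e] of arrays 10 and 11.  Two
   points with equal [a]-coordinates get time 0, by division by 0; this is
   harmless, since [exchange] skips them. *)
Definition pair_step (a b : nat) :=
  ISet 1 (reg 9) (reg 9) ;;
  ISet 10 (reg 9) (reg 12) ;;
  ISet 11 (reg 9) (reg 13) ;;
  RSet (time_name d) (reg 9)
    (RDiv (RSub (RGet b (reg 13)) (RGet b (reg 12))) (RSub (RGet a (reg 12)) (RGet a (reg 13)))) ;;
  ISet 9 (INum 0) (IAdd (reg 9) (INum 1)).

Definition list_pairs a b :=
  ISet 9 (INum 0) (INum 0) ;;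
  For 12 (reg 0) (For 13 (reg 0) (pair_step a b)).

Definition acc_update c :=
  RSet (acc_name d c) (INum 0) (RAdd (RGet (acc_name d c) (INum 0)) (RAdd
    (RMul (RMul (prob (reg 16)) (RSub (RDiv (factor (reg 16)) (RSub (RNum 1) (prob (reg 15)))) (factor (reg 16)))) (RGet c (reg 16)))
    (RMul (RMul (prob (reg 15)) (RSub (RMul (factor (reg 15)) (RSub (RNum 1) (prob (reg 16)))) (factor (reg 15)))) (RGet c (reg 15))))).

(* The point in reg 16 overtakes the one in reg 15. *)
Definition exchange (k : bool * nat) :=
  If (BNot (BRLe (key_exp k (reg 16)) (key_exp k (reg 15))))
    (Each acc_update d ;;
     RSet (factor_name d) (reg 16) (RDiv (factor (reg 16)) (RSub (RNum 1) (prob (reg 15)))) ;;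
     RSet (factor_name d) (reg 15) (RMul (factor (reg 15)) (RSub (RNum 1) (prob (reg 16)))))
    Skip.

(* The output is extended only after the last one of several simultaneous events. *)
Definition event_step k :=
  ISet 15 (INum 0) (IGet 10 (IGet 1 (reg 12))) ;;
  ISet 16 (INum 0) (IGet 11 (IGet 1 (reg 12))) ;;
  exchange k ;;
  If (BAnd (BILe (IAdd (reg 12) (INum 2)) (reg 9))
       (BRLe (RGet (time_name d) (IGet 1 (IAdd (reg 12) (INum 1)))) (RGet (time_name d) (IGet 1 (reg 12)))))
    Skip (emit d).

(** Sorting is by decreasing keys, so the times enter with a negative sign. *)
Definition sweep sg a b :=
  list_pairs a b ;;
  ISet 8 (INum 0) (reg 9) ;;
  sort_cmd [:: (false, time_name d)] ;;
  For 12 (reg 9) (event_step (sg, a)).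

Lemma event_step_cost k : (straight_cost (event_step k) <= d * 60 + 100)%N.
Proof.
rewrite /event_step /exchange /emit; cbn [straight_cost icost rcost bcost reg].
rewrite (straight_cost_Each _ (K := 48)) // (straight_cost_Each _ (K := 5)) //.
by rewrite /key_exp; case: k.1 => /=; lia.
Qed.

End SweepCode.

(** * Correctness of the sweep program *)

Section Sweep.
Variables (R : realType) (d n : nat) (rm0 : nat -> nat -> R).
Implicit Types s : state R.
Local Notation p := (rm0 d).

Lemma list_pairs_spec s a b :
  a != time_name d -> b != time_name d -> imem s 0 0 = n ->
  runs (list_pairs d a b) s (100 * (n * n + n + 1)) (fun s' =>
    [/\ imem s' 9 0 = (n * n)%N, forall e, (e < n * n)%N -> imem s' 1 e = e,
      forall i j, (i < n)%N -> (j < n)%N -> imem s' 10 (i * n + j)%N = i /\ imem s' 11 (i * n + j)%N = j &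
      forall i j, (i < n)%N -> (j < n)%N ->
        rmem s' (time_name d) (i * n + j)%N = event_time (rmem s a) (rmem s b) i j]).
Proof.
move=> at_ bt sn.
pose I m s' := [/\ imem s' 0 0 = n, imem s' 9 0 = m, rmem s' a = rmem s a /\ rmem s' b = rmem s b,
  forall e, (e < m)%N -> imem s' 1 e = e &
  forall i j, (j < n)%N -> (i * n + j < m)%N ->
    [/\ imem s' 10 (i * n + j)%N = i, imem s' 11 (i * n + j)%N = j &
      rmem s' (time_name d) (i * n + j)%N = event_time (rmem s a) (rmem s b) i j]].
eapply runs_bound.
  apply: runs_seq; apply: runs_straight => //.
  eapply (@runs_for _ _ _ _ _ n _ (fun k => I (k * n)%N)).
  - by split.
  - by move=> k s' kn [].
  - move=> k s' kn Ik xk.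
    eapply (@runs_for _ _ _ _ _ n _ (fun l s'' => I (k * n + l)%N s'' /\ imem s'' 12 0 = k)).
    + by rewrite addn0; case: Ik.
    + by move=> l s'' ln [[]].
    + move=> l s'' ln [[I0 I9 [Ia Ib] I1 Iij] x12] x13; apply: runs_straight => //.
      split; first by [].
      split; last by [].
      have ta : (a == time_name d) = false by apply/negbTE.
      have tb : (b == time_name d) = false by apply/negbTE.
      split=> /=.
      * exact: I0.
      * by rewrite /upd /= I9; lia.
      * by rewrite !upd_ne.
      * move=> e el; rewrite /upd /= I9; case: eqP => [->//|ne]; rewrite I1 //; lia.
      * move=> i j jn ij; rewrite /upd /= eqxx I9 Ia Ib x12 x13 event_id_inj //=.
        case: andP => [[/eqP-> /eqP->]//|ne]; apply: Iij => //.
        suff : (i * n + j != k * n + l)%N by lia.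
        by rewrite event_id_inj //; apply/negP => /andP.
    + move=> s'' [Is x12]; split; first exact: x12.
      by move: Is; rewrite -mulSnr.
  move=> s' [I0 I9 _ I1 Iij]; split=> // i j im jn.
    by have [|-> -> _] := Iij i j jn; first nia.
  by have [|_ _ ->] := Iij i j jn; first nia.
rewrite /=; nia.
Qed.

Lemma eq_outputs s1 s2 : imem s1 14 0 = imem s2 14 0 ->
  (forall c, rmem s1 (out_name d c) = rmem s2 (out_name d c)) -> outputs d s1 = outputs d s2.
Proof.
move=> e14 eo; rewrite /outputs e14; apply/eq_in_map => e _.
by apply/rowP => c; rewrite !mxE eo.
Qed.

Definition order_row (bf : rel nat) : 'rV[R]_d := \row_(c < d) order_coord d n rm0 bf c.

Hypothesis p1 : forall i, (i < n)%N -> 1 - p i != 0.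

Lemma run_exchange s k A B T i j S : has_input d n rm0 s ->
  imem s 15 0 = i -> imem s 16 0 = j -> (i < n)%N -> (j < n)%N ->
  key_val (rmem s) k = A -> ~~ S (i * n + j)%N ->
  (forall l, (l < n)%N -> rmem s (factor_name d) l = order_factor d n rm0 (swept n A B T S) l) ->
  (forall c, (c < d)%N -> rmem s (acc_name d c) 0 = order_coord d n rm0 (swept n A B T S) c) ->
  let s' := run (exchange d k) s in
  let S' := [pred x | S x || (x == i * n + j)%N] in
  [/\ imem s' = imem s,
    forall a, a != factor_name d -> (forall c, a != acc_name d c) -> rmem s' a = rmem s a,
    forall l, (l < n)%N -> rmem s' (factor_name d) l = order_factor d n rm0 (swept n A B T S') l &
    forall c, (c < d)%N -> rmem s' (acc_name d c) 0 = order_coord d n rm0 (swept n A B T S') c].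
Proof.
move=> [sn sin] s15 s16 im jn kA nS Hf Ha s' S'.
have step c := @swept_step R d n rm0 p1 A B T S i j c im jn nS.
rewrite /= -/S' in step.
have cE : beval s (BNot (BRLe (key_exp k (reg 16)) (key_exp k (reg 15)))) = (A i < A j).
  by rewrite /= !reval_key_exp /= s15 s16 kA ltNge.
rewrite /s' /exchange; cbn [run]; rewrite cE; case: ifP => Aij; last first.
  move: (step 0%N); rewrite Aij => E; split=> // [l ln|c cd].
    by rewrite Hf //; apply: eq_order_factor => q qn; rewrite E.
  by rewrite Ha //; apply: eq_order_coord => q l qn ln; rewrite E.
rewrite Aij in step.
have [M1 M2 M3] : [/\ imem (run (Each (acc_update d) d) s) = imem s,
    forall a, (forall c', a != acc_name d c') -> rmem (run (Each (acc_update d) d) s) a = rmem s a &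
    forall c, (c < d)%N -> rmem (run (Each (acc_update d) d) s) (acc_name d c) 0 =
      order_coord d n rm0 (swept n A B T S') c].
  have [|M1 M2 M3] := @run_Each_acc R d (fun c => if acc_update d c is RSet _ _ e then e else RNum 0) s.
    move=> c s'' cd I'' H'' A'' /=; rewrite I'' A'' !H'' // => c'; by rewrite ?rname_eq ?rname_input // ltnW.
  split=> // c cd; rewrite M3 //= s15 s16 (Ha c cd) (sin d (leqnn d)) (sin c (ltnW cd)) (Hf i im) (Hf j jn).
  by have [_ _ _ ->] := step c.
move: (run (Each _ _) s) M1 M2 M3 => sB M1 M2 M3.
have Mp e : rmem sB d e = p e by rewrite M2 ?sin // => c'; rewrite rname_input.
have Mf e : rmem sB (factor_name d) e = rmem s (factor_name d) e by rewrite M2 // => c'; rewrite rname_eq.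
have dF : (d == factor_name d) = false by rewrite rname_input.
have ij : (i == j) = false by apply/negP => /eqP e; rewrite e ltxx in Aij.
split=> //=.
- by move=> a an ac; rewrite !upd_ne ?M2 //; apply/negbTE.
- move=> l ln; rewrite M1 s15 s16 !Mp; have [fi fj fo _] := step 0%N.
  rewrite {1}/upd eqxx /=; case: eqP => [->|/eqP li].
    by rewrite fi (upd_ne _ _ _ dF) Mp /upd ij andbF Mf Hf.
  rewrite /upd eqxx /=; case: eqP => [->|/eqP lj]; first by rewrite fj Mf Hf.
  by rewrite Mf Hf // fo.
- by move=> c cd; rewrite !upd_ne ?rname_eq // M3.
Qed.

(** The times are insensitive to a common change of sign, so [pair_step] can compute them from the
    unsigned coordinates. *)
Lemma event_time_signed sg (f g : nat -> R) i j :
  event_time (fun r => signed sg (f r)) (fun r => signed sg (g r)) i j = event_time f g i j.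
Proof.
by case: sg => //; rewrite /event_time /signed -!opprD invrN mulrNN.
Qed.

Lemma sweep_spec s sg l ca cb T : has_input d n rm0 s ->
  let a := level_name d l ca in let b := level_name d l cb in
  let A := fun r => signed sg (rmem s a r) in
  let B := fun r => signed sg (rmem s b r) in
  let row i j := order_row (before (event_keys A B T (event_time A B i j))) in
  (forall i, (i < n)%N ->
    rmem s (factor_name d) i = order_factor d n rm0 (before (start_keys A B T)) i) ->
  (forall c, (c < d)%N -> rmem s (acc_name d c) 0 = order_coord d n rm0 (before (start_keys A B T)) c) ->
  runs (sweep d sg a b) s (2000 * d.+1 * ((n * n + n).+1 * (up_log 2 (n * n)).+1)) (fun s' => exists o,
    [/\ outputs d s' = outputs d s ++ o, (size o <= n * n)%N,
      forall x, x \in o -> exists i j, [/\ (i < n)%N, (j < n)%N & x = row i j] &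
      forall i j, (i < n)%N -> (j < n)%N -> row i j \in o]).
Proof.
move=> [sn sin] a b A B row Hf Ha.
eapply runs_bound.
  apply: runs_seq; eapply runs_weaken; [eapply runs_frame; apply: (@list_pairs_spec s a b)| |].
  - by rewrite rname_eq.
  - by rewrite rname_eq.
  - exact: sn.
  - exact: leqnn.
  move=> s1 [[I9 I1 I10 It] Fi Fr].
  apply: runs_seq; apply: runs_straight => //; apply: runs_seq.
  eapply runs_weaken; [eapply runs_frame; apply: (@sort_spec _ _ _ (n * n)%N)| |].
  - by rewrite /= /upd /=.
  - exact: leqnn.
  move=> s2 [[Jr Jp Js] Ji _].
  set nn := (n * n)%N in I9 I1 Jp Js *.
  pose pi := imem s2 1; pose tm := rmem s2 (time_name d).
  have sl1 : slice (imem s1 1) 0 nn = iota 0 nn.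
    rewrite /slice subn0 -[RHS]map_id; apply/eq_in_map => t; rewrite mem_iota => /andP[_ tn].
    exact: I1.
  have pi_perm : perm_eq (slice pi 0 nn) (iota 0 nn) by move: Jp; rewrite /= /upd /= sl1.
  have pi_sorted x y : (x <= y)%N -> (y < nn)%N -> tm (pi x) <= tm (pi y).
    move=> xy yn; have := Js x y xy yn.
    by rewrite /key_le /= /key_val /= andbF orbF ltrN2 -leNgt /tm Jr.
  have tmE i j : (i < n)%N -> (j < n)%N -> tm (i * n + j)%N = event_time A B i j.
    by move=> im jn; rewrite /tm Jr /= It // event_time_signed.
  have decode x : (x < nn)%N -> exists i j, [/\ (i < n)%N, (j < n)%N & x = (i * n + j)%N].
    move=> xn; have n0 : (0 < n)%N by rewrite /nn in xn; nia.
    by exists (x %/ n)%N, (x %% n)%N; rewrite ltn_divLR // ltn_pmod // -divn_eq.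
  have idlt i j : (i < n)%N -> (j < n)%N -> (i * n + j < nn)%N by rewrite /nn; nia.
  pose S e : pred nat := fun x => x \in slice pi 0 e.
  (* Last clause: the order of a processed event has been output, unless the next event is
     simultaneous and the output is postponed. *)
  pose K e s' := [/\ has_input d n rm0 s' /\ imem s' 9 0 = nn,
    [/\ imem s' 1 = pi, imem s' 10 = imem s1 10, imem s' 11 = imem s1 11, rmem s' a = rmem s a &
        rmem s' (time_name d) = tm],
    forall i, (i < n)%N -> rmem s' (factor_name d) i = order_factor d n rm0 (swept n A B T (S e)) i,
    forall c, (c < d)%N -> rmem s' (acc_name d c) 0 = order_coord d n rm0 (swept n A B T (S e)) c &
    exists o, [/\ outputs d s' = outputs d s ++ o, (size o <= e)%N,
      forall x, x \in o -> exists i j, [/\ (i < n)%N, (j < n)%N & x = row i j] &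
      forall i j, (i < n)%N -> (j < n)%N -> S e (i * n + j)%N ->
        row i j \in o \/ (e < nn)%N /\ tm (pi e) <= event_time A B i j]].
  apply: (@runs_for _ _ _ _ _ nn _ K).
  - split.
    + split; first split.
      * by rewrite /= /upd /= Ji //= /upd /= Fi.
      * move=> c cd /=; rewrite Jr /= Fr ?sin //=; by rewrite rname_input.
      * by rewrite /= /upd /= Ji //= /upd /= I9.
    + split; rewrite //= ?upd_ne ?Ji //= ?upd_ne //.
      by rewrite Jr /= Fr //= rname_eq.
    + move=> i im; rewrite /= Jr /= Fr /= ?rname_eq // Hf //.
      by apply: eq_order_factor => j jn; rewrite -(swept0 n).
    + move=> c cd; rewrite /= Jr /= Fr /= ?rname_eq // Ha //.
      by apply: eq_order_coord => j i jn im; rewrite -(swept0 n).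
    + exists [::]; split=> //; rewrite cats0; apply: eq_outputs.
        by rewrite /= /upd /= Ji //= /upd /= Fi.
      by move=> c; rewrite /= Jr /= Fr //= rname_eq.
  - by move=> e s' en [[]].
  - move=> e s' en [[[K0 Kin] K9] [K1 K10 K11 Kra Kt] Kf Ka [em [Ko so os oc]]] x12.
    apply: runs_straight.
      by rewrite /= /exchange /= !straight_Each.
    have [i [j [im jn pe]]] := decode (pi e) (pi_lt pi_perm en).
    have tpe : tm (i * n + j)%N = tm (pi e) by rewrite pe.
    have [e10 e11] := I10 i j im jn.
    set sA := run (ISet 16 (INum 0) (IGet 11 (IGet 1 (reg 12))))
      (run (ISet 15 (INum 0) (IGet 10 (IGet 1 (reg 12)))) s').
    have A15 : imem sA 15 0 = i by rewrite /sA /= /upd /= x12 K1 K10 pe e10.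
    have A16 : imem sA 16 0 = j by rewrite /sA /= /upd /= x12 K1 K11 pe e11.
    have Ain : has_input d n rm0 sA by split.
    have kA : key_val (rmem sA) (sg, a) = A by apply/funext => r; rewrite /key_val /= Kra.
    have nS : ~~ S e (i * n + j)%N.
      rewrite /S -pe; apply/negP => /mapP [t]; rewrite mem_iota subn0 => /andP[_ te] E.
      by have := pi_inj pi_perm en (ltn_trans te en) E; lia.
    have [B1 B2 Bf Ba] := run_exchange Ain A15 A16 im jn kA nS Kf Ka.
    have SE x : S e.+1 x = S e x || (x == i * n + j)%N.
      rewrite /S /slice !subn0 -addn1 iotaD map_cat mem_cat /= inE -pe.
      by [].
    set sB := run (exchange d (sg, a)) sA in B1 B2 Bf Ba.
    have HK s3 : imem s3 0 0 = n -> imem s3 9 0 = nn -> imem s3 12 0 = e ->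
      imem s3 1 = pi -> imem s3 10 = imem s1 10 -> imem s3 11 = imem s1 11 ->
      (forall x, (forall c, x != out_name d c) -> rmem s3 x = rmem sB x) ->
      (exists o, [/\ outputs d s3 = outputs d s ++ o, (size o <= e.+1)%N,
      forall x, x \in o -> exists i j, [/\ (i < n)%N, (j < n)%N & x = row i j] &
      forall i j, (i < n)%N -> (j < n)%N -> S e.+1 (i * n + j)%N ->
        row i j \in o \/ (e.+1 < nn)%N /\ tm (pi e.+1) <= event_time A B i j]) ->
      imem s3 12 0 = e /\ K e.+1 (set_int s3 12 0 e.+1).
      move=> h0 h9 h12 h1 h10 h11 hr ho; split=> //; split=> //.
      - split=> //; split=> // c cd /=; rewrite hr => [|c']; last by rewrite rname_input.
        rewrite B2 => [||c']; rewrite ?rname_input //; exact: Kin.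
      - split=> //=; rewrite hr => [|c]; rewrite ?rname_eq // B2 => [||c]; rewrite ?rname_eq //.
      - move=> q qn /=; rewrite hr => [|c]; last by rewrite rname_eq.
        by rewrite Bf //; apply: eq_order_factor => r rn; apply: swept_id_lt => // x _; rewrite SE.
      - move=> c cd /=; rewrite hr => [|c']; last by rewrite rname_eq.
        by rewrite Ba //; apply: eq_order_coord => r q rn qn; apply: swept_id_lt => // x _; rewrite SE.
    have oB : outputs d sB = outputs d s ++ em.
      rewrite -Ko; apply: eq_outputs => [|c]; first by rewrite B1.
      by rewrite B2 => [||c']; rewrite ?rname_eq.
    have Bt : rmem sB (time_name d) = tm by rewrite B2 => [||c']; rewrite ?rname_eq.
    have bE : beval sB (BAnd (BILe (IAdd (reg 12) (INum 2)) (reg 9))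
       (BRLe (RGet (time_name d) (IGet 1 (IAdd (reg 12) (INum 1)))) (RGet (time_name d) (IGet 1 (reg 12))))) =
       (e.+1 < nn)%N && (tm (pi e.+1) <= tm (pi e)).
      by rewrite /= Bt B1 /sA /= /upd /= x12 K1 K9 addn2 addn1.
    change (run (event_step d (sg, a)) s') with (run (If (BAnd (BILe (IAdd (reg 12) (INum 2)) (reg 9))
       (BRLe (RGet (time_name d) (IGet 1 (IAdd (reg 12) (INum 1)))) (RGet (time_name d) (IGet 1 (reg 12)))))
       Skip (emit d)) sB).
    cbn [run]; rewrite bE; case: ifP => next.
      apply: HK; rewrite ?B1 //.
      exists em; split=> //; first exact: leqW.
      move=> i' j' im' jn'; rewrite SE => /orP[/(oc _ _ im' jn') [|[_ h]]|/eqP E]; first by left.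
        by right; case/andP: next => -> h'; split=> //; apply: le_trans h' h.
      by right; case/andP: next => -> h'; split=> //; rewrite -tmE // E -pe.
    have [Gi Gr] : (forall x, ~~ int_writes (emit d) x -> imem (run (emit d) sB) x = imem sB x) /\
      (forall x, ~~ real_writes (emit d) x -> rmem (run (emit d) sB) x = rmem sB x).
      by apply: run_frame; rewrite /= straight_Each.
    have iw x : (x == 14)%N = false -> imem (run (emit d) sB) x = imem sB x.
      by move=> x14; apply: Gi; rewrite /= int_writes_Each x14 orbF -all_predC; apply/allP.
    (* The next event, if any, is strictly later, so the processed events are exactly those up to
       the current time, as [swept_event] requires. *)
    have SE' x : (x < nn)%N -> S e.+1 x = (tm x <= tm (pi e)).
      move=> xn; have : x \in slice pi 0 nn by rewrite (perm_mem pi_perm) mem_iota.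
      move=> /mapP [y]; rewrite mem_iota subn0 => /andP[_ yn] ->.
      have -> : S e.+1 (pi y) = (y <= e)%N.
        apply/mapP/idP => [[t]|ye]; last by exists y => //; rewrite mem_iota subn0.
        rewrite mem_iota subn0 => /andP[_ te] E.
        by rewrite (pi_inj pi_perm yn _ E) //; apply: leq_ltn_trans en; rewrite -ltnS.
      have [ye|ey] := leqP y e; first by rewrite pi_sorted.
      apply/esym/negbTE; rewrite -ltNge; apply: lt_le_trans (pi_sorted e.+1 y ey yn).
      by move/negbT: next; rewrite negb_and -ltNge (leq_ltn_trans ey yn).
    have rowE : \row_(c < d) rmem sB (acc_name d c) 0%N = row i j.
      apply/rowP => c; rewrite !mxE Ba //; apply: eq_order_coord => q r qn rn.
      apply: swept_event => // i' j' im' jn'; rewrite -!tmE // tpe.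
      by rewrite -SE' ?SE //; apply: idlt.
    apply: HK; rewrite ?iw // ?B1 //.
      move=> x xo; apply: Gr; rewrite /= real_writes_Each orbF; apply/hasPn => c _.
      exact: xo.
    exists (rcons em (row i j)); split.
    - by rewrite emit_spec oB rowE rcons_cat.
    - by rewrite size_rcons ltnS.
    - move=> x; rewrite mem_rcons inE => /orP[/eqP->|/os //]; by exists i, j.
    - move=> i' j' im' jn' Sx; left; rewrite mem_rcons inE.
      have xn := idlt _ _ im' jn'.
      have le1 : event_time A B i' j' <= tm (pi e) by rewrite -tmE // -SE'.
      move: Sx; rewrite SE => /orP[/(oc _ _ im' jn') [->|[_ h]]|/eqP E]; first by rewrite orbT.
        suff -> : row i' j' = row i j by rewrite eqxx.
        by rewrite /row -[event_time A B i j]tmE // tpe (le_anti (introT andP (conj le1 h))).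
      suff -> : row i' j' = row i j by rewrite eqxx.
      by rewrite /row -!tmE // E.
  move=> s' [_ _ _ _ [em [Eo so os oc]]]; exists em; split=> // i j im jn.
  have [||[]] // := oc i j im jn; last by rewrite ltnn.
  by rewrite /S (perm_mem pi_perm) mem_iota idlt.
have cE := event_step_cost d (sg, a).
have sE : (3 * sort_cost [:: (false, time_name d)] <= 1000)%N by [].
set X := (_.+1 * (up_log 2 _).+1)%N in sE *.
set Y := ((n * n + n).+1 * _)%N.
have XY : (X <= Y)%N by rewrite leq_mul2r; apply/orP; right; lia.
have nY : ((n * n + n).+1 <= Y)%N by rewrite leq_pmulr.
move: sE; set Z := sort_cost _ => sE.
have : (3 * Z * X <= 1000 * Y)%N by apply: leq_mul.
move: (straight_cost (event_step _ _)) cE => w cE; rewrite [icost _]/= [straight_cost _]/=.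
have : (n * n * (w + 2 + 13) <= (60 * d + 120) * Y)%N.
  by rewrite mulnC; apply: leq_mul; lia.
by move: (3 * Z * X)%N (_ * _ * (_ + _))%N => x y; nia.
Qed.

End Sweep.

(** * Recursive elimination of coordinates *)

Section LeafCode.
Variable d : nat.

(** Treats the directions whose last coordinate has the sign [sg]. The first branch is reached only
    for [d = 1], where no plane is available. *)
Definition half_leaf (sg : bool) (k : nat) (T : seq (bool * nat)) : cmd :=
  if k.+1 == d then init_order d ((sg, level_name d k k) :: T) ;; emit d
  else (init_order d ((~~ sg, level_name d k k) :: (sg, level_name d k k.+1) :: T) ;; emit d) ;;
    sweep d sg (level_name d k k) (level_name d k k.+1).

Definition leaf k T := half_leaf true k T ;; half_leaf false k T.

Definition eliminate_step (k c : nat) : cmd :=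
  let x c e := RGet (level_name d k c) e in
  let i := reg (20 + 2 * k) in
  let j := reg (21 + 2 * k) in
  RSet (level_name d k.+1 c) (reg 12)
    (RSub (x c (reg 12)) (RMul (RDiv (x k (reg 12)) (RSub (x k i) (x k j))) (RSub (x c i) (x c j)))).

Definition eliminate_cmd k : cmd := For 12 (reg 0) (Each (eliminate_step k) d).

(* [m] coordinates remain to be eliminated, starting with [k]; [T] lists the
   tie-breaking keys of the coordinates already eliminated, the latest first. *)
Fixpoint levels (m k : nat) (T : seq (bool * nat)) : cmd :=
  if m is m'.+1 then
    For (20 + 2 * k) (IAdd (reg 0) (INum 1)) (For (21 + 2 * k) (IAdd (reg 0) (INum 1))
      (eliminate_cmd k ;;
       levels m' k.+1 ((true, level_name d k k) :: T) ;;
       levels m' k.+1 ((false, level_name d k k) :: T)))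
  else leaf k T.

Lemma Each_no_int_writes f m a : (forall c, int_writes (f c) a = false) ->
  int_writes (Each f m) a = false.
Proof. by move=> H; rewrite int_writes_Each; apply/hasPn => c _; rewrite H. Qed.

Lemma emit_int_writes a : int_writes (emit d) a = (a == 14)%N.
Proof. by rewrite /= Each_no_int_writes. Qed.

Lemma init_order_int_writes ks a : int_writes (init_order d ks) a -> (0 < a)%N && (a != 14)%N.
Proof. by rewrite /= !Each_no_int_writes //=; lia. Qed.

Lemma half_leaf_int_writes sg k T a : int_writes (half_leaf sg k T) a -> (1 <= a <= 16)%N.
Proof.
by rewrite /half_leaf; case: ifP => _ /=; rewrite !Each_no_int_writes //=; lia.
Qed.

Lemma levels_int_writes m k T a : int_writes (levels m k T) a ->
  (1 <= a <= 16)%N || (20 + 2 * k <= a)%N.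
Proof.
elim: m k T => [|m IH] k T /=; first by case/orP => /half_leaf_int_writes ->.
move: (IH k.+1 ((true, level_name d k k) :: T)) (IH k.+1 ((false, level_name d k k) :: T)).
rewrite Each_no_int_writes //.
case: (int_writes _ _) => [/(_ isT) h _ _|_]; first lia.
by case: (int_writes _ _) => [/(_ isT) h _|_]; lia.
Qed.

Lemma half_leaf_real_writes sg k T a : real_writes (half_leaf sg k T) a ->
  exists2 x, a = rname d x & x.1.1 != 0%N.
Proof.
have acc (l : seq nat) : has (fun c => a == acc_name d c) l -> exists2 x, a = rname d x & x.1.1 != 0%N.
  by move=> /hasP [c _ /eqP ->]; exists (4, 0, c)%N.
have out (l : seq nat) : has (fun c => a == out_name d c) l -> exists2 x, a = rname d x & x.1.1 != 0%N.
  by move=> /hasP [c _ /eqP ->]; exists (5, 0, c)%N.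
have ini ks : real_writes (init_order d ks) a -> exists2 x, a = rname d x & x.1.1 != 0%N.
  rewrite /= !real_writes_Each orbF /= => /or4P[/eqP->|/acc//|/eqP->|].
  - by exists (3, 0, 0)%N.
  - by exists (1, 0, 0)%N.
  - by case/orP => [/acc//|/eqP->]; exists (3, 0, 0)%N.
have emi : real_writes (emit d) a -> exists2 x, a = rname d x & x.1.1 != 0%N.
  by rewrite /= real_writes_Each orbF => /out.
have seqE c1 c2 : real_writes (c1 ;; c2) a = real_writes c1 a || real_writes c2 a by [].
rewrite /half_leaf; case: ifP => _; rewrite seqE; first by case/orP => [/ini|/emi].
rewrite seqE => /orP[/orP[/ini//|/emi//]|].
rewrite /= !real_writes_Each !orbF /= => /or3P[/eqP->|h|/out//].
  by exists (2, 0, 0)%N.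
move: h => /or3P[/acc//|/eqP->|/eqP->]; by exists (1, 0, 0)%N.
Qed.

Lemma levels_real_writes m k T a : real_writes (levels m k T) a ->
  exists2 x, a = rname d x & (x.1.1 != 0%N) || (k < x.1.2)%N.
Proof.
elim: m k T => [|m IH] k T /=.
  by case/orP => /half_leaf_real_writes [x -> h]; exists x; rewrite ?h.
rewrite real_writes_Each !orbF => /or3P[/hasP[c _ /eqP->]|/IH|/IH].
- by exists (0, k.+1, c)%N; rewrite ?ltnSn.
- by move=> [x -> h]; exists x => //; lia.
- by move=> [x -> h]; exists x => //; lia.
Qed.

End LeafCode.

(** * Correctness of the leaves and of the recursion *)

Section LeafSpec.
Variables (R : realType) (d n : nat) (v : 'I_n -> 'rV[R]_d) (p : 'I_n -> R) (rm0 : nat -> nat -> R).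
Hypothesis rm0_v : forall (c : 'I_d) (i : 'I_n), rm0 c i = v i 0 c.
Hypothesis rm0_p : forall i : 'I_n, rm0 d i = p i.
Hypothesis p01 : forall i, 0 < p i < 1.
Hypothesis v_inj : injective v.
Implicit Types (s : state R) (u : 'rV[R]_d).

Local Notation order_row := (order_row d n rm0).

Definition level_point s k r : 'rV[R]_d := \row_(c < d) rmem s (level_name d k c) r.

Lemma order_row_point bf : order_row bf = order_point v p (fun j i : 'I_n => bf j i).
Proof.
apply/rowP => c; rewrite mxE /order_coord big_mkord summxE; apply: eq_bigr => i _.
rewrite mxE rm0_v rm0_p /order_factor big_mkord; congr (_ * _ * _).
by apply: eq_bigr => j _; rewrite rm0_p.
Qed.

Lemma eq_order_row (bf bf' : rel nat) :
  (forall j i, (j < n)%N -> (i < n)%N -> bf j i = bf' j i) -> order_row bf = order_row bf'.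
Proof. by move=> E; apply/rowP => c; rewrite !mxE; apply: eq_order_coord. Qed.

Lemma one_minus_prob_neq0 i : (i < n)%N -> 1 - rm0 d i != 0.
Proof.
move=> im; have := rm0_p (Ordinal im); have /andP[_ h] := p01 (Ordinal im).
by rewrite /= => ->; rewrite subr_eq0 gt_eqF.
Qed.

(** [li_sep]: points tied on all keys had equal eliminated coordinates, so the same multiple of [h]
    was subtracted from both at each level and their difference is still the original one.
    [li_names]: keys refer to earlier levels, which deeper code never overwrites. *)
Record level_inv s k T : Prop := LevelInv {
  li_input : has_input d n rm0 s;
  li_linear : forall c : 'I_d, linear_on v (fun r => rmem s (level_name d k c) r);
  li_keys : all_linear v (key_vals (rmem s) T);
  li_sep : forall i j : 'I_n, ties (key_vals (rmem s) T) i j ->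
    (forall c : 'I_d, level_point s k i 0 c - level_point s k j 0 c = v i 0 c - v j 0 c) /\
    (forall c : 'I_d, (c < k)%N -> v i 0 c = v j 0 c);
  li_names : forall key, key \in T -> exists2 l, (l < k)%N & key.2 = level_name d l l }.

Definition is_extreme x := exists2 u, generic v u & x = order_point v p (above v u).

Lemma before_extreme fs : all_linear v fs -> (forall i j : 'I_n, ties fs i j -> i = j) ->
  is_extreme (order_row (before fs)).
Proof.
move=> lfs sep; have [u gu E] := before_realizable lfs sep.
by exists u => //; rewrite order_row_point; apply: eq_order_point.
Qed.

(* What a run of [levels m k T] from [s] appends to the output. *)
Record level_output s k T (bound : nat) (o : seq 'rV[R]_d) : Prop := LevelOutput {
  lo_size : (size o <= bound)%N;
  lo_sound : forall x, x \in o -> is_extreme x;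
  lo_complete : forall u, supported_from k u -> separates n k u (level_point s k) ->
    order_row (before ((fun r => dot u (level_point s k r)) :: key_vals (rmem s) T)) \in o }.

Lemma linear_on_signed sg f : linear_on v f -> linear_on v (fun r => signed sg (f r)).
Proof.
case: sg => // lf; have [w hw] := linear_onZ (-1) lf.
by exists w => i; rewrite /signed -hw mulN1r.
Qed.

Lemma before_cons_extend (f : nat -> R) (G T : seq (nat -> R)) :
  (forall i j : 'I_n, (f j < f i) = before G i j) ->
  order_row (before (f :: T)) = order_row (before (G ++ T)).
Proof.
move=> H; apply: eq_order_row => j i jn im.
apply: (@before_extend R n [:: f] G T) => // j' i' jn' im'.
by rewrite /= andbF orbF; apply: (H (Ordinal jn') (Ordinal im')).
Qed.

Definition leaf_time := if d == 1%N then (n.+1 * (up_log 2 n).+1)%N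
  else ((n * n + n).+1 * (up_log 2 (n * n)).+1)%N.
Definition leaf_count := if d == 1%N then 1%N else (n * n).+1.

(** If the keys and the remaining coordinates agree, [li_sep] turns this into agreement of all
    original coordinates. *)
Lemma level_inv_distinct s k T (fs : seq (nat -> R)) : level_inv s k T ->
  (forall i j : 'I_n, ties fs i j -> ties (key_vals (rmem s) T) i j /\
    forall c : 'I_d, (k <= c)%N -> level_point s k i 0 c = level_point s k j 0 c) ->
  forall i j : 'I_n, ties fs i j -> i = j.
Proof.
move=> inv H i j /H [/(li_sep inv) [e1 e2] e3]; apply: v_inj; apply/rowP => c.
have [kc|ck] := leqP k c; last exact: e2.
by apply/eqP; rewrite -subr_eq0 -e1 e3 // subrr.
Qed.

Lemma emit_after_order s bf : (forall c, (c < d)%N -> rmem s (acc_name d c) 0 = order_coord d n rm0 bf c) ->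
  outputs d (run (emit d) s) = rcons (outputs d s) (order_row bf).
Proof.
by move=> H; rewrite emit_spec; congr rcons; apply/rowP => c; rewrite !mxE H.
Qed.

Definition same_levels s s' k :=
  forall l c, (l <= k)%N -> rmem s' (level_name d l c) = rmem s (level_name d l c).

Lemma same_level_point s s' k r : same_levels s s' k -> level_point s' k r = level_point s k r.
Proof. by move=> E; apply/rowP => c; rewrite !mxE E. Qed.

Lemma same_key_vals s s' k (T : seq (bool * nat)) : same_levels s s' k ->
  (forall key, key \in T -> exists2 l, (l < k)%N & key.2 = level_name d l l) ->
  key_vals (rmem s') T = key_vals (rmem s) T.
Proof.
move=> E H; apply/eq_in_map => key /H [l lk e].
by apply/funext => r; rewrite /key_val e E // ltnW.
Qed.

Lemma same_level_inv s s' k T : level_inv s k T -> has_input d n rm0 s' -> same_levels s s' k ->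
  level_inv s' k T.
Proof.
move=> [h1 h2 h3 h4 h5] hs E; split=> //.
- by move=> c; rewrite E.
- by rewrite (same_key_vals E).
- by move=> i j; rewrite (same_key_vals E) // !(same_level_point _ E); apply: h4.
Qed.

Lemma signed_inj sg : injective (signed sg : R -> R).
Proof. by case: sg => // x y /oppr_inj. Qed.

Lemma signedN sg (x : R) : signed (~~ sg) x = - signed sg x.
Proof. by case: sg => //=; rewrite opprK. Qed.

Definition first_cost ks := (100 * d.+1 + 3 * sort_cost ks + straight_cost (emit d))%N.

Lemma init_emit_spec s ks : has_input d n rm0 s ->
  let fs := key_vals (rmem s) ks in
  (forall i j : 'I_n, ties fs i j -> i = j) ->
  runs (init_order d ks ;; emit d) s (first_cost ks * (n.+1 * (up_log 2 n).+1)) (fun s' =>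
    [/\ has_input d n rm0 s', outputs d s' = rcons (outputs d s) (order_row (before fs)),
      forall x, x.1.1 = 0%N -> rmem s' (rname d x) = rmem s (rname d x),
      forall i, (i < n)%N -> rmem s' (factor_name d) i = order_factor d n rm0 (before fs) i &
      forall c, (c < d)%N -> rmem s' (acc_name d c) 0 = order_coord d n rm0 (before fs) c]).
Proof.
move=> [sn sin] fs sep.
have init_w a : real_writes (init_order d ks) a -> exists2 x, a = rname d x & x.1.1 \in [:: 1; 3; 4]%N.
  rewrite /= !real_writes_Each orbF /= => /or4P[/eqP->|/hasP[c _ /eqP->]|/eqP->|].
  - by exists (3, 0, 0)%N.
  - by exists (4, 0, c)%N.
  - by exists (1, 0, 0)%N.
  - by case/orP => [/hasP[c _ /eqP->]|/eqP->]; [exists (4, 0, c)%N|exists (3, 0, 0)%N].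
eapply runs_bound.
  apply: runs_seq; eapply runs_weaken; [eapply runs_frame; apply: (@init_order_spec R d n rm0 ks s)| |].
  - by split.
  - move=> i j im jn tij; have := sep (Ordinal im) (Ordinal jn) tij.
    by move=> /(congr1 val).
  - exact: leqnn.
  move=> s1 [[Hf Ha] Fi Fr].
  have Fr' x : x.1.1 \notin [:: 1; 3; 4]%N -> rmem s1 (rname d x) = rmem s (rname d x).
    move=> nx; apply: Fr; apply/negP => /init_w [y /eqP]; rewrite rname_eq => /eqP <-.
    by rewrite (negbTE nx).
  have Fin c : (c <= d)%N -> rmem s1 c = rm0 c.
    move=> cd; rewrite Fr ?sin //; apply/negP => /init_w [y /eqP]; by rewrite rname_input.
  apply: runs_straight; first by rewrite /= straight_Each.
  have [Gi Gr] : (forall x, ~~ int_writes (emit d) x -> imem (run (emit d) s1) x = imem s1 x) /\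
      (forall x, ~~ real_writes (emit d) x -> rmem (run (emit d) s1) x = rmem s1 x).
    by apply: run_frame; rewrite /= straight_Each.
  have Gr' a : (forall c, a != out_name d c) -> rmem (run (emit d) s1) a = rmem s1 a.
    by move=> h; apply: Gr; rewrite /= real_writes_Each orbF; apply/hasPn => c _; apply: h.
  split.
  - split; first by rewrite Gi ?emit_int_writes // Fi //; apply/negP => /init_order_int_writes.
    by move=> c cd; rewrite Gr' ?Fin // => c'; rewrite rname_input.
  - rewrite (emit_after_order Ha); congr rcons; apply: eq_outputs; first by rewrite Fi //; apply/negP => /init_order_int_writes.
    by move=> c; rewrite Fr'.
  - move=> x x0; rewrite Gr' => [|c]; first by rewrite Fr' ?x0.
    by rewrite rname_eq; apply/eqP => e; rewrite e in x0.
  - by move=> i im; rewrite Gr' ?Hf // => c; rewrite rname_eq.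
  - by move=> c cd; rewrite Gr' ?Ha // => c'; rewrite rname_eq.
rewrite /first_cost [leqRHS]mulnDl leq_add2l; apply: leq_pmulr.
by [].
Qed.

Definition leaf_cost ks := (first_cost ks + 2000 * d.+1)%N.

Lemma half_leaf1_spec sg s T : d = 1%N -> level_inv s 0 T ->
  let f r := signed sg (rmem s (level_name d 0 0) r) in
  let x := order_row (before (f :: key_vals (rmem s) T)) in
  runs (half_leaf d sg 0 T) s (leaf_cost ((sg, level_name d 0 0) :: T) * leaf_time)
    (fun s' => outputs d s' = rcons (outputs d s) x /\ is_extreme x).
Proof.
move=> d1 inv f x; have e1 : 1%N == d by rewrite d1.
rewrite /half_leaf /leaf_time e1 eq_sym e1.
set ks := _ :: T.
have d0 : (0 < d)%N by rewrite d1.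
pose a : 'I_d := Ordinal d0.
have sep (i j : 'I_n) : ties (key_vals (rmem s) ks) i j -> i = j.
  apply: (level_inv_distinct inv) => i' j' /= /andP[/eqP e ->]; split=> // c _.
  have -> : c = a by apply: val_inj => /=; have := ltn_ord c; lia.
  by rewrite !mxE /=; apply: signed_inj e.
apply: runs_weaken (init_emit_spec (li_input inv) sep) _ _.
  by rewrite leq_mul2r leq_addr orbT.
move=> s' [h1 h2 h3 h4 h5]; split=> //.
apply: before_extreme => //; split; last exact: li_keys inv.
by apply: linear_on_signed; have := li_linear inv a.
Qed.

Lemma half_leaf2_spec sg s k T : k.+2 = d -> level_inv s k T ->
  let A r := signed sg (rmem s (level_name d k k) r) in
  let B r := signed sg (rmem s (level_name d k k.+1) r) in
  let Tv := key_vals (rmem s) T in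
  runs (half_leaf d sg k T) s
    (leaf_cost ((~~ sg, level_name d k k) :: (sg, level_name d k k.+1) :: T) * leaf_time)
    (fun s' => exists o,
      [/\ outputs d s' = outputs d s ++ o, (size o <= leaf_count)%N,
        forall x, x \in o -> is_extreme x, order_row (before (start_keys A B Tv)) \in o &
        forall i j, (i < n)%N -> (j < n)%N ->
          order_row (before (event_keys A B Tv (event_time A B i j))) \in o]).
Proof.
move=> kd inv A B Tv; have dk : (k.+1 == d) = false by rewrite -kd; lia.
have d1 : (d == 1)%N = false by rewrite -kd; lia.
rewrite /half_leaf /leaf_time /leaf_count d1 dk.
set ks := _ :: _ :: T.
have kd1 : (k.+1 < d)%N by rewrite -kd.
pose a : 'I_d := Ordinal (ltnW kd1); pose b : 'I_d := Ordinal kd1.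
have ksE : key_vals (rmem s) ks = start_keys A B Tv.
  rewrite /start_keys /=; congr (_ :: _); apply/funext => r.
  exact: signedN.
(* Both kinds of key lists determine [A], [B] and the older keys, and these determine the point. *)
have sepAB (fs : seq (nat -> R)) : (forall i j : 'I_n, ties fs i j -> [/\ A i = A j, B i = B j & ties Tv i j]) ->
    forall i j : 'I_n, ties fs i j -> i = j.
  move=> H; apply: (level_inv_distinct inv) => i j /H [eA eB tT]; split=> // c kc.
  have [->|] := eqVneq c a; first by rewrite !mxE; apply: signed_inj eA.
  rewrite -(inj_eq val_inj) /= => ca.
  have -> : c = b by apply: val_inj => /=; have := ltn_ord c; lia.
  by rewrite !mxE; apply: signed_inj eB.
have sep0 (i j : 'I_n) : ties (start_keys A B Tv) i j -> i = j.
  by apply: sepAB => i' j' /= /and3P[/eqP/oppr_inj eA /eqP eB tT]; split.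
have lA : linear_on v A by apply: linear_on_signed; have := li_linear inv a.
have lB : linear_on v B by apply: linear_on_signed; have := li_linear inv b.
have lT : all_linear v Tv := li_keys inv.
have lN : linear_on v (fun r => - A r).
  by have [w hw] := linear_onZ (-1) lA; exists w => i; rewrite -hw mulN1r.
eapply runs_bound.
  apply: runs_seq; apply: runs_weaken (leqnn _) _.
    by apply: (init_emit_spec (ks := ks) (li_input inv)) => i j; rewrite ksE; apply: sep0.
  move=> s1 [h1 h2 h3 h4 h5].
  have := @sweep_spec R d n rm0 one_minus_prob_neq0 s1 sg k k k.+1 Tv h1.
  have e1 : rmem s1 (level_name d k k) = rmem s (level_name d k k) by apply: h3.
  have e2 : rmem s1 (level_name d k k.+1) = rmem s (level_name d k k.+1) by apply: h3.
  cbv zeta; rewrite e1 e2 -/A -/B -/Tv.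
  rewrite ksE in h2 h4 h5; move=> /(_ h4 h5) sw.
  apply: runs_weaken sw (leqnn _) _ => s2 [em [m1 m2 m3 m4]].
  exists (order_row (before (start_keys A B Tv)) :: em); split.
  - by rewrite m1 h2 -cats1 -catA.
  - by [].
  - move=> x; rewrite inE => /orP[/eqP->|/m3 [i [j [im jn ->]]]].
      by apply: before_extreme.
    apply: before_extreme.
      by split=> //; apply: linear_onD lB _; apply: linear_onZ.
    apply: sepAB => i' j' /= /and3P[/eqP eB /eqP eA tT]; split=> //.
    by move: eB; rewrite eA => /addIr.
  - by rewrite mem_head.
  - by move=> i j im jn; rewrite inE m4 // orbT.
rewrite /leaf_cost mulnDl leq_add //.
rewrite leq_mul2l; apply/orP; right; apply: leq_mul; first by nia.
by rewrite ltnS; apply: leq_up_log; case: n => // m; rewrite leq_pmulr.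
Qed.

(** Deeper levels and the working arrays of a leaf have names apart from the input and from the
    levels up to [k]. *)
Lemma writes_frame k c s b Q : has_input d n rm0 s ->
  (forall a, int_writes c a -> (0 < a)%N) ->
  (forall a, real_writes c a -> exists2 x, a = rname d x & (x.1.1 != 0%N) || (k < x.1.2)%N) ->
  runs c s b Q -> runs c s b (fun s' => [/\ Q s', has_input d n rm0 s' & same_levels s s' k]).
Proof.
move=> [sn sin] ci cr /runs_frame r; apply: runs_weaken r (leqnn _) _ => s' [q fi fr]; split=> //.
  split; first by rewrite fi //; apply/negP => /ci.
  move=> a ad; rewrite fr ?sin //; apply/negP => /cr [x /eqP]; by rewrite rname_input.
move=> l c' lk; apply: fr; apply/negP => /cr [x /eqP]; rewrite rname_eq => /eqP <- /=.
by rewrite ltnNge lk.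
Qed.

Lemma half_leaf_frame sg k T s b Q : has_input d n rm0 s -> runs (half_leaf d sg k T) s b Q ->
  runs (half_leaf d sg k T) s b (fun s' => [/\ Q s', has_input d n rm0 s' & same_levels s s' k]).
Proof.
move=> hs; apply: writes_frame => // a; first by case/half_leaf_int_writes/andP.
by case/half_leaf_real_writes => x -> h; exists x; rewrite ?h.
Qed.

Lemma levels_frame m k T s b Q : has_input d n rm0 s -> runs (levels d m k T) s b Q ->
  runs (levels d m k T) s b (fun s' => [/\ Q s', has_input d n rm0 s', same_levels s s' k &
    forall a, (16 < a < 20 + 2 * k)%N -> imem s' a = imem s a]).
Proof.
move=> hs r; apply: runs_weaken (runs_frame (writes_frame (k := k) hs _ _ r)) (leqnn _) _.
- by move=> a /levels_int_writes; lia.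
- exact: levels_real_writes.
- move=> s' [[q hs' sl] fi _]; split=> // a ak; apply: fi; apply/negP => /levels_int_writes; lia.
Qed.

Definition half_leaf_const sg k T :=
  (leaf_cost ((sg, level_name d 0 0) :: T) +
   leaf_cost ((~~ sg, level_name d k k) :: (sg, level_name d k k.+1) :: T))%N.

Definition leaf_const k T := (half_leaf_const true k T + half_leaf_const false k T)%N.

Lemma leaf_spec k T s : k.+2 = d \/ d = 1%N /\ k = 0%N -> level_inv s k T ->
  runs (leaf d k T) s (leaf_const k T * leaf_time) (fun s' => exists2 o,
    outputs d s' = outputs d s ++ o & level_output s k T (2 * leaf_count) o).
Proof.
move=> kd inv; rewrite /leaf_const mulnDl; apply: runs_seq.
have c1 sg : (leaf_cost ((sg, level_name d 0 0) :: T) * leaf_time <= half_leaf_const sg k T * leaf_time)%N.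
  by rewrite leq_mul2r leq_addr orbT.
have c2 sg : (leaf_cost ((~~ sg, level_name d k k) :: (sg, level_name d k k.+1) :: T) * leaf_time <=
    half_leaf_const sg k T * leaf_time)%N.
  by rewrite leq_mul2r leq_addl orbT.
case: kd => [kd|[d1 k0]].
  apply: runs_weaken (half_leaf_frame (li_input inv) (half_leaf2_spec true kd inv)) (c2 _) _.
  move=> s1 [[em1 [a1 a2 a3 a4 a5]] hs1 sl1].
  apply: runs_weaken (half_leaf2_spec false kd (same_level_inv inv hs1 sl1)) (c2 _) _.
  rewrite (same_key_vals sl1 (li_names inv)) (sl1 k k) // (sl1 k k.+1) //.
  move=> s2 [em2 [b1 b2 b3 b4 b5]].
  exists (em1 ++ em2); first by rewrite b1 a1 catA.
  split.
  - by rewrite size_cat mul2n -addnn leq_add.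
  - by move=> x; rewrite mem_cat => /orP[/a3|/b3].
  move=> u su sepu; rewrite mem_cat.
  have kd1 : (k.+1 < d)%N by rewrite -kd.
  pose a : 'I_d := Ordinal (ltnW kd1); pose b : 'I_d := Ordinal kd1.
  have [||sg H] := @line_sweep_complete R d n a b u (level_point s k)
    (rmem s (level_name d k k)) (rmem s (level_name d k k.+1)) erefl kd _ _ su sepu.
  - by move=> r; rewrite mxE.
  - by move=> r; rewrite mxE.
  have {H} H : forall em : seq 'rV[R]_d,
     (let A r := signed sg (rmem s (level_name d k k) r) in
      let B r := signed sg (rmem s (level_name d k k.+1) r) in
      order_row (before (start_keys A B (key_vals (rmem s) T))) \in em /\
      forall i j, (i < n)%N -> (j < n)%N ->
          order_row (before (event_keys A B (key_vals (rmem s) T) (event_time A B i j))) \in em) ->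
      order_row (before ((fun r => dot u (level_point s k r)) :: key_vals (rmem s) T)) \in em.
    move=> em [e1 e2]; case: H => [H|[q nq H]].
      by rewrite (before_cons_extend _ H).
    by rewrite (before_cons_extend _ H); apply: e2.
  by case: sg H => H; [rewrite (H em1)|rewrite (H em2) ?orbT].
subst k; have lc : leaf_count = 1%N by rewrite /leaf_count d1 eqxx.
apply: runs_weaken (half_leaf_frame (li_input inv) (half_leaf1_spec true d1 inv)) (c1 _) _.
move=> s1 [[a1 a2] hs1 sl1].
apply: runs_weaken (half_leaf1_spec false d1 (same_level_inv inv hs1 sl1)) (c1 _) _.
rewrite (same_key_vals sl1 (li_names inv)) (sl1 0 0)%N //.
move=> s2 [b1 b2].
eexists [:: _; _]; first by rewrite b1 a1 -!cats1 -catA.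
split.
- by rewrite lc.
- by move=> x; rewrite !inE => /orP[/eqP->|/eqP->].
move=> u su sepu; rewrite !inE.
have d0 : (0 < d)%N by rewrite d1.
have [|sg H] := @line_complete R d n (level_point s 0) u (Ordinal d0) (rmem s (level_name d 0 0)) d1 _ sepu.
  by move=> r; rewrite mxE.
by rewrite (before_cons_extend _ H); case: sg H => H; rewrite eqxx ?orbT.
Qed.

Lemma eliminate_spec k s T (kd : (k < d)%N) i j : level_inv s k T ->
  imem s (20 + 2 * k) 0 = i -> imem s (21 + 2 * k) 0 = j ->
  runs (eliminate_cmd d k) s ((26 * d + 40) * n.+1) (fun s' => forall r, (r < n)%N ->
    level_point s' k.+1 r =
    eliminate (Ordinal kd) (level_point s k i - level_point s k j) (level_point s k r)).
Proof.
move=> inv ei ej; have [sn sin] := li_input inv.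
pose E r := eliminate (Ordinal kd) (level_point s k i - level_point s k j) (level_point s k r).
eapply runs_bound.
  apply: (@runs_for _ _ _ _ _ n _ (fun m s' => [/\ imem s' 0 0 = n, imem s' (20 + 2 * k) 0 = i,
    imem s' (21 + 2 * k) 0 = j, same_levels s s' k & forall r, (r < m)%N -> level_point s' k.+1 r = E r])).
  - split=> //=; by rewrite upd_ne //; lia.
  - by move=> m s' mn [].
  - move=> m s' mn [I0 Ii Ij Is Ie] xm; apply: runs_straight.
      exact: straight_Each.
    pose J c s'' := [/\ imem s'' = imem s', same_levels s s'' k,
      forall r c', r != m -> rmem s'' (level_name d k.+1 c') r = rmem s' (level_name d k.+1 c') r &
      forall c' : 'I_d, (c' < c)%N -> rmem s'' (level_name d k.+1 c') m = E m 0 c'].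
    have [||J1 J2 J3 J4] := @run_Each R (eliminate_step d k) d J s'.
    + move=> c s'' cd [J1 J2 J3 J4]; split=> //.
      * by move=> l c' lk /=; rewrite upd_ne ?J2 // rname_eq !xpair_eqE /=; lia.
      * by move=> r c' rm /=; rewrite /upd J1 xm (negbTE rm) andbF J3.
      * move=> c' c'c; rewrite /= {1}/upd J1 xm eqxx andbT rname_eq !xpair_eqE /= eqxx andTb.
        rewrite Ii Ij !(J2 k) //.
        case: eqP => [<-|/eqP ne]; last by apply: J4; lia.
        by rewrite /E eliminateE !mxE.
    + by split.
    split; first by rewrite J1.
    split=> //=.
    + by rewrite upd_ne ?J1 //; lia.
    + by rewrite upd_ne ?J1 //; lia.
    + by rewrite upd_ne ?J1 //; lia.
    + move=> r rm; apply/rowP => c; rewrite mxE /=.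
      have [->|ne] := eqVneq r m; first exact: J4.
      by rewrite J3 // -Ie ?mxE //; lia.
  - by move=> s' [_ _ _ _ Ie] r rn; apply: Ie.
rewrite (straight_cost_Each _ (K := 26)) //; first by rewrite /=; nia.
Qed.

Lemma eq_order_row_head (f g : nat -> R) G : (forall r, (r < n)%N -> f r = g r) ->
  order_row (before (f :: G)) = order_row (before (g :: G)).
Proof. by move=> E; apply: eq_order_row => j i jn im; rewrite /= !E. Qed.

Lemma eq_separates k u (X Y : nat -> 'rV[R]_d) : (forall r, (r < n)%N -> X r = Y r) ->
  separates n k u X -> separates n k u Y.
Proof. by move=> E h i j; rewrite -!E //; apply: h. Qed.

(** Valid for every [h]: coordinates stay linear in the point because elimination is, and a tie on
    the new key means equal [k]-th coordinates, so that both points lose the same multiple of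
    [h]. *)
Lemma next_level_inv k (kd : (k < d)%N) s s1 T h sg : level_inv s k T ->
  has_input d n rm0 s1 -> same_levels s s1 k ->
  (forall r, (r < n)%N -> level_point s1 k.+1 r = eliminate (Ordinal kd) h (level_point s k r)) ->
  level_inv s1 k.+1 ((sg, level_name d k k) :: T).
Proof.
move=> inv hs sl E; have kv := same_key_vals sl (li_names inv); split=> //.
- move=> c; have [w hw] := li_linear inv c; have [w' hw'] := li_linear inv (Ordinal kd).
  exists (w - (h 0 c / h 0 (Ordinal kd)) *: w') => i.
  have := congr1 (fun x : 'rV[R]_d => x 0 c) (E i (ltn_ord i)).
  rewrite /= eliminateE !mxE hw hw' /= => ->; rewrite dotBl dotZl; ring.
- split; last by rewrite kv; apply: li_keys inv.
  apply: linear_on_signed; have [w hw] := li_linear inv (Ordinal kd).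
  by exists w => i; rewrite -hw sl.
- move=> i j /= /andP[/eqP /signed_inj e]; rewrite kv => /(li_sep inv) [h1 h2].
  have ek : level_point s k i 0 (Ordinal kd) = level_point s k j 0 (Ordinal kd).
    by rewrite !mxE /= -!(sl k k).
  split=> c.
    by rewrite !E // !eliminateE ek -h1; ring.
  rewrite ltnS leq_eqVlt => /orP[/eqP ck|]; last exact: h2.
  have -> : c = Ordinal kd by apply: val_inj.
  by apply/eqP; rewrite -subr_eq0 -h1 ek subrr.
- move=> key; rewrite inE => /orP[/eqP->|/(li_names inv) [l lk ->]]; first by exists k.
  by exists l => //; apply: ltnW.
Qed.

(** Per level, [n.+1 ^ 2] pairs of indices and 2 tie-breaking signs; at the bottom, two half
    leaves. *)
Definition level_count m := ((2 * n.+1 ^ 2) ^ m * (2 * leaf_count))%N.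

Fixpoint level_const m k T :=
  if m is m'.+1 then (200 * d.+1 + (level_const m' k.+1 ((true, level_name d k k) :: T) +
    level_const m' k.+1 ((false, level_name d k k) :: T)))%N
  else leaf_const k T.

Definition level_time m := ((n.+1 ^ 2) ^ m * leaf_time)%N.

(* What is appended for one choice of the hyperplane [h] and both signs. *)
Definition pair_output s k T (kd : (k < d)%N) h (o : seq 'rV[R]_d) :=
  forall sg u, supported_from k.+1 u ->
    separates n k.+1 u (fun r => eliminate (Ordinal kd) h (level_point s k r)) ->
    order_row (before ((fun r => dot u (eliminate (Ordinal kd) h (level_point s k r))) ::
      (fun r => signed sg (rmem s (level_name d k k) r)) :: key_vals (rmem s) T)) \in o.

Lemma level_body_spec m k T s sI (kd : (k < d)%N) i j :
  (forall T' s', level_inv s' k.+1 T' ->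
    runs (levels d m k.+1 T') s' (level_const m k.+1 T' * level_time m) (fun s'' => exists2 o,
      outputs d s'' = outputs d s' ++ o & level_output s' k.+1 T' (level_count m) o)) ->
  level_inv s k T -> has_input d n rm0 sI -> same_levels s sI k ->
  imem sI (20 + 2 * k) 0 = i -> imem sI (21 + 2 * k) 0 = j ->
  runs (eliminate_cmd d k ;; levels d m k.+1 ((true, level_name d k k) :: T) ;;
      levels d m k.+1 ((false, level_name d k k) :: T)) sI
    ((26 * d + 40) * n.+1 + (level_const m k.+1 ((true, level_name d k k) :: T) * level_time m +
      level_const m k.+1 ((false, level_name d k k) :: T) * level_time m))
    (fun s' => [/\ has_input d n rm0 s', same_levels s s' k,
      imem s' (20 + 2 * k) 0 = i, imem s' (21 + 2 * k) 0 = j & exists o,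
      [/\ outputs d s' = outputs d sI ++ o, (size o <= 2 * level_count m)%N,
        forall x, x \in o -> is_extreme x &
        pair_output s T kd (level_point s k i - level_point s k j) o]]).
Proof.
move=> IH inv hI slI eI eJ; set h := level_point s k i - _.
have invI := same_level_inv inv hI slI.
have hw a : real_writes (eliminate_cmd d k) a -> exists c, a = level_name d k.+1 c.
  by rewrite /= real_writes_Each orbF => /hasP [c _ /eqP ->]; exists c.
have hi a : int_writes (eliminate_cmd d k) a -> a = 12%N.
  by rewrite /= Each_no_int_writes //; lia.
apply: runs_seq; apply: runs_weaken (runs_frame (eliminate_spec kd invI eI eJ)) (leqnn _) _.
move=> s1 [e1 Fi Fr].
have sl1 : same_levels s s1 k.
  move=> l c lk; rewrite Fr ?slI //; apply/negP => /hw [c' /eqP].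
  by rewrite rname_eq !xpair_eqE => /andP[/andP[_ /eqP lk']]; rewrite lk' ltnn in lk.
have hs1 : has_input d n rm0 s1.
  have [sn sin] := hI; split; first by rewrite Fi //; apply/negP => /hi.
  by move=> c cd; rewrite Fr ?sin //; apply/negP => /hw [x /eqP]; rewrite rname_input.
have o1 : outputs d s1 = outputs d sI.
  apply: eq_outputs; first by rewrite Fi //; apply/negP => /hi.
  by move=> c; rewrite Fr //; apply/negP => /hw [c' /eqP]; rewrite rname_eq.
have ptE r : (r < n)%N -> level_point s1 k.+1 r = eliminate (Ordinal kd) h (level_point s k r).
  by move=> rn; rewrite e1 // !(same_level_point _ slI).
have reg_eq s' s'' : (forall a, (16 < a < 20 + 2 * k.+1)%N -> imem s' a = imem s'' a) ->
    imem s' (20 + 2 * k) 0 = imem s'' (20 + 2 * k) 0 /\ imem s' (21 + 2 * k) 0 = imem s'' (21 + 2 * k) 0.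
  by move=> H; rewrite !H //; lia.
have inv1 := next_level_inv true inv hs1 sl1 ptE.
apply: runs_seq; apply: runs_weaken (levels_frame hs1 (IH _ _ inv1)) (leqnn _) _.
move=> s2 [[em1 a1 [a2 a3 a4]] hs2 sl2 /reg_eq [r2 r2']].
have sl2' : same_levels s s2 k by move=> l c lk; rewrite sl2 ?sl1 // ltnW.
have inv2 := next_level_inv false inv hs2 sl2'.
have {}inv2 : level_inv s2 k.+1 ((false, level_name d k k) :: T).
  by apply: (inv2 kd h) => r rn; rewrite (same_level_point _ sl2) ptE.
apply: runs_weaken (levels_frame hs2 (IH _ _ inv2)) (leqnn _) _.
move=> s3 [[em2 b1 [b2 b3 b4]] hs3 sl3 /reg_eq [r3 r3']].
split=> //.
- by move=> l c lk; rewrite sl3 ?sl2' // ltnW.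
- by rewrite r3 r2 Fi //; apply/negP => /hi; lia.
- by rewrite r3' r2' Fi //; apply/negP => /hi; lia.
exists (em1 ++ em2); split.
- by rewrite b1 a1 o1 catA.
- by rewrite size_cat mul2n -addnn leq_add.
- by move=> x; rewrite mem_cat => /orP[/a3|/b3].
move=> sg u su sepu; rewrite mem_cat.
have main s' em : same_levels s s' k -> (forall r, (r < n)%N -> level_point s' k.+1 r = eliminate (Ordinal kd) h (level_point s k r)) ->
    (forall u, supported_from k.+1 u -> separates n k.+1 u (level_point s' k.+1) ->
      order_row (before ((fun r => dot u (level_point s' k.+1 r)) ::
        key_vals (rmem s') ((sg, level_name d k k) :: T))) \in em) ->
    order_row (before ((fun r => dot u (eliminate (Ordinal kd) h (level_point s k r))) ::
      (fun r => signed sg (rmem s (level_name d k k) r)) :: key_vals (rmem s) T)) \in em.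
  move=> sl' pt' H.
  have kE : key_vals (rmem s') ((sg, level_name d k k) :: T) =
      (fun r => signed sg (rmem s (level_name d k k) r)) :: key_vals (rmem s) T.
    by rewrite -(same_key_vals sl' (li_names inv)) -(sl' k k).
  have := H u su; rewrite kE.
  rewrite (eq_order_row_head (g := fun r => dot u (eliminate (Ordinal kd) h (level_point s k r)))).
    by apply; apply: eq_separates sepu => r rn; rewrite pt'.
  by move=> r rn; rewrite pt'.
case: sg main => main.
  by apply/orP; left; apply: main sl1 ptE a4.
apply/orP; right; apply: main sl2' _ b4 => r rn.
by rewrite (same_level_point _ sl2) ptE.
Qed.

Lemma levels_spec m k T s : (m + k).+2 = d \/ [/\ d = 1, m = 0 & k = 0]%N -> level_inv s k T ->
  runs (levels d m k T) s (level_const m k T * level_time m) (fun s' => exists2 o,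
    outputs d s' = outputs d s ++ o & level_output s k T (level_count m) o).
Proof.
elim: m k T s => [|m IH] k T s kd inv.
  rewrite /level_time /level_count expn0 !mul1n; apply: leaf_spec => //.
  by case: kd => [|[? _ ?]]; [left|right].
have {}kd : (m.+1 + k).+2 = d by case: kd => // [[]].
have dk : (k < d)%N by rewrite -kd; lia.
have {}IH T' s' : level_inv s' k.+1 T' ->
    runs (levels d m k.+1 T') s' (level_const m k.+1 T' * level_time m) (fun s'' => exists2 o,
      outputs d s'' = outputs d s' ++ o & level_output s' k.+1 T' (level_count m) o).
  by apply: IH; left; rewrite -kd; lia.
have [sn sin] := li_input inv.
pose hyper i j := level_point s k i - level_point s k j.
(* [cnt] bounds the size by the number of pairs treated, [done] tells which pairs these are; the
   same shape serves both loops. *)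
pose I cnt (done : nat -> nat -> bool) s' := [/\ has_input d n rm0 s', same_levels s s' k & exists o,
  [/\ outputs d s' = outputs d s ++ o, (size o <= cnt * (2 * level_count m))%N,
    forall x, x \in o -> is_extreme x &
    forall i j, done i j -> pair_output s T dk (hyper i j) o]].
have Iset cnt done s' a x : a != 14%N -> a != 0%N -> I cnt done s' -> I cnt done (set_int s' a 0 x).
  move=> a14 a0 [[h0 h1] h2 [em [h3 h4 h5 h6]]]; split.
  - by split=> //=; rewrite upd_ne // eq_sym (negbTE a0).
  - by [].
  - exists em; split=> //; rewrite -h3; apply: eq_outputs => //=.
    by rewrite upd_ne // eq_sym (negbTE a14).
eapply runs_bound.
  apply: (@runs_for _ _ _ _ _ n.+1 _ (fun i s' => I (i * n.+1)%N (fun i' j' => (i' < i) && (j' <= n))%N s')).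
  - apply: Iset; try lia; split=> //; exists [::]; split=> //; first by rewrite cats0.
  - by move=> i s' _ [[h _]] _ _ /=; rewrite h addn1.
  - move=> i s1 im I1 x1.
    apply: (@runs_for _ _ _ _ _ n.+1 _ (fun j s' => I (i * n.+1 + j)%N
      (fun i' j' => (i' < i) && (j' <= n) || (i' == i) && (j' < j))%N s' /\ imem s' (20 + 2 * k) 0 = i)).
    + split; last by rewrite /= upd_ne //; lia.
      rewrite addn0; apply: Iset; try lia.
      case: I1 => h0 h1 [em [h2 h3 h4 h5]]; split=> //; exists em; split=> // i' j'.
      by rewrite ltn0 andbF orbF; apply: h5.
    + by move=> j s' _ [[[h _]]] _ _ _ /=; rewrite h addn1.
    + move=> j s2 jn [[hs2 sl2 [em [h2 h3 h4 h5]]] y20] y21.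
      apply: runs_weaken (level_body_spec (dk) IH inv hs2 sl2 y20 y21) (leqnn _) _.
      move=> s3 [hs3 sl3 z20 z21 [em' [g1 g2 g3 g4]]]; split; first exact: z21.
      split; last by rewrite /= upd_ne ?z20 //; lia.
      apply: Iset; try lia; split=> //; exists (em ++ em'); split.
      * by rewrite g1 h2 catA.
      * by rewrite size_cat addnS mulSn addnC leq_add.
      * by move=> x; rewrite mem_cat => /orP[/h4|/g3].
      * move=> i' j'; rewrite ltnS [(j' <= j)%N]leq_eqVlt andb_orr orbCA orbC => /orP[D|/andP[/eqP-> /eqP->]].
          by move=> sg u su sepu; rewrite mem_cat (h5 _ _ D).
        by move=> sg u su sepu; rewrite mem_cat (g4 sg u su sepu) orbT.
    + move=> s2 [I2 y20]; split=> //; apply: Iset; try lia.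
      rewrite mulSnr; case: I2 => h0 h1 [em [h2 h3 h4 h5]]; split=> //; exists em; split=> // i' j'.
      rewrite ltnS [(i' <= i)%N]leq_eqVlt => /andP[/orP[/eqP->|i'i] j'n]; apply: h5.
        by rewrite eqxx ltnS j'n orbT.
      by rewrite i'i j'n.
  - move=> s' [h0 h1 [em [h2 h3 h4 h5]]]; exists em => //; split=> //.
      apply: leq_trans h3 _; rewrite /level_count -mulnn [in leqRHS]expnS.
      by move: (_ ^ m)%N => X; apply: eq_leq; ring.
    move=> u su sepu.
    have [|i0 [j0 [sg [u' [i0n j0n su' sep' H]]]]] := @elimination_complete R d n (Ordinal dk) u (level_point s k)
      (rmem s (level_name d k k)) _ su sepu.
      by move=> r; rewrite mxE.
    rewrite (before_cons_extend _ H); apply: (h5 i0 j0) => //.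
    by rewrite ltnS i0n.
have -> : level_time m.+1 = (n.+1 * n.+1 * level_time m)%N.
  by rewrite /level_time (expnS (n.+1 ^ 2)%N m) mulnn mulnA.
rewrite [level_const m.+1 k T]/= [icost _]/=.
have NX : (n.+1 <= level_time m)%N.
  rewrite -[leqLHS]mul1n leq_mul ?expn_gt0 ?muln_gt0 //.
  by rewrite /leaf_time; case: ifP => _; rewrite ?leq_pmulr //; apply: leq_trans (leq_pmulr _ _); nia.
set X := level_time m in NX *; set c1 := level_const _ _ _; set c2 := level_const _ _ _.
move: (n.+1) (ltn0Sn n) NX => N N0 NX.
have N1 : (N <= N * N * X)%N by nia.
have N2 : (N * N <= N * N * X)%N by nia.
have N3 : (N * N * ((26 * d + 40) * N) <= (26 * d + 40) * (N * N * X))%N.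
  by rewrite mulnCA leq_mul2l leq_mul2l NX !orbT.
have -> : (N * (N * ((26 * d + 40) * N + (c1 * X + c2 * X) + 4 + 13) + 4 + 9 + 4 + 13) + 4 + 9 =
  N * N * ((26 * d + 40) * N) + (c1 + c2) * (N * N * X) + 17 * (N * N) + 30 * N + 13)%N by ring.
move: (N * N * (_ * N))%N (N * N * X)%N N1 N2 N3 => u w N1 N2 N3.
rewrite [leqRHS]mulnDl; move: ((c1 + c2) * w)%N => q.
have -> : (200 * d.+1 * w)%N = (200 * (d * w) + 200 * w)%N by ring.
rewrite (mulnDl _ 40) -(mulnA 26) in N3.
by move: (d * w)%N N3 => y; lia.
Qed.

End LeafSpec.

(** * The whole program *)

Section ProgramCode.
Variable d : nat.

Definition copy_input : cmd :=
  For 12 (reg 0) (Each (fun c => RSet (level_name d 0 c) (reg 12) (RGet c (reg 12))) d).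

Definition out_keys := [seq (true, out_name d c) | c <- iota 0 d].

(** In a sorted list a repetition is a point that does not strictly follow its predecessor, so one
    comparison suffices. The points kept overwrite the input arrays, where the output is
    expected. *)
Definition keep_step :=
  If (BAnd (BILe (INum 1) (reg 12)) (cmp_exp out_keys (IGet 1 (reg 12)) (IGet 1 (ISub (reg 12) (INum 1)))))
    Skip
    (Each (fun c => RSet c (reg 17) (RGet (out_name d c) (IGet 1 (reg 12)))) d ;;
     ISet 17 (INum 0) (IAdd (reg 17) (INum 1))).

Definition finish : cmd :=
  For 12 (reg 14) (ISet 1 (reg 12) (reg 12)) ;;
  ISet 8 (INum 0) (reg 14) ;;
  sort_cmd out_keys ;;
  ISet 17 (INum 0) (INum 0) ;;
  For 12 (reg 14) keep_step ;;
  ISet 0 (INum 0) (reg 17).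

Definition finish_cost := (100 + 3 * sort_cost out_keys + straight_cost keep_step)%N.

Definition expected_hull_program : cmd :=
  copy_input ;; levels d (d - 2) 0 [::] ;; finish.

End ProgramCode.

(** * Sorting the candidates and dropping repetitions *)

Section Finish.
Variables (R : realType) (d : nat).
Implicit Types s : state R.

Definition output_row s e : 'rV[R]_d := \row_(c < d) rmem s (out_name d c) e.

Lemma ties_out_keys s i j :
  ties (key_vals (rmem s) (out_keys d)) i j = (output_row s i == output_row s j).
Proof.
have -> : ties (key_vals (rmem s) (out_keys d)) i j =
    all (fun c => rmem s (out_name d c) i == rmem s (out_name d c) j) (iota 0 d).
  rewrite /out_keys; elim: (iota 0 d) => //= c l ->.
  by [].
apply/allP/eqP => [H|/rowP H c].
  by apply/rowP => c; rewrite !mxE; apply/eqP/H; rewrite mem_iota ltn_ord.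
rewrite mem_iota => /andP[_ cd].
by have := H (Ordinal cd); rewrite !mxE => /eqP.
Qed.

Definition kept s : seq 'rV[R]_d := mkseq (fun e => \row_(c < d) rmem s c e) (imem s 17 0).

Lemma keep_step_frame s : let s' := run (keep_step d) s in
  (forall a, a != 17%N -> imem s' a = imem s a) /\
  (forall c, rmem s' (out_name d c) = rmem s (out_name d c)).
Proof.
move=> s'; have [|Fi Fr] := @run_frame R (keep_step d) s; first by rewrite /= straight_Each.
split=> [a a17|c]; first by apply: Fi; rewrite /= Each_no_int_writes.
apply: Fr; rewrite /= orbF real_writes_Each; apply/hasPn => c'; rewrite mem_iota => /andP[_ cd] /=.
by rewrite rname_input // ltnW.
Qed.

Lemma keep_step_spec s : let k := imem s 12 0 in let r := imem s 1 in
  kept (run (keep_step d) s) = if (0 < k)%N && key_le (rmem s) (out_keys d) (r k) (r k.-1)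
    then kept s else rcons (kept s) (output_row s (r k)).
Proof.
move=> k r; rewrite /keep_step; cbn [run].
have -> : beval s (BAnd (BILe (INum 1) (reg 12))
    (cmp_exp (out_keys d) (IGet 1 (reg 12)) (IGet 1 (ISub (reg 12) (INum 1))))) =
    (0 < k)%N && key_le (rmem s) (out_keys d) (r k) (r k.-1).
  by cbn [beval]; rewrite beval_cmp_exp /= subn1.
case: ifP => // _.
pose I c s1 := [/\ imem s1 = imem s,
  forall c', rmem s1 (out_name d c') = rmem s (out_name d c'),
  forall c', (c' < c)%N -> rmem s1 c' (imem s 17 0) = rmem s (out_name d c') (r k) &
  forall c' e, (e < imem s 17 0)%N -> rmem s1 c' e = rmem s c' e].
have := @run_Each R (fun c => RSet c (reg 17) (RGet (out_name d c) (IGet 1 (reg 12)))) d I s.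
case=> [c s1 cd [I1 I2 I3 I4]|//|J1 _ J3 J4].
  split=> //= [c'|c' c'c|c' e eE]; rewrite ?I1.
  - by rewrite upd_ne ?I2 // rname_input // ltnW.
  - rewrite /upd eqxx andbT; case: eqP => [->|/eqP ne]; first by rewrite I2.
    by rewrite I3 //; lia.
  - by rewrite /upd (ltn_eqF eE) andbF I4.
rewrite /kept /= /upd /= J1 addn1 mkseqS; congr rcons.
  apply/eq_in_map => e; rewrite mem_iota => /= eE.
  by apply/rowP => c; rewrite !mxE J4.
by apply/rowP => c; rewrite !mxE J3.
Qed.

Lemma finish_spec s m : imem s 14 0 = m ->
  runs (finish d) s (finish_cost d * (m.+1 * (up_log 2 m).+1)) (fun s' =>
    [/\ uniq (output_points d s'), output_points d s' =i outputs d s & (imem s' 0 0 <= m)%N]).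
Proof.
move=> sm; eapply runs_bound.
  apply: runs_seq.
  eapply (@runs_for _ _ _ _ _ m _ (fun k s' => [/\ imem s' 14 0 = m, rmem s' = rmem s &
    forall t, (t < k)%N -> imem s' 1 t = t])).
  - by split.
  - by move=> k s' kn [].
  - move=> k s' km [I14 Ir It] xk; apply: runs_straight => //; split=> //; split=> //= t.
    by rewrite ltnS leq_eqVlt /upd /= xk => /orP[/eqP->|tk]; rewrite ?eqxx // (ltn_eqF tk) It.
  move=> s1 [I14 Ir It].
  apply: runs_seq; apply: runs_straight => //; apply: runs_seq.
  eapply runs_weaken; [eapply runs_frame; apply: (@sort_spec _ _ _ m) => //| |].
  - exact: leqnn.
  move=> s2 [[J1 J2 J3] Jf _].
  rewrite /= Ir in J3.
  apply: runs_seq; apply: runs_straight => //; apply: runs_seq.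
  pose pi := imem s2 1; pose row t := output_row s (pi t).
  pose K k s' := [/\ imem s' 14 0 = m, imem s' 1 = pi,
    forall c, rmem s' (out_name d c) = rmem s (out_name d c), (size (kept s') <= k)%N &
    uniq (kept s') /\ forall x, x \in kept s' = (x \in mkseq row k)].
  eapply (@runs_for _ _ _ _ _ m _ K).
  + split=> //=.
    * by rewrite /upd /= Jf.
    * by rewrite J1 Ir.
  + by move=> k s' kn [].
  + move=> k s' kn [K14 K1 Kr K17 [Ku Km]] xk.
    have [Fi Fr] := keep_step_frame s'; have Ks := keep_step_spec s'; cbv zeta in Ks.
    apply: runs_straight; first by rewrite /= straight_Each.
    move: (run _ s') Fi Fr Ks => s3 Fi Fr.
    have kv : key_vals (rmem s') (out_keys d) = key_vals (rmem s) (out_keys d).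
      by rewrite /key_vals /out_keys -!map_comp; apply: eq_map => c; rewrite /= /key_val Kr.
    have orow i : output_row s' i = output_row s i by apply/rowP => c; rewrite !mxE Kr.
    rewrite xk K1 orow -/(row k) /key_le kv => Ks.
    have tie t : (t <= k)%N -> ~~ before (key_vals (rmem s) (out_keys d)) (pi t) (pi k) ->
        row k = row t.
      move=> tk nb; apply/eqP; rewrite /row -ties_out_keys ties_before nb /=.
      by have := J3 t k tk kn; rewrite /key_le.
    split; first by rewrite Fi // xk.
    have -> : K k.+1 (set_int s3 12 0 k.+1) = K k.+1 s3.
      by rewrite /K /kept /= /upd /=.
    split; rewrite ?Fi //.
    * by move=> c; rewrite Fr.
    * by rewrite Ks; case: ifP; rewrite ?size_rcons // => _; apply: leqW.
    rewrite Ks mkseqS; case: ifP => [/andP[k0 nb]|nb].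
      split=> // x; rewrite Km mem_rcons inE; apply/idP/orP => [->|[/eqP->|//]]; first by right.
      by rewrite (tie k.-1) ?leq_pred // map_f // mem_iota /= ltn_predL.
    rewrite rcons_uniq Ku Km andbT; split; last by move=> x; rewrite !mem_rcons !inE Km.
    apply/negP => /mapP[t]; rewrite mem_iota /= => tk e; move/negP: nb; apply.
    have k0 : (0 < k)%N by apply: leq_ltn_trans tk.
    (* An equal row at an earlier position [t] would, by sortedness, keep row [k] from strictly
       following its predecessor. *)
    rewrite k0 /=; apply: (@key_le_trans R (rmem s) (out_keys d) (pi t)).
      by move/eqP: e; rewrite -ties_out_keys ties_before /key_le => /andP[].
    apply: J3; [lia|by rewrite (leq_ltn_trans (leq_pred k))].
  move=> s3 [K14 K1 Kr K17 [Ku Km]]; apply: runs_straight => //.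
  have -> : output_points d (run (ISet 0 (INum 0) (reg 17)) s3) = kept s3.
    by rewrite /output_points /kept /= /upd.
  split=> //.
    move=> x; rewrite Km; rewrite /outputs sm.
    have -> : mkseq row m = map (output_row s) (slice pi 0 m).
      by rewrite /slice -map_comp subn0.
    apply: perm_mem; rewrite /mkseq; apply: perm_map; rewrite (perm_trans J2) // /slice subn0.
    rewrite -[X in perm_eq _ X]map_id (_ : map _ _ = map id (iota 0 m)) //.
    by apply/eq_in_map => t; rewrite mem_iota => /andP[_ tn]; apply: It.
  by move: K17; rewrite size_mkseq /= /upd.
cbn [straight_cost icost reg]; rewrite /finish_cost.
set C := sort_cost _; set S := straight_cost _; set X := (m.+1 * _)%N.
have mX : (m.+1 <= X)%N by rewrite leq_pmulr.
have : (S * m.+1 <= S * X)%N by rewrite leq_mul2l mX orbT.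
rewrite !mulnDl mulnS (mulnC S).
rewrite -(addnA S) (mulnDr m S).
by move: (3 * C * X)%N (m * S)%N (S * X)%N => a b e; lia.
Qed.

End Finish.

Section Program.
Variables (R : realType) (d n : nat) (v : 'I_n -> 'rV[R]_d) (p : 'I_n -> R).

Definition input_reals := rmem (input_state v p).

Lemma input_reals_point (c : 'I_d) (i : 'I_n) : input_reals c i = v i 0 c.
Proof. by rewrite /input_reals /= !valK. Qed.

Lemma input_reals_prob (i : 'I_n) : input_reals d i = p i.
Proof. by rewrite /input_reals /= valK insubF ?ltnn ?eqxx. Qed.

Lemma copy_input_spec :
  runs (copy_input d) (input_state v p) ((6 * d + 20) * n.+1) (fun s =>
    level_inv v input_reals s 0 [::] /\ outputs d s = [::]).
Proof.
eapply runs_bound.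
  apply: (@runs_for _ _ _ _ _ n _ (fun k s => [/\ has_input d n input_reals s, imem s 14 0 = 0%N &
    forall (r : nat) (c : 'I_d), (r < k)%N -> rmem s (level_name d 0 c) r = input_reals c r])).
  - by split=> //; split.
  - by move=> k s kn [[]].
  - move=> k s kn [[sn sin] s14 H] xk; apply: runs_straight; first exact: straight_Each.
    pose J c s' := [/\ imem s' = imem s, forall c', (c' <= d)%N -> rmem s' c' = input_reals c',
      forall r c', (r < k)%N -> rmem s' (level_name d 0 c') r = rmem s (level_name d 0 c') r &
      forall c', (c' < c)%N -> rmem s' (level_name d 0 c') k = input_reals c' k].
    have [||J1 J2 J3 J4] := @run_Each R (fun c => RSet (level_name d 0 c) (reg 12) (RGet c (reg 12))) d J s.
    + move=> c s' cd [J1 J2 J3 J4]; split=> //= [c' c'd|r c' rk|c' c'c].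
      * by rewrite upd_ne ?J2 // rname_input.
      * by rewrite /upd J1 xk (ltn_eqF rk) andbF J3.
      * rewrite /upd J1 xk eqxx andbT rname_eq !xpair_eqE /=.
        case: eqP => [->|/eqP ne]; first by rewrite J2 // ltnW.
        by apply: J4; lia.
    + by split.
    split; first by rewrite J1.
    split; first by split; rewrite /= /upd ?J1.
      by rewrite /= /upd /= J1.
    move=> r c; rewrite ltnS leq_eqVlt => /orP[/eqP->|rk]; first exact: J4.
    by rewrite /= J3 ?H.
  - move=> s [sin s14 H]; split; last by rewrite /outputs s14.
    split=> // [c|i j _].
      by exists (delta_mx 0 c) => i; rewrite H // input_reals_point dot_delta.
    by split=> // c; rewrite !mxE !H // !input_reals_point.
rewrite (straight_cost_Each _ (K := 6)) //=.
nia.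
Qed.

Hypothesis p01 : forall i, 0 < p i < 1.
Hypothesis v_inj : injective v.

(** On the line [2 * d - 2] is 0, but sorting the points already takes time of order n log n. *)
Definition program_exponent := if d == 1%N then 1%N else (2 * d - 2)%N.

Definition program_const := (6 * d + 20 + level_const d (d - 2) 0 [::] * 2 +
  finish_cost d * ((2 ^ d).+1 * (4 * d)))%N.

Definition program_time := (n.+1 ^ program_exponent * (up_log 2 n.+1).+1)%N.

(** The power of 2 covers the [d - 2] tie-breaking signs and the sign of the last coordinate; for
    [d = 1] it is the two orders of the line. *)
Definition vertex_bound := (2 ^ d * n.+1 ^ (2 * d - 2))%N.

Lemma level_count_bound : (0 < d)%N -> (level_count d n (d - 2) <= vertex_bound)%N.
Proof.
rewrite /level_count /leaf_count /vertex_bound; case: d => // - [|m] _ //.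
rewrite (_ : m.+2 - 2 = m)%N; last lia.
rewrite (_ : 2 * m.+2 - 2 = 2 * m.+1)%N; last lia.
rewrite /= expnMn !(expnM _ 2) (expnS _ m) (expnSr 2 m.+1) (expnSr 2 m).
have : ((n * n).+1 <= n.+1 ^ 2)%N by rewrite -mulnn; nia.
move: (2 ^ m)%N ((n.+1 ^ 2) ^ m)%N (n.+1 ^ 2)%N (n * n).+1 => a b c e ec.
by rewrite -!mulnA leq_mul2l; nia.
Qed.

Lemma vertex_bound_time : (0 < d)%N -> (vertex_bound <= 2 ^ d * n.+1 ^ program_exponent)%N.
Proof.
by move=> d0; rewrite leq_mul2l leq_pexp2l ?orbT // /program_exponent; case: eqP; lia.
Qed.

Lemma level_time_bound : (0 < d)%N -> (level_time d n (d - 2) <= 2 * program_time)%N.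
Proof.
rewrite /level_time /leaf_time /program_time /program_exponent.
have lN : (up_log 2 n <= up_log 2 n.+1)%N by apply: leq_up_log.
case: d => // - [|m] _ /=.
  by rewrite mul1n expn1; nia.
rewrite (_ : m.+2 - 2 = m)%N; last lia.
rewrite (_ : 2 * m.+2 - 2 = 2 * m.+1)%N; last lia.
have l2 : (up_log 2 (n * n) <= 2 * up_log 2 n.+1)%N.
  apply: up_log_min => //; rewrite mulnC expnM -mulnn.
  have := up_logP n.+1 (isT : (1 < 2)%N); move: (2 ^ _)%N; nia.
rewrite expnM (expnSr _ m).
have : ((n * n + n).+1 <= n.+1 ^ 2)%N by rewrite -mulnn; nia.
move: (n.+1 ^ 2)%N (n * n + n).+1 => b c cb.
move: (up_log 2 (n * n)) (up_log 2 n.+1) l2 => e f l2.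
have -> : (2 * (b ^ m * b * f.+1) = b ^ m * (b * (2 * f.+1)))%N by ring.
by rewrite leq_mul2l leq_mul ?orbT //; lia.
Qed.

(** The number of candidates is polynomial in n of degree depending on [d] only, so its logarithm is
    of order log n. *)
Lemma finish_time_bound m : (0 < d)%N -> (m <= vertex_bound)%N ->
  (m.+1 * (up_log 2 m).+1 <= (2 ^ d).+1 * (4 * d) * program_time)%N.
Proof.
move=> d0 mV; have l : (up_log 2 m <= d + (2 * d - 2) * up_log 2 n.+1)%N.
  apply: up_log_min => //; apply: leq_trans mV _; rewrite /vertex_bound expnD leq_mul2l.
  apply/orP; right; rewrite (mulnC (_ - _)%N) expnM.
  by case: (2 * d - 2)%N => // q; rewrite leq_exp2r // up_logP.
rewrite /program_time mulnACA; apply: leq_mul.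
  have := leq_trans mV (vertex_bound_time d0); move: (expn_gt0 n.+1 program_exponent).
  by move: (n.+1 ^ _)%N (2 ^ d)%N => a b /=; nia.
by move: (up_log 2 n.+1) l => a; nia.
Qed.

Lemma program_spec : (0 < d)%N ->
  runs (expected_hull_program d) (input_state v p) (program_const * program_time) (fun s =>
    vertex_description (expected_hull v p) (output_points d s) /\ (imem s 0 0 <= vertex_bound)%N).
Proof.
move=> d0; have timeN : (n.+1 <= program_time)%N.
  rewrite /program_time -[leqLHS]muln1; apply: leq_mul => //.
  by rewrite -[leqLHS]expn1 leq_pexp2l // /program_exponent; case: eqP; lia.
rewrite /program_const; set a := (6 * d + 20)%N; set b := (_ * 2)%N; set c := (finish_cost d * _)%N.
rewrite 2!mulnDl -addnA; apply: runs_seq.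
apply: runs_weaken copy_input_spec _ _; first by rewrite leq_mul2l timeN orbT.
move=> s1 [inv out1]; apply: runs_seq.
apply: runs_weaken (levels_spec input_reals_point input_reals_prob p01 v_inj _ inv) _ _.
- by have [d1|/eqP d1] := eqVneq d 1%N; [right; split; lia|left; lia].
- by rewrite -mulnA leq_mul2l level_time_bound ?orbT.
move=> s2 [em]; rewrite out1 cat0s => out2 [em_size em_sound em_complete].
have em_bound := leq_trans em_size (level_count_bound d0).
apply: runs_weaken (@finish_spec R d s2 _ erefl) _ _.
  have : (imem s2 14 0 <= vertex_bound)%N by rewrite -out2 size_mkseq in em_bound.
  by move=> /(finish_time_bound d0) h; rewrite -mulnA leq_mul2l h orbT.
move=> s3 [s3_uniq s3_mem s3_count]; split.
  apply: expected_hull_vertices => // x; rewrite s3_mem out2; split; first exact: em_sound.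
  move=> [u gu ->].
  (* With no keys yet, [li_sep] identifies differences at level 0 with those of the input. *)
  have diff (i j : 'I_n) : dot u (level_point d s1 0 i) - dot u (level_point d s1 0 j) = dot u (v i) - dot u (v j).
    have [e _] := li_sep inv (i := i) (j := j) isT; rewrite -!dotBr; congr dot.
    by apply/rowP => c'; have := e c'; rewrite !mxE.
  have := em_complete u; rewrite (order_row_point input_reals_point input_reals_prob).
  rewrite (@eq_order_point _ _ _ _ _ _ (above v u)); last first.
    by move=> j i; rewrite /= andbF orbF /above -subr_lt0 diff subr_lt0.
  apply=> [c'|i j /eqP]; first by rewrite ltn0.
  rewrite -subr_eq0 diff subr_eq0 => /eqP /gu -> //.
by apply: leq_trans s3_count _; rewrite -out2 size_mkseq in em_bound.
Qed.

End Program.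

(** * From explicit bounds to asymptotic ones *)

Section Asymptotics.
Variable R : realType.

(** The bound is asked from 2 on, since [ln n] vanishes at 1. *)
Lemma eqO_nat (f : nat -> nat) (g : nat -> R) (C : R) : 0 < C ->
  (forall n, (2 <= n)%N -> (f n)%:R <= C * g n) ->
  (fun n => (f n)%:R : R^o) =O_\oo (g : nat -> R^o).
Proof.
move=> C0 H; apply/eqO_exP; exists C => //.
exists 2%N => // n /= n2; rewrite ger0_norm //; apply: le_trans (H n n2) _.
by rewrite ler_pM2l // ler_norm.
Qed.

(** The left side is [k + 2] with [2 ^ k <= n]: the term [k] costs one multiple of [ln n / ln 2] and
    the 2 costs two more, as [ln 2 <= ln n]. *)
Lemma up_log2_ln n : (2 <= n)%N -> (up_log 2 n.+1).+1%:R <= 3 / ln 2 * ln n%:R :> R.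
Proof.
move=> n2; have l2 : 0 < ln 2 :> R by rewrite ln_gt0 // ltr1n.
have nn : ln 2 <= ln n%:R :> R by rewrite ler_ln ?posrE ?ltr0n ?ler_nat //; lia.
have U0 : (0 < up_log 2 n.+1)%N by rewrite up_log_gt0 /=; lia.
have : (2 ^ (up_log 2 n.+1).-1 <= n)%N by rewrite -ltnS up_log_gtn //; lia.
rewrite -{2}(prednK U0); move: (up_log 2 n.+1).-1 => k kn.
have {}kn : k%:R * ln 2 <= ln n%:R :> R.
  by rewrite mulr_natl -lnXn // ler_ln ?posrE ?exprn_gt0 ?ltr0n -?natrX ?ler_nat //; lia.
have -> : k.+2%:R = k%:R + 2 :> R by rewrite -addn2 natrD.
rewrite mulrAC ler_pdivlMr //; move: (ln 2) (ln n%:R) (k%:R : R) nn kn => a b c; nra.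
Qed.

Lemma succ_expn_ler n e : (0 < n)%N -> (n.+1 ^ e)%:R <= 2 ^+ e * n%:R ^+ e :> R.
Proof. by move=> n0; rewrite -exprMn natrX lerXn2r ?nnegrE // -natrM ler_nat; lia. Qed.

End Asymptotics.

Lemma expected_hull_computable (R : realType) d e : (0 < d)%N -> (program_exponent d <= e)%N ->
  expected_hull_computable_in d (fun n => n%:R ^+ e * ln n%:R : R).
Proof.
move=> d0 de; exists (expected_hull_program d), (fun n => program_const d * program_time d n)%N; split.
  apply: (@eqO_nat _ _ _ (((program_const d)%:R + 1) * (2 ^+ e * (3 / ln 2)))) => [|n n2].
    by rewrite !mulr_gt0 ?ltr_wpDl ?exprn_gt0 ?invr_gt0 ?ln_gt0 ?ltr1n.
  have n0 : (0 < n)%N by apply: ltn_trans n2.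
  have l0 : 0 <= ln n%:R :> R by rewrite ln_ge0 // ler1n.
  rewrite natrM -mulrA ler_pM // ?lerDl //.
  apply: (@le_trans _ _ ((n.+1 ^ e)%:R * (up_log 2 n.+1).+1%:R)).
    by rewrite -natrM ler_nat leq_mul2r leq_pexp2l ?orbT.
  have -> : 2 ^+ e * (3 / ln 2) * (n%:R ^+ e * ln n%:R) =
    (2 ^+ e * n%:R ^+ e) * (3 / ln 2 * ln n%:R) :> R by ring.
  by rewrite ler_pM ?succ_expn_ler ?up_log2_ln.
move=> n v p [v_inj _ p01].
have [t [s [e1 tT [vd _]]]] := program_spec p01 v_inj d0.
by exists t, s.
Qed.

Theorem mainTheorem5 (R : realType) :
  (forall d : nat, (0 < d)%N ->
     (forall (n : nat) (v : 'I_n -> 'rV[R]_d) (p : 'I_n -> R),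
        stochastic_instance v p ->
        is_polytope (expected_hull v p) /\
        forall u : 'rV[R]_d,
          support_fun (expected_hull v p) u = expected_support v p u) /\
     (exists V : nat -> nat,
        (fun n => (V n)%:R : R^o) =O_\oo
          (fun n => n%:R ^+ (2 * d - 2) : R^o) /\
        forall (n : nat) (v : 'I_n -> 'rV[R]_d) (p : 'I_n -> R),
          stochastic_instance v p ->
          exists s : seq 'rV[R]_d,
            vertex_description (expected_hull v p) s /\ (size s <= V n)%N) /\
     expected_hull_computable_in d
       (fun n => n%:R ^+ (2 * d - 1) * ln n%:R : R)) /\
  expected_hull_computable_in 2 (fun n => n%:R ^+ 2 * ln n%:R : R).
Proof.
split; last by apply: expected_hull_computable.
move=> d d0; split.
  move=> n v p [v_inj _ p01]; split=> [|u]; last exact: expected_hull_support.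
  (* The halting run itself supplies the finite list spanning the expected hull. *)
  have [_ [s [_ _ [[_ _ h] _]]]] := program_spec p01 v_inj d0.
  by exists (output_points d s).
split; last first.
  by apply: expected_hull_computable => //; rewrite /program_exponent; case: eqP; lia.
exists (vertex_bound d); split.
  apply: (@eqO_nat _ _ _ ((2 ^ d)%:R * 2 ^+ (2 * d - 2))) => [|n n2].
    by rewrite mulr_gt0 ?ltr0n ?expn_gt0 ?exprn_gt0.
  by rewrite natrM -mulrA ler_pM2l ?ltr0n ?expn_gt0 // succ_expn_ler // ltnW.
move=> n v p [v_inj _ p01].
have [_ [s [_ _ [vd sV]]]] := program_spec p01 v_inj d0.
by exists (output_points d s); rewrite size_mkseq.
Qed.
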